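(* For all integers $r \geq 3$ and all integers $n$ with $n \geq 2r+1$ and $n \geq 12$, the alternating group $A_n$ has a representation as a rank $r$ string C-group; that is, there exist involutions $\rho_0,\ldots,\rho_{r-1}$ generating $A_n$ such that $(A_n,\{\rho_0,\ldots,\rho_{r-1}\})$ is a string C-group of rank $r$.
   Context: A group $\Gamma$ together with an ordered list of generating involutions (elements of order exactly 2) $\rho_0,\ldots,\rho_{r-1}$ is a rank $r$ string group generated by involutions (sggi) if $\rho_i\rho_j=\rho_j\rho_i$ whenever $|i-j|\geq 2$. It is a rank $r$ string C-group if moreover it satisfies the intersection property: for all $I,J\subseteq\{0,\ldots,r-1\}$, $\langle \rho_i \mid i\in I\rangle\cap\langle\rho_i\mid i\in J\rangle=\langle\rho_i\mid i\in I\cap J\rangle$. A group $G$ is said to have a representation as a rank $r$ string C-group if $G$ is generated by some ordered list of $r$ involutions making it a rank $r$ string C-group. *)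

(* Defs.v *)
From mathcomp Require Import all_boot all_fingroup all_solvable.

Set Implicit Arguments.
Unset Strict Implicit.
Unset Printing Implicit Defensive.

Import GroupScope.

Section StringCGroups.

Variables (gT : finGroupType) (r : nat).

Definition parabolic (rho : 'I_r -> gT) (I : {set 'I_r}) : {set gT} :=
  <<[set rho i | i in I]>>.

(* The condition |i - j| >= 2 is given for i < j only, [commute] being
   symmetric. *)
Definition is_sggi (G : {group gT}) (rho : 'I_r -> gT) : Prop :=
  [/\ parabolic rho [set: 'I_r] = G,
      forall i : 'I_r, #[rho i] = 2
    & forall i j : 'I_r, i + 2 <= j -> commute (rho i) (rho j)].

Definition intersection_property (rho : 'I_r -> gT) : Prop :=
  forall I J : {set 'I_r},
    parabolic rho I :&: parabolic rho J = parabolic rho (I :&: J).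

Definition is_string_C_group (G : {group gT}) (rho : 'I_r -> gT) : Prop :=
  is_sggi G rho /\ intersection_property rho.

End StringCGroups.

Definition has_string_C_group_rep (gT : finGroupType) (G : {group gT})
    (r : nat) : Prop :=
  exists rho : 'I_r -> gT, is_string_C_group G rho.

(* Main.v *)
(** A string C-group of even permutations in which only the first generator
    moves a given point p can be glued, along p, to the reversal of another
    one: the commutator of the two generators that move p is a 3-cycle, so that
    every interval of generators across the junction contains the alternating
    group on the orbits through p, and the intersection property only has to
    be checked inside the two arms.  Replacing rho_0, rho_1, rho_2 by rho_1,
    rho_0 rho_2 keeps the group and the intersection property and lowers the
    rank by one when rho_2 rho_3 has odd order, so in each residue class of n
    modulo 4 it is enough to reach a few ranks, the largest one included.
    Paths, ladders, two families on 2 r + 1 and 2 r + 4 points and five small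
    permutation groups do this. *)

Require Import Defs.
From mathcomp Require Import all_boot all_fingroup all_solvable.
From mathcomp Require Import zify.

Set Implicit Arguments.
Unset Strict Implicit.
Unset Printing Implicit Defensive.

Import GroupScope.

(** Two obstacles shape the details. One is parity: all generators must be even, and the generator
    that links the two rows of a ladder with m + 1 columns moves 2 (m + 1 - z) points, so m - z has
    to be odd; [tripod] and [fork] need m even for the same kind of reason. Hence the separation by
    residues modulo 4, and the linking position z, which is 0 for some classes and 1 for others. The
    other obstacle is an interval that ends at the junction: no 3-cycle is available there, and an
    element supported on an orbit of one arm must already be known to lie in the right subgroup. The
    field [arm_star] isolates this; it follows from parity for paths, from a description by signed
    permutations for ladders, and from enumeration for the small groups. Odd order enters the rank
    reduction because rho_0 commutes with rho_2 rho_3: raising rho_0 rho_2 rho_3 to the odd order of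
    rho_2 rho_3 returns rho_0. Ladders offer a long run of products of order 3 at their free end,
    but it stops before rank 3; the lowest ranks come from a path glued to a group of type {3,5} or
    {3,5,3}. On 12 points the former does not fit yet, whence the separate group [twelve]. *)

Ltac nlia := repeat match goal with H : is_true (in_mem _ _) |- _ => clear H end; lia.

(** * Intervals of generators *)

Section Generated.

Variable gT : finGroupType.
Implicit Types (rho : nat -> gT) (s : seq nat) (P Q : pred nat).

Definition gens rho s : {group gT} := <<[set x in map rho s]>>%G.

(** Arbitrary subsets of generators are cut out by [P] inside an interval, so that the intersection
    property can be proved by induction on the interval. *)
Definition itv lo hi P := [seq c <- index_iota lo hi | P c].

Lemma mem_itv lo hi P c : (c \in itv lo hi P) = [&& P c, lo <= c & c < hi].
Proof. by rewrite mem_filter mem_index_iota. Qed.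

Lemma mem_gens rho s c : c \in s -> rho c \in gens rho s.
Proof. by move=> cs; apply/mem_gen; rewrite inE map_f. Qed.

Lemma gens_sub rho s (H : {group gT}) :
  (forall c, c \in s -> rho c \in H) -> gens rho s \subset H.
Proof.
by move=> sH; rewrite gen_subG; apply/subsetP=> x; rewrite inE => /mapP[c /sH ? ->].
Qed.

Lemma gensS rho s s' : {subset s <= s'} -> gens rho s \subset gens rho s'.
Proof. by move=> ss'; apply: gens_sub => c /ss'; apply: mem_gens. Qed.

Lemma eq_gens rho s s' : s =i s' -> gens rho s = gens rho s' :> {set gT}.
Proof. by move=> e; apply/eqP; rewrite eqEsubset !gensS // => c; rewrite e. Qed.

Lemma gens_nil rho : gens rho [::] = 1 :> {set gT}.
Proof. by apply/trivgP; apply: gens_sub. Qed.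

(** Only an interval and its shift by one are compared; [intersection_stringC] recovers from this
    the property for all pairs of subsets. *)
Record stringC rho r : Prop := StringC {
  stringC_order : forall i, i < r -> #[rho i] = 2;
  stringC_comm : forall i j, i + 2 <= j -> j < r -> commute (rho i) (rho j);
  stringC_itv : forall i j, i < j -> j < r ->
    gens rho (index_iota i j) :&: gens rho (index_iota i.+1 j.+1)
      \subset gens rho (index_iota i.+1 j) }.

Section Interval.

Variables (rho : nat -> gT) (r : nat).
Hypothesis sC : stringC rho r.

Local Notation G lo hi P := (gens rho (itv lo hi P)).

Lemma itv_all lo hi : index_iota lo hi = itv lo hi predT.
Proof. by rewrite /itv filter_predT. Qed.

(** A missing generator disconnects the string: what lies below [c] commutes with what lies above
    it. *)
Lemma split_gens lo hi P c x : hi <= r -> lo <= c < hi -> ~~ P c ->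
  x \in G lo hi P ->
  exists u v, [/\ u \in G lo c P, v \in G c.+1 hi P & x = u * v].
Proof.
move=> hir /andP[loc chi] Pc.
have cuv : G c.+1 hi P \subset 'C(G lo c P).
  rewrite gen_subG; apply/subsetP=> y; rewrite inE => /mapP[d].
  rewrite mem_itv => /and3P[_ cd dhi] ->.
  apply/centP => z zG; apply/commute_sym.
  have : G lo c P \subset 'C[rho d].
    apply: gens_sub => e; rewrite mem_itv => /and3P[_ loe ec].
    apply/cent1P; apply: (stringC_comm sC); lia.
  by move/subsetP/(_ z zG)/cent1P/commute_sym.
have -> : G lo hi P = (G lo c P <*> G c.+1 hi P)%G.
  apply/val_inj/eqP; rewrite /= eqEsubset; apply/andP; split.
    apply: (@gens_sub _ _ (G lo c P <*> G c.+1 hi P)%G) => d.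
    rewrite mem_itv => /and3P[Pd lod dhi]; apply: mem_gen; rewrite inE.
    case: (ltngtP d c) => [dc|cd|dc]; last by rewrite dc (negbTE Pc) in Pd.
      by rewrite mem_gens // mem_itv Pd lod dc.
    by rewrite orbC mem_gens // mem_itv Pd cd dhi.
  rewrite join_subG !gensS // => d; rewrite !mem_itv => /and3P[-> a b]; lia.
by rewrite /= cent_joinEr // => /mulsgP[u v uG vG ->]; exists u, v.
Qed.

(** Induction on the length of the interval. If one subset is everything there is nothing to do;
    otherwise each misses a generator, both subgroups factor at the gaps, and the factors live in
    shorter intervals. The hypothesis [stringC_itv] enters only through [mid]. *)
Lemma intersection_itv d lo hi P Q : hi = lo + d -> hi <= r ->
  G lo hi P :&: G lo hi Q \subset G lo hi (predI P Q).
Proof.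
elim: d lo hi P Q => [|d IH] lo hi P Q hE hir.
  apply/subsetP=> x; rewrite inE => /andP[+ _].
  by apply/subsetP/gensS => c; rewrite !mem_itv; nlia.
have IHl P' Q' : G lo hi.-1 P' :&: G lo hi.-1 Q' \subset G lo hi.-1 (predI P' Q').
  by apply: IH; nlia.
have IHr P' Q' : G lo.+1 hi P' :&: G lo.+1 hi Q' \subset G lo.+1 hi (predI P' Q').
  by apply: IH; nlia.
have mid x : x \in G lo hi.-1 predT -> x \in G lo.+1 hi predT ->
    x \in G lo.+1 hi.-1 predT.
  move=> xl xr; case: d IH hE {IHl IHr} => [|d] _ hE.
    move: xl; apply/subsetP/gensS => c; rewrite !mem_itv; nlia.
  have lh : lo < hi.-1 by nlia.
  have hr : hi.-1 < r by nlia.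
  have /subsetP := stringC_itv sC lh hr.
  rewrite !itv_all prednK; last by nlia.
  by apply; rewrite inE xl xr.
have incl (a b a' b' : nat) (A B : pred nat) x :
    (forall c, A c -> a <= c < b -> B c && (a' <= c < b')) ->
    x \in G a b A -> x \in G a' b' B.
  move=> AB; apply/subsetP/gensS => c; rewrite !mem_itv => /and3P[Ac ac cb].
  by have := AB c Ac; rewrite ac cb => /(_ isT).
have [Pall|/allPn[c]] := boolP (all P (index_iota lo hi)).
  apply/subsetP=> x; rewrite inE => /andP[_]; apply: incl => c Qc loc.
  by rewrite /= Qc loc (allP Pall) // mem_index_iota.
rewrite mem_index_iota => cI Pc.
have [Qall|/allPn[e]] := boolP (all Q (index_iota lo hi)).
  apply/subsetP=> x; rewrite inE => /andP[+ _]; apply: incl => b Pb lob.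
  by rewrite /= Pb lob (allP Qall) // mem_index_iota.
rewrite mem_index_iota => eI Qe.
(* Case where [P'] lacks the top generator. The factor [v] of [x] above the gap [f] of [Q'] lies in
   both shortened intervals, so [mid] removes the top generator from it as well, and the induction
   hypothesis applies below the top. *)
have missr (P' Q' : pred nat) f x : ~~ P' hi.-1 -> lo <= f < hi -> ~~ Q' f ->
    x \in G lo hi P' -> x \in G lo hi Q' -> x \in G lo hi (predI P' Q').
  move=> Phi fI Qf xP xQ.
  have xP1 : x \in G lo hi.-1 P'.
    apply: incl xP => b Pb bI; rewrite Pb /=.
    by have : b != hi.-1 by [apply: contraTneq Pb => ->]; nlia.
  have [Qhi|Qhi] := boolP (Q' hi.-1); last first.
    have xQ1 : x \in G lo hi.-1 Q'.
      apply: incl xQ => b Qb bI; rewrite Qb /=.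
      by have : b != hi.-1 by [apply: contraTneq Qb => ->]; nlia.
    have /subsetP := IHl P' Q'; move/(_ x); rewrite inE xP1 xQ1 => /(_ isT).
    by apply: incl => b /= ->; nlia.
  have fhi : f != hi.-1 by apply: contraNneq Qf => ->.
  have [u [v [uG vG xE]]] := split_gens hir fI Qf xQ.
  have uG' : u \in G lo hi.-1 Q' by apply: incl uG => b /= ->; nlia.
  have vl : v \in G lo hi.-1 predT.
    have -> : v = u^-1 * x by rewrite xE mulKg.
    rewrite groupM ?groupV //; first by apply: incl uG' => b /=; nlia.
    by apply: incl xP1 => b /=; nlia.
  have vr : v \in G lo.+1 hi Q' by apply: incl vG => b /= ->; nlia.
  have vm : v \in G lo.+1 hi (fun b => b < hi.-1).
    have : v \in G lo.+1 hi.-1 predT.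
      by apply: mid => //; apply: incl vr => b /=; nlia.
    by apply: incl => b /=; nlia.
  have v' : v \in G lo hi.-1 Q'.
    have /subsetP/(_ v) := IHr Q' (fun b => b < hi.-1).
    rewrite inE vr vm => /(_ isT).
    by apply: incl => b /= /andP[-> ->]; nlia.
  have xQ1 : x \in G lo hi.-1 Q' by rewrite xE groupM.
  have /subsetP/(_ x) := IHl P' Q'; rewrite inE xP1 xQ1 => /(_ isT).
  by apply: incl => b /= ->; nlia.
(* Mirror image of [missr] at the bottom of the interval. *)
have missl (P' Q' : pred nat) f x : ~~ P' lo -> lo <= f < hi -> ~~ Q' f ->
    x \in G lo hi P' -> x \in G lo hi Q' -> x \in G lo hi (predI P' Q').
  move=> Plo fI Qf xP xQ.
  have xP1 : x \in G lo.+1 hi P'.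
    apply: incl xP => b Pb bI; rewrite Pb /=.
    by have : b != lo by [apply: contraTneq Pb => ->]; nlia.
  have [Qlo|Qlo] := boolP (Q' lo); last first.
    have xQ1 : x \in G lo.+1 hi Q'.
      apply: incl xQ => b Qb bI; rewrite Qb /=.
      by have : b != lo by [apply: contraTneq Qb => ->]; nlia.
    have /subsetP := IHr P' Q'; move/(_ x); rewrite inE xP1 xQ1 => /(_ isT).
    by apply: incl => b /= ->; nlia.
  have flo : f != lo by apply: contraNneq Qf => ->.
  have [u [v [uG vG xE]]] := split_gens hir fI Qf xQ.
  have vG' : v \in G lo.+1 hi Q' by apply: incl vG => b /= ->; nlia.
  have ur : u \in G lo.+1 hi predT.
    have -> : u = x * v^-1 by rewrite xE mulgK.
    rewrite groupM ?groupV //; last by apply: incl vG' => b /=; nlia.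
    by apply: incl xP1 => b /=; nlia.
  have ul : u \in G lo hi.-1 Q' by apply: incl uG => b /= ->; nlia.
  have um : u \in G lo hi.-1 (fun b => lo < b).
    have : u \in G lo.+1 hi.-1 predT.
      by apply: mid => //; apply: incl ul => b /=; nlia.
    by apply: incl => b /=; nlia.
  have u' : u \in G lo.+1 hi Q'.
    have /subsetP/(_ u) := IHl Q' (fun b => lo < b).
    rewrite inE ul um => /(_ isT).
    by apply: incl => b /= /andP[-> ->]; nlia.
  have xQ1 : x \in G lo.+1 hi Q' by rewrite xE groupM.
  have /subsetP/(_ x) := IHr P' Q'; rewrite inE xP1 xQ1 => /(_ isT).
  by apply: incl => b /= ->; nlia.
(* The two factorizations x = u v = u' v' at the gaps f <= h are compared: [w], which is both a
   quotient of the lower factors and one of the upper factors, only involves generators strictly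
   between f and h. *)
have gap (P' Q' : pred nat) f h x : lo <= f -> f <= h -> h < hi -> ~~ P' f -> ~~ Q' h ->
    x \in G lo hi P' -> x \in G lo hi Q' -> x \in G lo hi (predI P' Q').
  move=> lof fh hhi Pf Qh xP xQ.
  have fI : lo <= f < hi by nlia.
  have hI : lo <= h < hi by nlia.
  have [u [v [uG vG xE]]] := split_gens hir fI Pf xP.
  have [u' [v' [uG' vG' xE']]] := split_gens hir hI Qh xQ.
  have hb : hi.-1 < hi by nlia.
  pose w := u'^-1 * u.
  have wE : w = v' * v^-1.
    by apply: (mulIg v); rewrite mulgKV /w -mulgA -xE xE' mulKg.
  have wl : w \in G lo h predT.
    rewrite groupM ?groupV //; first by apply: incl uG' => b /=; nlia.
    by apply: incl uG => b /=; nlia.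
  have wr : w \in G f.+1 hi predT.
    rewrite wE groupM ?groupV //; first by apply: incl vG' => b /=; nlia.
    by apply: incl vG => b /=; nlia.
  have wm : w \in G lo.+1 hi.-1 predT.
    by apply: mid; [apply: incl wl|apply: incl wr] => b /=; nlia.
  have wm1 : w \in G lo hi.-1 (fun b => (lo < b) && (b < h)).
    have /subsetP/(_ w) := IHl (fun b => lo < b) (fun b => b < h).
    have w1 : w \in G lo hi.-1 (fun b => lo < b).
      by apply: incl wm => b /=; nlia.
    have w2 : w \in G lo hi.-1 (fun b => b < h).
      by apply: incl wl => b /=; nlia.
    by rewrite inE w1 w2 => /(_ isT).
  have wm2 : w \in G lo.+1 hi (fun b => (f < b) && (b < h)).
    have /subsetP/(_ w) := IHr (fun b => f < b) (fun b => b < h).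
    have w1 : w \in G lo.+1 hi (fun b => f < b).
      by apply: incl wr => b /=; nlia.
    have w2 : w \in G lo.+1 hi (fun b => b < h).
      by apply: incl wm1 => b /=; nlia.
    by rewrite inE w1 w2 => /(_ isT).
  (* Since u' is u times the inverse of [w], it lies in the subgroup of [A], which still misses f.
     Splitting u' there produces [al], common to [P'] and [Q']; the remaining factor of [x] lies
     above f, so it misses [lo] and [missl] concludes. *)
  pose A b := (b < f) && P' b || (f < b) && (b < h).
  have u'A : u' \in G lo hi.-1 A.
    have -> : u' = u * w^-1 by rewrite /w invMg invgK mulKVg.
    rewrite groupM ?groupV //.
      by apply: incl uG => b; rewrite /A => ->; nlia.
    by apply: incl wm2 => b /= bI ?; rewrite /A bI orbT; nlia.
  have u'Q : u' \in G lo hi.-1 Q'.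
    by apply: incl uG' => b /= ->; nlia.
  have u'2 : u' \in G lo hi.-1 (predI A Q').
    have /subsetP/(_ u') := IHl A Q'.
    by rewrite inE u'A u'Q => /(_ isT).
  have hir1 : hi.-1 <= r by nlia.
  have [fhi|fhi] := eqVneq f hi.-1.
    by apply: missr xP xQ; [rewrite -fhi|exact: hI|].
  have fI1 : lo <= f < hi.-1 by nlia.
  have ANf : ~~ predI A Q' f by rewrite /= /A; nlia.
  have [al [be [alG beG u'E]]] := split_gens hir1 fI1 ANf u'2.
  have alP : al \in G lo hi (predI P' Q').
    by apply: incl alG => b /= /andP[+ ->]; rewrite /A; case: (P' b) => /=; nlia.
  have alP1 : al \in G lo hi P' by apply: incl alP => b /= /andP[-> _].
  pose B b := (f < b) && Q' b.
  have rest : al^-1 * x \in G lo hi B.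
    rewrite xE' u'E -!mulgA mulKg groupM //.
      by apply: incl beG => b /= /andP[_]; rewrite /B => ->; nlia.
    by apply: incl vG' => b; rewrite /B => ->; nlia.
  have rest2 : al^-1 * x \in G lo hi P' by rewrite groupM // groupV.
  have Blo : ~~ B lo by rewrite /B; nlia.
  have := missl B P' f _ Blo fI Pf rest rest2.
  move=> restI; rewrite -(mulKVg al x) groupM //.
  by apply: incl restI => b /= /andP[/andP[_ ->] ->].
apply/subsetP=> x; rewrite inE => /andP[xP xQ].
have [ce|ec] := leqP c e.
  by apply: (gap P Q c e) => //; nlia.
have := gap Q P e c x; rewrite Pc Qe xP xQ.
move=> /(_ _ _ _ isT isT isT isT) h.
have: x \in G lo hi (predI Q P) by apply: h; nlia.
by apply: incl => b /= /andP[-> ->].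
Qed.

Lemma intersection_stringC P Q :
  G 0 r P :&: G 0 r Q = G 0 r (predI P Q).
Proof.
apply/eqP; rewrite eqEsubset (@intersection_itv r) // subsetI !gensS // => c;
  by rewrite !mem_itv /= => /andP[/andP[? ?] ->]; apply/andP.
Qed.

End Interval.

End Generated.

Section Conversion.

Variable gT : finGroupType.
Implicit Types (rho : nat -> gT).

Lemma stringC_rep (G : {group gT}) rho r :
  stringC rho r -> gens rho (index_iota 0 r) = G :> {set gT} ->
  has_string_C_group_rep G r.
Proof.
move=> sC GE.
pose P (I : {set 'I_r}) c := [exists i : 'I_r, (i == c :> nat) && (i \in I)].
have parE (I : {set 'I_r}) :
    parabolic (fun i : 'I_r => rho i) I = gens rho (itv 0 r (P I)).
  congr <<_>>; apply/setP=> x; rewrite inE; apply/imsetP/mapP.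
    case=> i iI ->; exists (val i) => //; rewrite mem_itv ltn_ord !andbT.
    by apply/existsP; exists i; rewrite eqxx.
  case=> c; rewrite mem_itv => /andP[/existsP[i /andP[/eqP <- iI]] _] ->.
  by exists i.
exists (fun i => rho i); split; first split.
- rewrite parE -GE; apply: eq_gens => c; rewrite mem_itv mem_index_iota.
  rewrite andbC; have [cr|//] := boolP (0 <= c < r).
  by apply/existsP; exists (Ordinal (proj2 (andP cr))); rewrite inE eqxx.
- by move=> i; apply: (stringC_order sC).
- by move=> i j ij; apply: (stringC_comm sC).
move=> I J; rewrite !parE (intersection_stringC sC); apply: eq_gens => c.
rewrite !mem_itv; congr (_ && _); apply/andP/existsP.
  case=> /existsP[i /andP[/eqP ic iI]] /existsP[j /andP[/eqP jc jJ]].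
  exists i; rewrite ic eqxx inE iI.
  by have -> : i = j by apply: val_inj; rewrite /= ic jc.
case=> i /andP[ic]; rewrite inE => /andP[iI iJ].
by split; apply/existsP; exists i; rewrite ic ?iI ?iJ.
Qed.

(* In the dihedral group <a, b> the rotations are inverted by a, so that an
   involution among them commutes with a. *)
Lemma dihedral_commute (a b c : gT) :
  #[a] = 2 -> #[b] = 2 -> c ^+ 2 = 1 -> commute c b -> c \in <<[set a; b]>> ->
  commute c a \/ commute (c * b) a.
Proof.
move=> a2 b2 c2 cb cD.
have aa : a * a = 1 by rewrite -[a * a]/(a ^+ 2) -a2 expg_order.
have bb : b * b = 1 by rewrite -[b * b]/(b ^+ 2) -b2 expg_order.
have aV : a^-1 = a by apply/(mulIg a); rewrite mulVg.
have bV : b^-1 = b by apply/(mulIg b); rewrite mulVg.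
have rotN y : y \in <[a * b]> -> y ^+ 2 = 1 -> commute y a.
  case/cycleP=> n -> y2.
  have yV : ((a * b) ^+ n)^-1 = (a * b) ^+ n.
    by apply/(mulIg ((a * b) ^+ n)); rewrite mulVg; apply: esym y2.
  have : ((a * b) ^+ n) ^ a = (a * b) ^+ n.
    by rewrite conjXg -[RHS]yV -expgVn invMg aV bV conjgE aV !mulgA aa mul1g.
  by move/conjg_fixP/commgP.
have nb : <[b]> \subset 'N(<[a * b]>).
  rewrite cycle_subG; apply/normP; rewrite -cycleJ conjgE bV -!mulgA bb mulg1.
  by rewrite -cycleV invMg aV bV.
have sD : <<[set a; b]>> \subset <[a * b]> * <[b]>.
  rewrite -norm_joinEr // gen_subG subUset !sub1set.
  have bJ : b \in <[a * b]> <*> <[b]> by rewrite mem_gen // inE orbC cycle_id.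
  rewrite bJ andbT -{1}[a](mulgK b) groupM ?groupV //.
  by rewrite mem_gen // inE cycle_id.
case/mulsgP: (subsetP sD _ cD) => y z yR zb cE; move: zb.
rewrite cycle2g // !inE => /orP[] /eqP zE; rewrite {}zE in cE.
  by left; apply: rotN => //; rewrite cE mulg1.
right; apply: rotN; first by rewrite cE -mulgA bb mulg1.
by rewrite expgMn // c2 mul1g -[b ^+ 2]/(b * b).
Qed.

(** * Rank reduction *)

Section FrontReduction.

Variables (rho : nat -> gT) (r : nat).
Hypotheses (sC : stringC rho r.+1) (r3 : 3 <= r).
Hypotheses (nc01 : ~ commute (rho 0) (rho 1)) (nc12 : ~ commute (rho 1) (rho 2)).
Hypothesis odd23 : odd #[rho 2 * rho 3].

Definition merge c := if c is c'.+1 then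
    if c' is _.+1 then rho c.+1 else rho 0 * rho 2 else rho 1.

Local Notation G P := (gens rho (itv 0 r.+1 P)).

Let rho_in (P : pred nat) c : P c -> c <= r -> rho c \in G P.
Proof. by move=> Pc cr; apply: mem_gens; rewrite mem_itv Pc. Qed.

Let GI P Q x : x \in G P -> x \in G Q -> x \in G (predI P Q).
Proof. by move=> xP xQ; rewrite -intersection_stringC // inE xP. Qed.

Let GS (P Q : pred nat) x : (forall c, P c -> c <= r -> Q c) -> x \in G P -> x \in G Q.
Proof.
move=> PQ; apply/subsetP/gensS => c; rewrite !mem_itv => /and3P[Pc _ cr].
by rewrite PQ.
Qed.

Let sqr c : c <= r -> rho c * rho c = 1.
Proof. by move=> cr; rewrite -[_ * _]/(rho c ^+ 2) -(stringC_order sC cr) expg_order. Qed.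

Let cm i j : i + 2 <= j <= r -> rho i * rho j = rho j * rho i.
Proof. by case/andP=> ij jr; apply: (stringC_comm sC). Qed.

Let triv (P : pred nat) x : (forall c, c <= r -> ~~ P c) -> x \in G P -> x = 1.
Proof.
move=> P0 xP; apply/set1P; apply: subsetP xP; apply: gens_sub => c.
by rewrite mem_itv => /and3P[Pc _ cr]; have := P0 c cr; rewrite Pc.
Qed.

Let neq c d : c < d <= r -> rho c <> rho d.
Proof.
case/andP=> cd dr e; have c1 : rho c = 1.
  apply: (@triv (predI (pred1 c) (pred1 d))) => [b _|]; first by rewrite /=; lia.
  by apply: GI; [|rewrite e]; apply: rho_in => //=; lia.
have : #[rho c] = 2 by apply: (stringC_order sC); lia.
by rewrite c1 order1.
Qed.

(** Old indices behind the new generators: the new index 1 stands for 0 and 2, later ones are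
    shifted by one. The second clause removes the old index 1 from a range that starts at 0. *)
Let P1 i j : pred nat := fun c => (i <= c < j) && ((i != 0) || (c != 1)%N).

Let upper i j : i < j -> j <= r -> 0 < i ->
  gens merge (index_iota i j) \subset G (P1 (if i == 1%N then 0 else i.+1) j.+1).
Proof.
move=> ij jr i0; apply: gens_sub => -[|[|c]]; rewrite mem_index_iota; try lia.
  move=> /= iE; have -> : i = 1%N by lia.
  by rewrite eqxx groupM // rho_in /P1 //=; lia.
by move=> cI; apply: rho_in; rewrite /P1; [case: eqP|]; lia.
Qed.

Let upper0 j : j <= r -> gens merge (index_iota 0 j) \subset G (fun c => c < maxn 3 j.+1).
Proof.
move=> jr; apply: gens_sub => -[|[|c]]; rewrite mem_index_iota => cI.
- by apply: rho_in; lia.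
- by rewrite groupM // rho_in //=; lia.
by apply: rho_in; lia.
Qed.

Let rho0_in : rho 0 \in <<[set rho 0 * rho 2; rho 3]>>.
Proof.
have c0 : commute (rho 0) (rho 2 * rho 3).
  by apply: commuteM; apply: cm; lia.
have : (rho 0 * (rho 2 * rho 3)) ^+ #[rho 2 * rho 3] = rho 0.
  rewrite expgMn // expg_order mulg1 -[#[_ * _]]odd_double_half odd23.
  by rewrite expgS -mul2n expgM -[rho 0 ^+ 2]/(rho 0 * rho 0) sqr // expg1n mulg1.
move=> {1}<-; apply: groupX; rewrite mulgA.
by rewrite groupM // mem_gen // !inE eqxx ?orbT.
Qed.

Let lower (H : {group gT}) : rho 0 * rho 2 \in H -> rho 3 \in H ->
  (rho 0 \in H) && (rho 2 \in H).
Proof.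
move=> h02 h3; have h0 : rho 0 \in H.
  have : <<[set rho 0 * rho 2; rho 3]>> \subset H by rewrite gen_subG subUset !sub1set h02.
  by move/subsetP; apply.
by rewrite h0 -(mulKg (rho 0) (rho 2)) groupM ?groupV.
Qed.

Let m_in i j c : i <= c < j -> merge c \in gens merge (index_iota i j).
Proof. by move=> cI; apply: mem_gens; rewrite mem_index_iota. Qed.

(** From j = 3 on, [rho 3] is present, so that [rho 0] and [rho 2] can be separated and merging
    loses nothing. *)
Let full1 j : 3 <= j <= r -> G (P1 0 j.+1) \subset gens merge (index_iota 1 j).
Proof.
case/andP=> j3 jr.
have /andP[h0 h2] : (rho 0 \in gens merge (index_iota 1 j))
    && (rho 2 \in gens merge (index_iota 1 j)).
  apply: lower; first by apply: (@m_in 1 j 1); lia.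
  by apply: (@m_in 1 j 2); lia.
apply: gens_sub => c; rewrite mem_itv /P1.
case: c => [|[|[|c]]] cI //; first lia.
by apply: (@m_in 1 j c.+2); lia.
Qed.

Let shift i j : 2 <= i -> j <= r -> G (P1 i.+1 j.+1) \subset gens merge (index_iota i j).
Proof.
move=> i2 jr; apply: gens_sub => -[|[|[|c]]]; rewrite mem_itv /P1 => cI; try lia.
by apply: (@m_in i j c.+2); lia.
Qed.

Lemma gens_merge :
  gens merge (index_iota 0 r) = gens rho (index_iota 0 r.+1) :> {set gT}.
Proof.
apply/eqP; rewrite eqEsubset; apply/andP; split.
  have := upper0 (leqnn r); have -> : maxn 3 r.+1 = r.+1 by lia.
  move/subset_trans; apply; apply: gensS => c; rewrite mem_itv mem_index_iota; lia.
have sub1 : gens merge (index_iota 1 r) \subset gens merge (index_iota 0 r).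
  by apply: gensS => c; rewrite !mem_index_iota; lia.
apply: gens_sub => -[|[|c]]; rewrite mem_index_iota => cI.
- by apply/(subsetP sub1)/(subsetP (full1 _)); [lia|apply: rho_in].
- by apply: (@m_in 0 r 0); lia.
by apply/(subsetP sub1)/(subsetP (full1 _)); [lia|apply: rho_in; rewrite /P1; lia].
Qed.

(** If [rho 1] commuted with [rho 0 * rho 2], the squares of [rho 0 * rho 1] and [rho 2 * rho 1]
    would coincide and, by the intersection property, lie in the group of order 2 generated by
    [rho 1]. Both of its elements are impossible. *)
Lemma merge_nc01 : ~ commute (merge 0) (merge 1).
Proof.
rewrite /commute /= => c1.
pose w := rho 0 * rho 1 * rho 0 * rho 1.
have r02 : rho 0 * rho 2 = rho 2 * rho 0 by apply: cm; lia.
have wE : w = rho 2 * rho 1 * rho 2 * rho 1.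
  rewrite /w; congr (_ * _).
  apply: (mulIg (rho 2)); rewrite -!mulgA sqr ?mulg1; last lia.
  rewrite c1 r02 mulgA.
  by rewrite -[rho 2 * rho 0]r02 -!mulgA (mulgA (rho 0)) sqr // mul1g.
have : w \in G (predI (fun c => c < 2) (fun c => 0 < c < 3)).
  apply: GI; first by rewrite !groupM // rho_in //; lia.
  by rewrite wE !groupM // rho_in //; lia.
have s1 c : predI (fun c => c < 2) (fun c => 0 < c < 3) c -> c <= r -> pred1 1%N c.
  by move=> /=; lia.
move/(GS s1).
have /subsetP sub : G (pred1 1%N) \subset <[rho 1]>.
  by apply: gens_sub => c; rewrite mem_itv => /andP[/eqP -> _]; apply: cycle_id.
have o1 : #[rho 1] = 2 by apply: (stringC_order sC); lia.
move/sub; rewrite cycle2g // !inE.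
case/orP=> /eqP; rewrite /w => e.
  apply: nc01; rewrite /commute; apply: (mulIg (rho 0)); apply: (mulIg (rho 1)).
  rewrite e; have -> : rho 1 * rho 0 * rho 0 * rho 1 = rho 1 * (rho 0 * rho 0) * rho 1.
    by rewrite !mulgA.
  by rewrite sqr // mulg1 sqr //; lia.
have : rho 1 = 1.
  have : rho 0 * rho 1 * rho 0 = 1 by apply: (mulIg (rho 1)); rewrite mul1g.
  move=> e'; apply: (mulgI (rho 0)); apply: (mulIg (rho 0)).
  by rewrite e' mulg1 sqr.
by move=> e1; rewrite e1 order1 in o1.
Qed.

(** Otherwise [rho 2] and [rho 3] would commute, the odd order of their product would divide 2, and
    they would be equal. *)
Lemma merge_nc12 : ~ commute (merge 1) (merge 2).
Proof.
rewrite /commute /= => c1.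
have c23 : rho 2 * rho 3 = rho 3 * rho 2.
  apply: (mulgI (rho 0)); rewrite !mulgA c1.
  by have -> : rho 0 * rho 3 = rho 3 * rho 0 by [apply: cm; lia]; rewrite mulgA.
have : (rho 2 * rho 3) ^+ 2 = 1.
  by rewrite expgMn // -[rho 2 ^+ 2]/(_ * _) -[rho 3 ^+ 2]/(_ * _) !sqr ?mulg1 //; lia.
move=> e2.
have /eqP e1 : rho 2 * rho 3 == 1.
  rewrite -order_eq1; have : #[rho 2 * rho 3] %| 2 by rewrite order_dvdn e2.
  by move/(@dvdn_leq _ 2 isT); move: odd23; case: #[_] => [|[|[|?]]].
apply: (@neq 2 3); first lia.
by apply: (mulIg (rho 3)); rewrite e1 sqr //; lia.
Qed.

(** Where merged subgroups agree with old ones, the old intersection property suffices. The delicate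
    case is the pair {0, 1} against {1, 2}, since the first does not contain [rho 3] and cannot
    separate [rho 0] from [rho 2]. *)
Lemma stringC_merge : stringC merge r.
Proof.
have r02 : commute (rho 0) (rho 2) by apply: (stringC_comm sC); lia.
have m2 i : i < r -> #[merge i] = 2.
  case: i => [|[|i]] ir /=; [| |by apply: (stringC_order sC); lia].
    by apply: (stringC_order sC); lia.
  apply: nt_prime_order => //.
    by rewrite expgMn // -[rho 0 ^+ 2]/(_ * _) -[rho 2 ^+ 2]/(_ * _) !sqr ?mulg1 //; lia.
  apply/eqP=> e; apply: (@neq 0 2); first lia.
  by apply: (mulIg (rho 2)); rewrite e sqr //; lia.
split=> // [i j ij jr|i j ij jr].
  case: j ij jr => [|[|j]] ij jr; try lia.
  case: i ij => [|[|i]] ij /=; first by apply: (stringC_comm sC); lia.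
    by apply/commute_sym/commuteM; apply/commute_sym/(stringC_comm sC); lia.
  by apply: (stringC_comm sC); lia.
apply/subsetP=> x; rewrite inE => /andP[xl xr].
case: i ij xl xr => [|i] ij xl xr; last first.
  have {}xl := subsetP (@upper i.+1 j ij (ltnW jr) isT) _ xl.
  have {}xr := subsetP (@upper i.+2 j.+1 ij jr isT) _ xr.
  apply: (subsetP (@shift i.+2 j isT (ltnW jr))).
  by apply: GS (GI xl xr) => c; rewrite /= /P1; case: eqP; lia.
have {}xr := subsetP (@upper 1 j.+1 ij jr isT) _ xr.
have {}xl' := subsetP (upper0 (ltnW jr)) _ xl.
have xI := GI xl' xr; rewrite /= in xI.
have [j3|j3] := leqP 3 j.
  apply: (subsetP (full1 _)); first by rewrite j3 ltnW.
  by apply: GS xI => c /=; rewrite /P1; lia.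
have {j3} j12 : (j == 1)%N || (j == 2)%N by lia.
case/orP: j12 => /eqP jE; rewrite {j}jE in ij jr xl xl' xr xI *.
  have {}xl : x \in G (pred1 1%N).
    apply: subsetP xl; apply: gens_sub => c; rewrite mem_index_iota => cI.
    by have -> : c = 0 by [lia]; apply: rho_in => //; lia.
  rewrite (triv _ (GI xl xr)) // => c _; rewrite /= /P1; lia.
have x02 : x \in G (fun c => (c == 0) || (c == 2))%N.
  by apply: GS xI => c /=; rewrite /P1; lia.
have [o0 o1 o2] : [/\ #[rho 0] = 2, #[rho 1] = 2 & #[rho 2] = 2].
  by split; apply: (stringC_order sC); nlia.
have {}x02 : x \in <[rho 0]> * <[rho 2]>.
  have c02 : <[rho 2]> \subset 'C(<[rho 0]>).
    by rewrite cent_cycle cycle_subG; apply/cent1P.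
  rewrite -(cent_joinEr c02); apply: subsetP x02.
  apply: (gens_sub (H := (<[rho 0]> <*> <[rho 2]>)%G)) => c.
  rewrite mem_itv => /and3P[/orP[]/eqP -> _ _]; rewrite mem_gen // inE cycle_id //.
  by rewrite orbT.
have xD : x \in <<[set rho 1; rho 0 * rho 2]>>.
  apply: subsetP xl; apply: (gens_sub (H := <<[set rho 1; (rho 0 * rho 2)%g]>>%G)) => c.
  rewrite mem_index_iota.
  by case: c => [|[|c]] // _; rewrite mem_gen // !inE eqxx ?orbT.
(* The element [x] lies in the four-group of [rho 0] and [rho 2] and must be a power of their
   product. Were one of the two factors in the dihedral group of [rho 1] and [rho 0 * rho 2], then
   by [dihedral_commute] it or the other one would commute with [rho 1]. *)
have dih c : c = rho 0 \/ c = rho 2 ->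
    ~ (c \in <<[set rho 1; rho 0 * rho 2]>>).
  move=> cE cD.
  have c2 : c ^+ 2 = 1 by case: cE => ->; apply: sqr; nlia.
  have ccb : commute c (rho 0 * rho 2).
    by case: cE => ->; apply: commuteM => //; apply/commute_sym.
  have i1 : 1 < r by nlia.
  have [] := dihedral_commute o1 (m2 _ i1) c2 ccb cD.
    by case: cE => -> // /commute_sym.
  rewrite /=; case: cE => ->.
    by rewrite mulgA sqr // mul1g => /commute_sym.
  by rewrite r02 mulgA sqr ?mul1g //; lia.
case/mulsgP: x02 => y z; rewrite !cycle2g // !inE.
case/orP=> /eqP -> /orP[]/eqP -> xE; rewrite {}xE in xl xl' xr xI xD *.
- by rewrite mulg1.
- by rewrite mul1g in xD; case: (dih (rho 2%N) _ xD); right.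
- by rewrite mulg1 in xD; case: (dih (rho 0%N) _ xD); left.
exact: (@m_in 1 2 1).
Qed.

End FrontReduction.

(** Here [t] counts the reductions that can be made. Each one shifts the generators from index 3 on
    down by one, so the products at positions 2 to t + 1 are consumed in turn. *)
Definition reducible_rep (G : {group gT}) r t := exists rho : nat -> gT,
  [/\ stringC rho r, gens rho (index_iota 0 r) = G :> {set gT},
      ~ commute (rho 0%N) (rho 1%N), ~ commute (rho 1%N) (rho 2%N)
    & forall i, 2 <= i -> i <= t.+1 -> i.+1 < r -> odd #[rho i * rho i.+1]].

Lemma rank_reduction (G : {group gT}) r t r' :
  reducible_rep G r t -> r - t <= r' <= r -> 3 <= r' -> has_string_C_group_rep G r'.
Proof.
elim: t r => [|t IH] r [rho [sC GE nc01 nc12 od]] r'I r3.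
  by have <- : r = r' by [lia]; apply: stringC_rep GE.
have [<-|rr'] := eqVneq r r'; first exact: stringC_rep GE.
case: r rr' r'I sC GE od => [|r] rr' r'I sC GE od; first lia.
have rr : 3 <= r by lia.
have o23 : odd #[rho 2 * rho 3] by apply: od.
apply: (IH r) => //; last lia.
exists (merge rho); split.
- exact: stringC_merge.
- by rewrite gens_merge.
- by apply: (merge_nc01 sC).
- by apply: (merge_nc12 sC).
by move=> [|[|i]] // _ it ir /=; apply: od.
Qed.

End Conversion.

(** * Alternating groups from 3-cycles *)

Section ThreeCycles.

Variable T : finType.
Implicit Types (x y z : T) (S : {set T}) (G : {group {perm T}}).

(** Products of permutations act from left to right, so this is the cycle x -> y -> z -> x. *)
Definition cyc3 x y z : {perm T} := tperm x y * tperm x z.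

Lemma cyc3J x y z (g : {perm T}) : cyc3 x y z ^ g = cyc3 (g x) (g y) (g z).
Proof. by rewrite conjMg !tpermJ. Qed.

Lemma cyc3E x y z : uniq [:: x; y; z] ->
  [/\ cyc3 x y z x = y, cyc3 x y z y = z, cyc3 x y z z = x
    & forall t, t \notin [:: x; y; z] -> cyc3 x y z t = t].
Proof.
rewrite /= !inE negb_or andbT => /andP[/andP[xy xz] yz]; split.
- by rewrite permM tpermL tpermD // eq_sym.
- by rewrite permM tpermR tpermL.
- by rewrite permM (tpermD xz yz) tpermR.
by move=> t; rewrite !inE !negb_or => /and3P[tx ty tz]; rewrite permM !tpermD // eq_sym.
Qed.

Lemma cyc3_rot x y z : uniq [:: x; y; z] -> cyc3 x y z = cyc3 y z x.
Proof.
rewrite /= !inE negb_or andbT => /andP[/andP[xy xz] yz].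
rewrite /cyc3 (tpermC y x) -[RHS](mulKg (tperm x y)) tpermV mulgA tperm2 mul1g.
have -> : tperm y z = tperm x z ^ tperm x y.
  by rewrite tpermJ tpermL tpermD // eq_sym.
by rewrite conjgE tpermV !mulgA -(mulgA _ _ (tperm x y)) tperm2 mulg1.
Qed.

Lemma cyc3V x y z : (cyc3 x y z)^-1 = cyc3 x z y.
Proof. by rewrite /cyc3 invMg !tpermV. Qed.

Lemma odd_cyc3 x y z : uniq [:: x; y; z] -> odd_perm (cyc3 x y z) = false.
Proof.
rewrite /= !inE negb_or andbT => /andP[/andP[xy xz] _].
by rewrite odd_permM !odd_tperm xy xz.
Qed.

(** A formulation by 3-cycles is easy to extend by one point. It is vacuous on fewer than three
    points, which starts the induction of [tripod_alt]. *)
Definition alt_on G S := [forall x in S, forall y in S, forall z in S,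
  uniq [:: x; y; z] ==> (cyc3 x y z \in G)].

Lemma alt_onP G S : reflect
  (forall x y z, x \in S -> y \in S -> z \in S -> uniq [:: x; y; z] -> cyc3 x y z \in G)
  (alt_on G S).
Proof.
apply: (iffP forall_inP) => [h x y z xS yS zS|h x xS].
  by move/implyP: (forall_inP (forall_inP (h x xS) y yS) z zS); apply.
by apply/forall_inP=> y yS; apply/forall_inP=> z zS; apply/implyP; apply: h.
Qed.

Lemma alt_onS G S S' : S' \subset S -> alt_on G S -> alt_on G S'.
Proof.
move=> /subsetP sub /alt_onP h; apply/alt_onP=> x y z /sub xS /sub yS /sub zS.
exact: h.
Qed.

(** Induction on [S]: multiplying by a 3-cycle puts a moved point x back in place and removes it
    from the support. A third point exists, since otherwise [s] would be the transposition of x and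
    s x, which is odd. *)
Lemma alt_on_even G S (s : {perm T}) :
  alt_on G S -> perm_on S s -> ~~ odd_perm s -> s \in G.
Proof.
have [n le_n] := ubnP #|S|; elim: n S s le_n => // n IH S s le_n aS sS se.
have [->|s1] := eqVneq s 1; first exact: group1.
have [x xs] : exists x, s x != x.
  apply/existsP; apply: contraNT s1; rewrite negb_exists => /forallP fx.
  by apply/eqP/permP=> x; rewrite perm1; apply/eqP; move: (fx x); rewrite negbK.
have xS : x \in S by apply: contraR xs => xS; rewrite (out_perm sS).
set y := s x in xs; have yS : y \in S by rewrite (perm_closed _ sS).
have [z zS /andP[zx zy]] : exists2 z, z \in S & (z != x) && (z != y).
  apply/exists_inP; apply: contraNT se; rewrite negb_exists_in => /forall_inP nz.
  have -> : s = tperm x y.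
    apply/permP=> t; case: tpermP => [->//|->|/eqP tx /eqP ty].
      have sy : s y \in S by rewrite (perm_closed _ sS).
      have := nz _ sy; rewrite negb_and !negbK (inj_eq (@perm_inj _ s)) (negbTE xs) orbF.
      by move/eqP.
    by apply: (out_perm sS); apply/negP => tS; have := nz _ tS; rewrite tx ty.
  by rewrite odd_tperm eq_sym.
have u : uniq [:: y; x; z].
  by rewrite /= !inE negb_or xs eq_sym zy eq_sym zx.
have cG : cyc3 y x z \in G by move/alt_onP: aS; apply.
have [cy cx cz cO] := cyc3E u.
rewrite -(groupMr _ cG); apply: (IH (S :\ x)).
- by move: le_n; rewrite (cardsD1 x S) xS.
- by apply: alt_onS aS; apply: subD1set.
- apply/subsetP=> t; rewrite inE permM !inE => tN.
  have tx : t != x by apply: contraNneq tN => ->; rewrite -/y cy.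
  rewrite tx /=; apply: contraR tN => tS.
  rewrite (out_perm sS) // cO // !inE (negbTE tx) /=.
  by apply/norP; split; apply: contraNneq tS => ->.
by rewrite odd_permM odd_cyc3 // addbF.
Qed.

(** Conjugation by 3-cycles on [S], together with inversion, carries the given pair (d, e) to every
    ordered pair of distinct points of [S]. *)
Lemma alt_on_grow G S w d e : alt_on G S -> w \notin S -> d \in S -> e \in S -> d != e ->
  cyc3 w d e \in G -> alt_on G (w |: S).
Proof.
move=> /alt_onP aS wS dS eS de cG.
have nw t : t \in S -> w != t by apply: contraTneq => <-.
have sym a b : cyc3 w a b \in G -> cyc3 w b a \in G by rewrite -cyc3V groupV.
have step a b f : a \in S -> b \in S -> f \in S -> a != b -> f != b ->
    cyc3 w a b \in G -> cyc3 w b f \in G.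
  move=> ia ib ic ab fb cab; have [->|fa] := eqVneq f a; first exact: sym.
  have u : uniq [:: a; b; f] by rewrite /= !inE negb_or ab eq_sym fa eq_sym fb.
  have [ca cb cf cO] := cyc3E u.
  rewrite -ca -{2}cb -[X in cyc3 X](cO w).
    by rewrite -cyc3J groupJ // aS.
  by rewrite !inE !negb_or !nw.
have pair a b : a \in S -> b \in S -> a != b -> cyc3 w a b \in G.
  move=> ia ib ab; have [be|be] := eqVneq b e.
    by apply/sym/(step d b a) => //; rewrite be.
  by apply/sym/(step e b a) => //; [rewrite eq_sym|apply: (step d)].
apply/alt_onP=> x y z; rewrite !inE => xS yS zS u.
have u' : uniq [:: y; z; x] by rewrite -(rot_uniq 1) in u.
have u'' : uniq [:: z; x; y] by rewrite -(rot_uniq 1) in u'.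
move: (u); rewrite /= !inE negb_or andbT => /andP[/andP[xy xz] yz].
have inS t : w != t -> (t == w) || (t \in S) -> t \in S.
  by move=> wt; rewrite eq_sym (negbTE wt).
have [xw|xw] := eqVneq w x.
  by subst x; apply: pair => //; apply: inS.
have [yw|yw] := eqVneq w y.
  by subst y; rewrite cyc3_rot // pair //; first [exact: inS | rewrite eq_sym].
have [zw|zw] := eqVneq w z.
  by subst z; rewrite -cyc3_rot // pair //; exact: inS.
by apply: aS => //; apply: inS.
Qed.

(** A maximal [S] behaves like a block of imprimitivity. This replaces an appeal to primitivity: to
    add an image of a point of [S], it is enough that the element of [G] used keeps some known point
    inside [S]. *)
Lemma alt_on_max G S0 : alt_on G S0 -> 2 < #|S0| -> exists S,
  [/\ S0 \subset S, alt_on G S &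
      forall g a b, g \in G -> a \in S -> b \in S -> g b \in S -> g a \in S].
Proof.
move=> aS0 S02; have [S /maxsetP[aS maxS] sub] := maxset_exists aS0.
exists S; split=> // g a b gG ia ib gb; apply: contraT => wS.
have third p q : exists2 t, t \in S & (t != p) && (t != q).
  have : 0 < #|S :\ p :\ q|.
    have := subset_leq_card sub; have := cardsD1 p S; have := cardsD1 q (S :\ p).
    case: (p \in S); case: (q \in _); lia.
  case/card_gt0P=> t; rewrite !inE => /and3P[tq tp tS]; exists t => //.
  by rewrite tp.
suff /maxS eS : alt_on G (g a |: S).
  by move: wS; rewrite -(eS (subsetUr _ _)) setU11.
have ab : a != b by apply: contraNneq wS => ->.
have [c cS /andP[ca cb]] := third a b.
have u : uniq [:: a; b; c] by rewrite /= !inE negb_or ab eq_sym ca eq_sym cb.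
have : cyc3 a b c \in G by move/alt_onP: aS; apply.
rewrite -(groupJr _ gG) cyc3J.
have [gc|gc] := boolP (g c \in S).
  by apply: alt_on_grow => //; rewrite (inj_eq perm_inj) eq_sym.
(* Now g a and g c are both outside [S] while g b is inside. Conjugating a 3-cycle (g b, d, e) on
   [S] by one through these three points replaces g b by g a and leaves d and e alone. *)
move=> cG; have [d dS /andP[db _]] := third (g b) (g b).
have [e eS /andP[eb ed]] := third (g b) d.
have u2 : uniq [:: g b; d; e] by rewrite /= !inE negb_or eq_sym db eq_sym eb eq_sym ed.
have u3 : uniq [:: g a; g c; g b].
  rewrite /= !inE negb_or !(inj_eq perm_inj) ab cb andbT andbC andbT eq_sym //.
have : cyc3 (g b) d e \in G by move/alt_onP: aS; apply.
have cV : cyc3 (g a) (g c) (g b) \in G by rewrite -cyc3V groupV.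
rewrite -(groupJr _ cV) cyc3J; have [c1 c2 c0 cO] := cyc3E u3.
have fx t : t \in S -> t != g b -> cyc3 (g a) (g c) (g b) t = t.
  move=> tS tb; apply: cO; rewrite !inE !negb_or tb andbT.
  by apply/andP; split; apply: contraTneq tS => ->.
rewrite c0 !fx //; apply: alt_on_grow => //; rewrite eq_sym //.
Qed.

End ThreeCycles.

Lemma gens_ind (gT : finGroupType) (rho : nat -> gT) s (P : gT -> Prop) :
  P 1 -> (forall x c, c \in s -> P x -> P (x * rho c)) ->
  forall x, x \in gens rho s -> P x.
Proof.
move=> P1 PM x /gen_prodgP[n [f fA ->]].
elim: n f fA => [|n IH] f fA; first by rewrite big_ord0.
rewrite big_ord_recr /=; have := fA ord_max; rewrite inE => /mapP[c cs ->].
by apply: PM => //; apply: IH => i; apply: fA.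
Qed.

Lemma alt_on3 (T : finType) (G : {group {perm T}}) (x y z : T) :
  uniq [:: x; y; z] -> cyc3 x y z \in G -> alt_on G [set x; y; z].
Proof.
move=> u cG; have u1 : uniq [:: y; z; x] by rewrite -(rot_uniq 1) in u.
have cV : cyc3 x z y \in G by rewrite -cyc3V groupV.
have u2 : uniq [:: x; z; y] by move: u; rewrite /= !inE !negb_or (eq_sym y) => /andP[/andP[-> ->] ->].
have u3 : uniq [:: z; y; x] by rewrite -(rot_uniq 1) in u2.
move: (cG) (cV); rewrite cyc3_rot // => cG1; rewrite cyc3_rot // => cV1.
move: (cG1) (cV1); rewrite cyc3_rot // => cG2; rewrite cyc3_rot // => cV2.
apply/alt_onP=> a b c; rewrite !inE => /orP[/orP[]|] /eqP -> /orP[/orP[]|] /eqP ->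
  /orP[/orP[]|] /eqP -> //; by rewrite /= !inE !eqxx ?orbT ?andbF.
Qed.

Lemma cards3 (T : finType) (x y z : T) : uniq [:: x; y; z] -> #|[set x; y; z]| = 3.
Proof.
rewrite /= !inE negb_or andbT => /andP[/andP[xy xz] yz].
by rewrite setUC cardsU1 cards2 !inE negb_or xy ![z == _]eq_sym xz yz.
Qed.

Section PermOn.

Variables (T : finType).

Lemma perm_on_gens (rho : nat -> {perm T}) s (K : {set T}) :
  (forall c, c \in s -> perm_on K (rho c)) -> forall g, g \in gens rho s -> perm_on K g.
Proof.
move=> sK; apply: gens_ind => [|x c cs xK]; first exact: perm_on1.
exact: perm_onM (sK c cs).
Qed.

End PermOn.

Ltac plia := repeat match goal with
  | H : is_true ?b |- _ => lazymatch b with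
      | context [in_mem] => clear H
      | context [@fun_of_perm] => clear H
      | context [@perm_on] => clear H
      | context [@alt_on] => clear H
      | context [@uniq] => clear H
      | context [@Finite.sort] => clear H
      end
  end; lia.

(** * Gluing at a point *)

Section Join.

Variables (X : finType) (rho : nat -> {perm X}) (k r : nat) (K R : {set X}) (p : X).
Local Notation G i j := (gens rho (index_iota i j)).
Local Notation M i := [set (g : {perm X}) p | g in G i k].
Local Notation O j := [set (g : {perm X}) p | g in G k j].

Hypotheses (k0 : 0 < k) (kr : k < r).
Hypotheses (KR : K :&: R = [set p]).
Hypotheses (suppL : forall c, c < k -> perm_on K (rho c)).
Hypotheses (suppR : forall c, k <= c -> c < r -> perm_on R (rho c)).
Hypotheses (fixL : forall c, c.+1 < k -> rho c p = p) (movL : rho k.-1 p != p).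
Hypotheses (fixR : forall c, k < c -> c < r -> rho c p = p) (movR : rho k p != p).
Hypotheses (even : forall c, c < r -> odd_perm (rho c) = false).
Hypotheses (ord2 : forall c, c < r -> #[rho c] = 2).
Hypotheses (commL : forall i j, i + 2 <= j -> j < k -> commute (rho i) (rho j)).
Hypotheses (commR : forall i j, k <= i -> i + 2 <= j -> j < r -> commute (rho i) (rho j)).
Hypotheses (itvL : forall i j, i < j -> j < k -> G i j :&: G i.+1 j.+1 \subset G i.+1 j).
Hypotheses (itvR : forall i j, k <= i -> i < j -> j < r ->
  G i j :&: G i.+1 j.+1 \subset G i.+1 j).
Hypotheses (starL : forall i, i.+1 < k -> forall g : {perm X}, g \in G i k ->
  (forall x, x \in K -> x \notin M i.+1 -> g x = x) -> g \in G i.+1 k).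
Hypotheses (starR : forall j, k < j -> j < r -> forall g : {perm X}, g \in G k j.+1 ->
  (forall x, x \in R -> x \notin O j -> g x = x) -> g \in G k j).

Let inKR x : x \in K -> x \in R -> x = p.
Proof. by move=> xK xR; apply/set1P; rewrite -KR inE xK. Qed.

Let pK : p \in K. Proof. by have := set11 p; rewrite -KR inE => /andP[]. Qed.

Let pR : p \in R. Proof. by have := set11 p; rewrite -KR inE => /andP[]. Qed.

Let GK i j (g : {perm X}) : j <= k -> g \in G i j -> perm_on K g.
Proof. by move=> jk; apply: perm_on_gens => c; rewrite mem_index_iota => ?; apply: suppL; plia. Qed.

Let GR i j (g : {perm X}) : k <= i -> j <= r -> g \in G i j -> perm_on R g.
Proof. by move=> ki jr; apply: perm_on_gens => c; rewrite mem_index_iota => ?; apply: suppR; plia. Qed.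

Let GS i j i' j' : i' <= i -> j <= j' -> G i j \subset G i' j'.
Proof. by move=> ii jj; apply: gensS => c; rewrite !mem_index_iota; plia. Qed.

Let inG i j c : i <= c < j -> rho c \in G i j.
Proof. by move=> cI; apply: mem_gens; rewrite mem_index_iota. Qed.

Let outR x (g : {perm X}) : perm_on R g -> x \in K -> x != p -> g x = x.
Proof. by move=> gR xK xp; apply: (out_perm gR); apply: contra xp => /(inKR xK)/eqP. Qed.

Let outK x (g : {perm X}) : perm_on K g -> x \in R -> x != p -> g x = x.
Proof. by move=> gK xR xp; apply: (out_perm gK); apply: contra xp => /inKR/(_ xR)/eqP. Qed.

Let invol c x : c < r -> rho c (rho c x) = x.
Proof. by move=> cr; rewrite -permM -[_ * _]/(rho c ^+ 2) -(ord2 cr) expg_order perm1. Qed.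

Let x' := rho k.-1 p.
Let a := rho k p.

Let x'K : x' \in K. Proof. by rewrite /x' (perm_closed _ (suppL _)) //; plia. Qed.

Let aR : a \in R. Proof. by rewrite /a (perm_closed _ (suppR _ _)). Qed.

Let pax : uniq [:: p; a; x'].
Proof.
rewrite /= !inE negb_or andbT eq_sym movR eq_sym movL /=.
by apply/eqP=> ax; case/eqP: movR; apply: inKR; rewrite -/a // ax.
Qed.

(** The two involutions have [p] as their only common moved point, so their commutator moves only
    [p] and its two images. *)
Let comm_cyc3 : rho k ^ rho k.-1 * rho k = cyc3 p a x'.
Proof.
have k1 : k.-1 < k by plia.
have k1r : k.-1 < r by plia.
have [c1 c2 c0 cO] := cyc3E pax.
have oV : (rho k.-1)^-1 = rho k.-1.
  by apply: (mulIg (rho k.-1)); rewrite mulVg -[RHS]/(rho k.-1 ^+ 2) -(ord2 k1r) expg_order.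
apply/permP=> t; transitivity (rho k (rho k.-1 (rho k (rho k.-1 t)))).
  by rewrite permM conjgE oV !permM.
have fa : rho k.-1 a = a by apply: outK (suppL _) _ _.
have [->|tp] := eqVneq t p.
  by rewrite c1 -/x' (outR (suppR _ _) x'K) // /x' invol.
have [->|ta] := eqVneq t a.
  by rewrite c2 fa /a invol // -/x' (outR (suppR _ _) x'K).
have [->|tx] := eqVneq t x'.
  by rewrite c0 /x' invol // -/a fa /a invol.
rewrite cO; last by rewrite !inE !negb_or tp ta tx.
have [tR|tR] := boolP (t \in R).
  rewrite (outK (suppL k1) tR) // (outK (suppL k1)) ?invol //.
    by rewrite (perm_closed _ (suppR _ _)).
  by apply: contraNneq ta => e; rewrite -(invol t kr) e.
have tR' : rho k.-1 t \notin R.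
  apply/negP=> h; have [tK|tK] := boolP (t \in K); last first.
    by move: h; rewrite (out_perm (suppL k1)) // (negbTE tR).
  have tK' : rho k.-1 t \in K by rewrite (perm_closed _ (suppL k1)).
  by case/eqP: tx; rewrite /x' -(inKR tK' h) invol.
rewrite (out_perm (suppR (leqnn k) kr) tR') invol // (out_perm (suppR (leqnn k) kr) tR) //.
Qed.

Lemma join_nc : ~ commute (rho k.-1) (rho k).
Proof.
move=> c; have := comm_cyc3; have -> : rho k ^ rho k.-1 = rho k.
  by rewrite conjgE -c mulKg.
rewrite -[_ * _]/(rho k ^+ 2) -(ord2 kr) expg_order => e.
have [c1 _ _ _] := cyc3E pax; move: c1; rewrite -e perm1 => pa.
by case/eqP: movR.
Qed.

(** Elements of the left arm fix [a], which belongs to the right arm, so the block property puts the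
    whole left orbit of [p] into the maximal set; on the right, [x'] plays the same part. *)
Let alt_join i j : i < k -> k < j -> j <= r -> alt_on (G i j) (M i :|: O j).
Proof.
move=> ik kj jr; have cG : cyc3 p a x' \in G i j.
  by rewrite -comm_cyc3 groupM // ?groupJ // inG //; plia.
have [|S [S0 aS cS]] := alt_on_max (alt_on3 pax cG).
  move: pax; rewrite /= !inE negb_or andbT => /andP[/andP[pa px] ax].
  by rewrite -setUA cardsU1 cards2 !inE negb_or pa px ax.
have [pS aS' xS] : [/\ p \in S, a \in S & x' \in S].
  by split; apply: (subsetP S0); rewrite !inE eqxx ?orbT.
apply: alt_onS aS; apply/subsetP=> y; rewrite inE => /orP[]/imsetP[g gG ->].
  apply: (cS g p a) => //; first by apply: (subsetP (GS _ _)) gG => //; plia.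
  by rewrite (outK (GK (leqnn k) gG)).
apply: (cS g p x') => //; first by apply: (subsetP (GS _ _)) gG => //; plia.
by rewrite (outR (GR (leqnn k) jr gG)).
Qed.

Let OP j x (g : {perm X}) : g \in G k j -> (g x \in O j) = (x \in O j).
Proof.
move=> gG; apply/imsetP/imsetP=> [[h hG e]|[h hG ->]].
  by exists (h * g^-1); rewrite ?groupM ?groupV // permM -e permK.
by exists (h * g); rewrite ?groupM ?permM.
Qed.

Let MP i x (g : {perm X}) : g \in G i k -> (g x \in M i) = (x \in M i).
Proof.
move=> gG; apply/imsetP/imsetP=> [[h hG e]|[h hG ->]].
  by exists (h * g^-1); rewrite ?groupM ?groupV // permM -e permK.
by exists (h * g); rewrite ?groupM ?permM.
Qed.

Let pO j : p \in O j. Proof. by apply/imsetP; exists 1; rewrite ?group1 ?perm1. Qed.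

Let pM i : p \in M i. Proof. by apply/imsetP; exists 1; rewrite ?group1 ?perm1. Qed.

Let OE x : x \in O k -> x = p.
Proof.
case/imsetP=> f; have -> : G k k = 1 :> {set {perm X}}.
  by rewrite /index_iota subnn gens_nil.
by move/set1P=> -> ->; rewrite perm1.
Qed.

(** Away from the orbit of [p], only the right-hand letters of a word are visible on the right arm:
    the left ones move no point of [R] but [p], and the orbit is stable under the right ones. *)
Let decR i j (g : {perm X}) : j <= r -> g \in G i j ->
  exists2 t, t \in G k j & forall x, x \in R -> x \notin O j -> g x = t x.
Proof.
move=> jr; move: g; apply: gens_ind; first by exists 1; rewrite ?group1.
move=> g c; rewrite mem_index_iota => cI [t tG gt].
have [ck|kc] := ltnP c k.
  exists t => // x xR xO; rewrite permM gt //.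
  apply: (outK (suppL ck)).
    by rewrite (perm_closed _ (GR (leqnn k) jr tG)).
  by apply: contraNneq xO => e; rewrite -(OP x tG) e.
exists (t * rho c); first by rewrite groupM // inG //; plia.
by move=> x xR xO; rewrite !permM gt.
Qed.

Let decL i j (g : {perm X}) : j <= r -> g \in G i j ->
  exists2 d, d \in G i k & forall x, x \in K -> x \notin M i -> g x = d x.
Proof.
move=> jr; move: g; apply: gens_ind; first by exists 1; rewrite ?group1.
move=> g c; rewrite mem_index_iota => cI [t tG gt].
have [ck|kc] := ltnP c k.
  exists (t * rho c); first by rewrite groupM // inG //; plia.
  by move=> x xK xM; rewrite !permM gt.
exists t => // x xK xM; rewrite permM gt //.
apply: (outR (suppR kc _)); first plia.
  by rewrite (perm_closed _ (GK (leqnn k) tG)).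
by apply: contraNneq xM => e; rewrite -(MP x tG) e.
Qed.

Let evenG i j (g : {perm X}) : j <= r -> g \in G i j -> ~~ odd_perm g.
Proof.
move=> jr; move: g; apply: gens_ind; first by rewrite odd_perm1.
by move=> g c; rewrite mem_index_iota => cI ge; rewrite odd_permM even ?addbF //; plia.
Qed.

(** Dividing [g] by its traces [t] and [d] on the two arms leaves an element [h] supported on
    [M i.+1 :|: O j]. With generators on both sides of the junction [alt_join] contains it; when
    i.+1 = k or j = k one of the orbits is just [p] and the arm condition [starR] or [starL]
    applies. If both equalities hold, h = 1. *)
Let crossG i j (g : {perm X}) : i < k -> k <= j -> j < r ->
  g \in G i.+1 j.+1 ->
  (exists2 t, t \in G k j & forall x, x \in R -> x \notin O j -> g x = t x) ->
  (j = k -> g \in G i k) -> g \in G i.+1 j.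
Proof.
move=> ik kj jr gr [t tG gt] gl.
have [d dG gd] := decL jr gr.
have tG' : t \in G i.+1 j by apply: (subsetP (GS _ _)) tG.
have dG' : d \in G i.+1 j by apply: (subsetP (GS _ _)) dG.
have tR := GR (leqnn k) (ltnW jr) tG; have dK := GK (leqnn k) dG.
pose h := g * t^-1 * d^-1.
suff : h \in G i.+1 j by rewrite /h !groupMr // groupV.
have hr : h \in G i.+1 j.+1.
  by rewrite !groupM ?groupV //; [apply: (subsetP (GS _ _)) tG'|apply: (subsetP (GS _ _)) dG'].
have gKR : perm_on (K :|: R) g.
  apply: perm_on_gens gr => c; rewrite mem_index_iota => cI.
  have [ck|kc] := ltnP c k.
    by apply: subset_trans (suppL ck) _; apply: subsetUl.
  by apply: subset_trans (suppR kc _) _; [plia|apply: subsetUr].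
have tV x : t^-1 (t x) = x by rewrite permK.
have dV x : d^-1 (d x) = x by rewrite permK.
have tVR : perm_on R t^-1 by rewrite perm_onV.
have dVK : perm_on K d^-1 by rewrite perm_onV.
have hfix x : x \notin M i.+1 -> x \notin O j -> h x = x.
  move=> xM xO; have xp : x != p by apply: contraNneq xO => ->.
  rewrite /h !permM; have [xR|xR] := boolP (x \in R).
    by rewrite gt // tV (outK dVK).
  have [xK|xK] := boolP (x \in K).
    rewrite gd // (outR tVR) ?dV //; first by rewrite (perm_closed _ dK).
    by apply: contraNneq xM => e; rewrite -(MP x dG) e.
  have -> : g x = x by rewrite (out_perm gKR) // inE negb_or xK.
  by rewrite (out_perm tVR) // (out_perm dVK).
have [ik1|ik1] := ltnP i.+1 k; last first.
  have {ik1} ik1 : i.+1 = k by plia.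
  have M1 x : x \in M i.+1 -> x = p.
    by rewrite ik1; apply: OE.
  have [jk|jk] := eqVneq j k.
    suff -> : h = 1 by apply: group1.
    apply/permP=> x; rewrite perm1; have [->|xp] := eqVneq x p; last first.
      apply: hfix; first by apply: contraNN xp => /M1 ->.
      by apply: contraNN xp; rewrite jk => /OE ->.
    apply: contraTeq isT => hp; have : h (h p) = h p.
      apply: hfix; first by apply: contraNN hp => /M1 ->.
      by apply: contraNN hp; rewrite jk => /OE {1}->.
    by move/perm_inj/eqP; rewrite (negbTE hp).
  rewrite ik1 in hr *; apply: starR hr _; [plia|done|].
  by move=> x xR xO; apply: hfix => //; apply: contraNN xO => /M1 ->.
have [jk|jk] := eqVneq j k.
  have hl : h \in G i k.
    by rewrite !groupM ?groupV ?gl //; [apply: (subsetP (GS _ _)) tG'|apply: (subsetP (GS _ _)) dG'];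
      plia.
  rewrite jk; apply: starL hl _ => // x xK xM; apply: hfix => //.
  by apply: contraNN xM; rewrite jk => /OE ->.
apply: alt_on_even (alt_join ik1 _ _) _ _; [plia|plia| |exact: evenG hr].
apply/subsetP=> x; rewrite !inE => hx; apply: contraR hx; rewrite negb_or => /andP[xM xO].
by rewrite hfix.
Qed.

(** Generators of different arms that are not adjacent do not both move [p], so their supports are
    disjoint. *)
Let comm_cross i j : i < k -> k <= j -> i + 2 <= j -> j < r -> commute (rho i) (rho j).
Proof.
move=> ik kj ij jr; have sL := suppL ik; have sR := suppR kj jr.
have fp : rho i p = p \/ rho j p = p.
  have [|] := ltnP i.+1 k; first by left; apply: fixL.
  by move=> ki; right; apply: fixR; plia.
apply/permP=> x; rewrite !permM.
have [->|xp] := eqVneq x p.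
  case: fp => e; rewrite e.
    have [->|jp] := eqVneq (rho j p) p; first by rewrite e.
    by rewrite (outK sL) // (perm_closed _ sR).
  have [->|jp] := eqVneq (rho i p) p; first by rewrite e.
  by rewrite (outR sR) // (perm_closed _ sL).
have [xK|xK] := boolP (x \in K).
  rewrite (outR sR xK xp); have iK : rho i x \in K by rewrite (perm_closed _ sL).
  have [e|ip] := eqVneq (rho i x) p; last by rewrite (outR sR).
  case: fp => e'; last by rewrite e.
  by case/eqP: xp; apply: (@perm_inj _ (rho i)); rewrite e e'.
rewrite (out_perm sL xK); have [xR|xR] := boolP (x \in R); last first.
  by rewrite (out_perm sR xR) (out_perm sL xK).
have jR : rho j x \in R by rewrite (perm_closed _ sR).
have [e|jp] := eqVneq (rho j x) p; last by rewrite (outK sL).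
case: fp => e'; first by rewrite e.
by case/eqP: xp; apply: (@perm_inj _ (rho j)); rewrite e e'.
Qed.

Lemma join_stringC : stringC rho r.
Proof.
split=> [|i j ij jr|i j ij jr].
- exact: ord2.
- have [jk|kj] := ltnP j k; first exact: commL.
  have [ik|ki] := ltnP i k; first exact: comm_cross.
  exact: commR.
have [jk|kj] := ltnP j k; first exact: itvL.
have [ik|ki] := ltnP i k; last exact: itvR.
apply/subsetP=> g; rewrite inE => /andP[gl gr].
apply: crossG gr _ _ => //; first exact: decR (ltnW jr) gl.
by move=> jk; rewrite -jk.
Qed.

Lemma join_Alt : M 0 :|: O r = setT -> G 0 r = 'Alt_X :> {set {perm X}}.
Proof.
move=> full; apply/eqP; rewrite eqEsubset; apply/andP; split; apply/subsetP=> g.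
  by rewrite Alt_even => /(evenG (leqnn r)).
rewrite Alt_even => ge; have := alt_join k0 kr (leqnn r); rewrite full => aG.
by apply: alt_on_even aG _ ge; apply/subsetP=> x; rewrite inE.
Qed.

End Join.

(** * Extending permutations along an injection *)

Section Embedding.

Variables (W X : finType) (f : W -> X).
Hypothesis f_inj : injective f.
Implicit Types (s t : {perm W}).

Definition emb_fun s x := if [pick w | f w == x] is Some w then f (s w) else x.

Lemma emb_fun_f s w : emb_fun s (f w) = f (s w).
Proof.
rewrite /emb_fun; case: pickP => [v /eqP/f_inj -> //|/(_ w)].
by rewrite eqxx.
Qed.

Lemma emb_fun_out s x : x \notin codom f -> emb_fun s x = x.
Proof.
rewrite /emb_fun; case: pickP => // w /eqP <-.
by rewrite codom_f.
Qed.

Lemma emb_fun_inj s : injective (emb_fun s).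
Proof.
apply: (can_inj (g := emb_fun s^-1)) => x.
have [/codomP[w ->]|xN] := boolP (x \in codom f).
  by rewrite !emb_fun_f permK.
by rewrite !emb_fun_out.
Qed.

Definition emb s : {perm X} := perm (@emb_fun_inj s).

Lemma embE s w : emb s (f w) = f (s w).
Proof. by rewrite permE emb_fun_f. Qed.

Lemma emb_out s x : x \notin codom f -> emb s x = x.
Proof. by rewrite permE; apply: emb_fun_out. Qed.

Lemma eq_on_codom (g h : {perm X}) : (forall w, g (f w) = h (f w)) ->
  (forall x, x \notin codom f -> g x = h x) -> g = h.
Proof.
move=> e eN; apply/permP=> x.
by have [/codomP[w ->]|/eN] := boolP (x \in codom f).
Qed.

Lemma embM s t : emb (s * t) = emb s * emb t.
Proof.
by apply: eq_on_codom => [w|x xN]; rewrite [RHS]permM ?embE ?permM // !emb_out.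
Qed.

Lemma emb1 : emb 1 = 1.
Proof. by apply: eq_on_codom => [w|x xN]; rewrite ?embE ?emb_out // !perm1. Qed.

Lemma emb_inj : injective emb.
Proof. by move=> s t e; apply/permP=> w; apply: f_inj; rewrite -!embE e. Qed.

Lemma emb_tperm u v : emb (tperm u v) = tperm (f u) (f v).
Proof.
apply: eq_on_codom => [w|x xN]; first by rewrite embE inj_tperm.
by rewrite emb_out // tpermD //; apply: contraNneq xN => <-; rewrite codom_f.
Qed.

Lemma odd_emb s : odd_perm (emb s) = odd_perm s.
Proof.
have [ts -> _] := prod_tpermP s.
elim: ts => [|t ts IH]; first by rewrite !big_nil emb1 !odd_perm1.
by rewrite !big_cons embM !odd_permM IH emb_tperm !odd_tperm (inj_eq f_inj).
Qed.

Lemma emb_perm_on s : perm_on [set x in codom f] (emb s).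
Proof.
by apply/subsetP=> x; rewrite !inE; apply: contraR => /emb_out ->.
Qed.

Lemma embX s n : emb (s ^+ n) = emb s ^+ n.
Proof. by elim: n => [|n IH]; rewrite ?expg0 ?emb1 // !expgS embM IH. Qed.

Lemma order_emb s : #[emb s] = #[s].
Proof.
apply/eqP; rewrite eqn_dvd !order_dvdn -embX expg_order emb1 eqxx /=.
by rewrite -(inj_eq emb_inj) embX expg_order emb1.
Qed.

Lemma mem_emb_gens (tau : nat -> {perm W}) c g :
  g \in gens (fun i => emb (tau i)) c <-> exists2 h, h \in gens tau c & g = emb h.
Proof.
split.
  move: g; apply: gens_ind; first by exists 1; rewrite ?group1 ?emb1.
  move=> g i ic [h hG ->]; exists (h * tau i); last by rewrite embM.
  by rewrite groupM // mem_gens.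
case=> h + ->; move: h; apply: gens_ind => [|h i ic hG]; first by rewrite emb1.
by rewrite embM groupM // (mem_gens (fun i => emb (tau i))).
Qed.

Lemma emb_itv (tau : nat -> {perm W}) (s1 s2 s3 : seq nat) :
  gens tau s1 :&: gens tau s2 \subset gens tau s3 ->
  gens (fun i => emb (tau i)) s1 :&: gens (fun i => emb (tau i)) s2
    \subset gens (fun i => emb (tau i)) s3.
Proof.
move/subsetP=> sub; apply/subsetP=> g; rewrite inE => /andP[].
move=> /mem_emb_gens[h h1 ->] /mem_emb_gens[h' h2 /emb_inj e].
by apply/mem_emb_gens; exists h => //; apply: sub; rewrite inE h1 e.
Qed.

Lemma commute_emb s t : commute (emb s) (emb t) <-> commute s t.
Proof.
rewrite /commute -!embM; split=> [/emb_inj //|-> //].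
Qed.

End Embedding.

(** * Arms and their gluing *)

Record arm (V : finType) (m : nat) (tau : nat -> {perm V}) (v0 : V) : Prop := Arm {
  arm_pos : 0 < m;
  arm_mov : tau 0 v0 != v0;
  arm_fix : forall c, 0 < c -> c < m -> tau c v0 = v0;
  arm_even : forall c, c < m -> odd_perm (tau c) = false;
  arm_stringC : stringC tau m;
  (* Lets intervals with one end at the junction be treated inside the arm. *)
  arm_star : forall j, 0 < j -> j < m ->
    forall g : {perm V}, g \in gens tau (index_iota 0 j.+1) ->
    (forall x, x \notin [set (h : {perm V}) v0 | h in gens tau (index_iota 0 j)] -> g x = x) ->
    g \in gens tau (index_iota 0 j) }.

Definition arm_transitive (V : finType) m (tau : nat -> {perm V}) v0 :=
  forall v, exists2 h : {perm V}, h \in gens tau (index_iota 0 m) & v = h v0.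

Section Glue.

Variables (U V : finType) (m1 m2 : nat).
Variables (lam : nat -> {perm U}) (u0 : U) (tau : nat -> {perm V}) (v0 : V).
Hypotheses (aL : arm m1 lam u0) (aT : arm m2 tau v0).

(** The common point is [u0]; removing [v0] from the second summand is what makes [inV] need a
    default value. *)
Definition glued : finType := (U + {v : V | v != v0})%type.

Definition inU (u : U) : glued := inl u.
Definition inV (v : V) : glued := if insub v is Some w then inr w else inl u0.

Lemma inU_inj : injective inU.
Proof. by move=> u u' []. Qed.

Lemma inV0 : inV v0 = inU u0.
Proof. by rewrite /inV insubF // eqxx. Qed.

Lemma inVN v (h : v != v0) : inV v = inr (Sub v h).
Proof. by rewrite /inV insubT. Qed.

Lemma inV_inj : injective inV.
Proof.
move=> v v'; have [->|vN] := eqVneq v v0; have [->|vN'] := eqVneq v' v0 => //.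
- by rewrite inV0 (inVN vN').
- by rewrite inV0 (inVN vN).
by rewrite (inVN vN) (inVN vN') => -[].
Qed.

(** Reversing the first arm brings the two generators that move the junction, [lam 0] and [tau 0],
    to the adjacent positions m1 - 1 and m1. *)
Definition glue c : {perm glued} :=
  if c < m1 then emb inU_inj (lam (m1.-1 - c)) else emb inV_inj (tau (c - m1)).

Lemma card_glued : #|{: glued}| = (#|U| + #|V|).-1.
Proof.
rewrite card_sum card_sig (eq_card (B := predC1 v0)) //.
by rewrite cardC1; have : 0 < #|V| by [apply/card_gt0P; exists v0]; lia.
Qed.

Lemma glueL i j : i <= j -> j <= m1 -> gens glue (index_iota i j) =
  gens (fun c => emb inU_inj (lam c)) (index_iota (m1 - j) (m1 - i)) :> {set _}.
Proof.
move=> ij jm; apply/eqP; rewrite eqEsubset; apply/andP; split.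
  apply: gens_sub => c; rewrite mem_index_iota => cI.
  have cm : c < m1 by lia.
  rewrite /glue cm; apply: (mem_gens (fun c => emb inU_inj (lam c))).
  by rewrite mem_index_iota; lia.
apply: gens_sub => c; rewrite mem_index_iota => cI.
have -> : emb inU_inj (lam c) = glue (m1.-1 - c).
  have cm : m1.-1 - c < m1 by lia.
  by rewrite /glue cm; congr (emb _ (lam _)); lia.
by apply: mem_gens; rewrite mem_index_iota; lia.
Qed.

Lemma glueR i j : m1 <= i -> gens glue (index_iota i j) =
  gens (fun c => emb inV_inj (tau c)) (index_iota (i - m1) (j - m1)) :> {set _}.
Proof.
move=> mi; apply/eqP; rewrite eqEsubset; apply/andP; split.
  apply: gens_sub => c; rewrite mem_index_iota => cI.
  have -> : glue c = emb inV_inj (tau (c - m1)).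
    by rewrite /glue; have -> : (c < m1) = false by lia.
  by apply: (mem_gens (fun c => emb inV_inj (tau c))); rewrite mem_index_iota; lia.
apply: gens_sub => c; rewrite mem_index_iota => cI.
have -> : emb inV_inj (tau c) = glue (c + m1).
  by rewrite /glue addnK; have -> : (c + m1 < m1) = false by lia.
by apply: mem_gens; rewrite mem_index_iota; lia.
Qed.

Let p := inU u0.
Let K := [set x in codom inU].
Let R := [set x in codom inV].

Let KR : K :&: R = [set p].
Proof.
apply/setP=> x; rewrite !inE; apply/andP/eqP => [[/codomP[u xu] /codomP[v]]|->].
  have [->|vN] := eqVneq v v0; first by rewrite inV0.
  by rewrite (inVN vN) xu.
by rewrite codom_f /p -inV0 codom_f.
Qed.

Let m1_gt0 := arm_pos aL.
Let m2_gt0 := arm_pos aT.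

Let glue_lt c : c < m1 -> glue c = emb inU_inj (lam (m1.-1 - c)).
Proof. by rewrite /glue => ->. Qed.

Let glue_ge c : m1 <= c -> glue c = emb inV_inj (tau (c - m1)).
Proof. by rewrite /glue leqNgt => /negbTE ->. Qed.

Let orbL j (x : U) : j < m1 ->
  (inU x \in [set (g : {perm glued}) p | g in gens glue (index_iota (m1 - j) m1)]) =
  (x \in [set (h : {perm U}) u0 | h in gens lam (index_iota 0 j)]).
Proof.
move=> jm; rewrite glueL ?leq_subr // subnn subKn; last exact: ltnW.
apply/imsetP/imsetP=> [[g /mem_emb_gens[h hG ->] e]|[h hG ->]].
  by exists h => //; apply: inU_inj; rewrite e embE.
by exists (emb inU_inj h); [apply/mem_emb_gens; exists h|rewrite embE].
Qed.

Let orbR j (x : V) :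
  (inV x \in [set (g : {perm glued}) p | g in gens glue (index_iota m1 (m1 + j))]) =
  (x \in [set (h : {perm V}) v0 | h in gens tau (index_iota 0 j)]).
Proof.
rewrite glueR // subnn addKn; apply/imsetP/imsetP.
  move=> [g /mem_emb_gens[h hG ->] e].
  by exists h => //; apply: inV_inj; rewrite e /p -inV0 embE.
move=> [h hG ->].
by exists (emb inV_inj h); [apply/mem_emb_gens; exists h|rewrite /p -inV0 embE].
Qed.

Let r := m1 + m2.

Let suppL c : c < m1 -> perm_on K (glue c).
Proof. by move=> cm; rewrite glue_lt //; apply: emb_perm_on. Qed.

Let suppR c : m1 <= c -> c < r -> perm_on R (glue c).
Proof. by move=> cm _; rewrite glue_ge //; apply: emb_perm_on. Qed.

Let fixL c : c.+1 < m1 -> glue c p = p.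
Proof.
by move=> cm; rewrite glue_lt ?embE ?(arm_fix aL) //; lia.
Qed.

Let movL : glue m1.-1 p != p.
Proof.
rewrite glue_lt; last lia.
by rewrite embE subnn (inj_eq inU_inj) (arm_mov aL).
Qed.

Let fixR c : m1 < c -> c < r -> glue c p = p.
Proof.
move=> cm cr; rewrite glue_ge; last exact: ltnW.
by rewrite /p -inV0 embE (arm_fix aT) //; lia.
Qed.

Let movR : glue m1 p != p.
Proof.
by rewrite glue_ge // /p -inV0 embE subnn (inj_eq inV_inj) (arm_mov aT).
Qed.

Let even c : c < r -> odd_perm (glue c) = false.
Proof.
rewrite /r => cr; have [cm|cm] := ltnP c m1.
  by rewrite glue_lt // odd_emb (arm_even aL) //; lia.
by rewrite glue_ge // odd_emb (arm_even aT) //; lia.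
Qed.

Let ord2 c : c < r -> #[glue c] = 2.
Proof.
rewrite /r => cr; have [cm|cm] := ltnP c m1.
  by rewrite glue_lt // order_emb (stringC_order (arm_stringC aL)) //; lia.
by rewrite glue_ge // order_emb (stringC_order (arm_stringC aT)) //; lia.
Qed.

Let commL i j : i + 2 <= j -> j < m1 -> commute (glue i) (glue j).
Proof.
move=> ij jm; rewrite !glue_lt //; last lia.
by apply/commute_emb/commute_sym/(stringC_comm (arm_stringC aL)); lia.
Qed.

Let commR i j : m1 <= i -> i + 2 <= j -> j < r -> commute (glue i) (glue j).
Proof.
rewrite /r => mi ij jm; rewrite !glue_ge //; last lia.
by apply/commute_emb/(stringC_comm (arm_stringC aT)); lia.
Qed.

Let itvL i j : i < j -> j < m1 -> gens glue (index_iota i j) :&: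
  gens glue (index_iota i.+1 j.+1) \subset gens glue (index_iota i.+1 j).
Proof.
move=> ij jm; rewrite !glueL; try lia.
rewrite setIC; apply: emb_itv.
have ij' : m1 - j.+1 < m1 - i.+1 by lia.
have jm' : m1 - i.+1 < m1 by lia.
have := stringC_itv (arm_stringC aL) ij' jm'.
have -> : (m1 - i.+1).+1 = m1 - i by lia.
by have -> : (m1 - j.+1).+1 = m1 - j by lia.
Qed.

Let itvR i j : m1 <= i -> i < j -> j < r -> gens glue (index_iota i j) :&:
  gens glue (index_iota i.+1 j.+1) \subset gens glue (index_iota i.+1 j).
Proof.
rewrite /r => mi ij jm; rewrite !glueR; try lia.
rewrite !subSn; try lia.
by apply: emb_itv; apply: (stringC_itv (arm_stringC aT)); lia.
Qed.

Let starL i : i.+1 < m1 -> forall g : {perm glued}, g \in gens glue (index_iota i m1) ->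
  (forall x, x \in K ->
    x \notin [set (h : {perm glued}) p | h in gens glue (index_iota i.+1 m1)] -> g x = x) ->
  g \in gens glue (index_iota i.+1 m1).
Proof.
move=> im g hG hx; move: hG; rewrite !glueL ?subnn //; try lia.
case/mem_emb_gens=> h hG gE; rewrite {}gE in hx *; apply/mem_emb_gens; exists h => //.
apply: (arm_star aL) => [||| x xN]; try lia.
  by have -> : (m1 - i.+1).+1 = m1 - i by lia.
apply: inU_inj; rewrite -(embE inU_inj); apply: hx; first by rewrite inE codom_f.
have jm : m1 - i.+1 < m1 by lia.
by have := orbL x jm; rewrite subKn ?(ltnW im) // => ->.
Qed.

Let starR j : m1 < j -> j < r -> forall g : {perm glued},
  g \in gens glue (index_iota m1 j.+1) ->
  (forall x, x \in R ->
    x \notin [set (h : {perm glued}) p | h in gens glue (index_iota m1 j)] -> g x = x) ->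
  g \in gens glue (index_iota m1 j).
Proof.
rewrite /r => mj jr g hG hx; move: hG; rewrite !glueR // !subnn.
case/mem_emb_gens=> h hG gE; rewrite {}gE in hx *; apply/mem_emb_gens; exists h => //.
apply: (arm_star aT) => [||| x xN]; try lia.
  by have <- : j.+1 - m1 = (j - m1).+1 by lia.
apply: inV_inj; rewrite -(embE inV_inj); apply: hx; first by rewrite inE codom_f.
by have := @orbR (j - m1) x; rewrite subnKC ?(ltnW mj) // => ->.
Qed.

Let m1r : m1 < r. Proof. by rewrite /r; lia. Qed.

Lemma glue_stringC : stringC glue (m1 + m2).
Proof. exact: (join_stringC m1_gt0 m1r KR). Qed.

Lemma glue_nc : ~ commute (glue m1.-1) (glue m1).
Proof. by apply: (join_nc m1_gt0 m1r KR). Qed.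

Hypotheses (tL : arm_transitive m1 lam u0) (tT : arm_transitive m2 tau v0).

Lemma glue_Alt : gens glue (index_iota 0 (m1 + m2)) = 'Alt_glued :> {set {perm glued}}.
Proof.
apply: (join_Alt m1_gt0 m1r KR) => //.
apply/setP=> x; rewrite inE [RHS]inE; apply/orP.
have L u : inU u \in [set (g : {perm glued}) p | g in gens glue (index_iota 0 m1)].
  have [h hG ->] := tL u; apply/imsetP; exists (emb inU_inj h); last by rewrite embE.
  by rewrite glueL // subnn subn0; apply/mem_emb_gens; exists h.
case: x => [u|[v vN]]; [by left; apply: L|right].
have -> : inr (exist _ v vN) = inV v.
  by rewrite (inVN vN); congr inr; apply: val_inj.
have [h hG ->] := tT v; apply/imsetP; exists (emb inV_inj h).
  by rewrite glueR // subnn /r addKn; apply/mem_emb_gens; exists h.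
by rewrite /p -inV0 embE.
Qed.

End Glue.

Section Transport.

Variables (X : finType) (n : nat).
Hypothesis cX : #|X| = n.

Let f (x : X) : 'I_n := cast_ord cX (enum_rank x).
Let f_inj : injective f.
Proof. by move=> x y /cast_ord_inj/enum_rank_inj. Qed.

Let f' (i : 'I_n) : X := enum_val (cast_ord (esym cX) i).
Let fK i : f (f' i) = i.
Proof. by rewrite /f enum_valK cast_ordKV. Qed.

Let f'_inj : injective f' := can_inj fK.
Let f'K x : f' (f x) = x.
Proof. by apply: f_inj; rewrite fK. Qed.

Lemma transport_rep r t :
  reducible_rep 'Alt_X r t -> reducible_rep 'Alt_('I_n) r t.
Proof.
case=> rho [sC GE n01 n12 od]; exists (fun c => emb f_inj (rho c)); split.
- split=> [i ir|i j ij jr|i j ij jr].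
  + by rewrite order_emb (stringC_order sC).
  + by apply/commute_emb/(stringC_comm sC).
  by apply: emb_itv; apply: (stringC_itv sC).
- apply/setP=> g; rewrite Alt_even; apply/idP/idP.
    by case/mem_emb_gens=> h; rewrite GE Alt_even => he ->; rewrite odd_emb.
  move=> ge; apply/mem_emb_gens; exists (emb f'_inj g); first by rewrite GE Alt_even odd_emb.
  by apply/permP=> i; rewrite -{2}[i]fK embE -{1}[i]fK -{2}[f' i]f'K embE !fK.
- by move/commute_emb.
- by move/commute_emb.
by move=> i i2 it ir; rewrite -embM order_emb; apply: od.
Qed.

End Transport.

(** * Certified computation with tables of values *)

Section Tables.

Variable N : nat.
Implicit Types (l : seq (nat * nat)) (x y : seq nat) (g h : {perm 'I_N.+1}).

Definition prod_tperm l : {perm 'I_N.+1} :=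
  foldr (fun q g => tperm (inord q.1) (inord q.2) * g) 1 l.

Definition swap_nat (q : nat * nat) a :=
  if a == q.1 then q.2 else if a == q.2 then q.1 else a.

Definition table l := [seq foldl (fun b q => swap_nat q b) a l | a <- iota 0 N.+1].

Definition table_of g : seq nat := [seq nat_of_ord (g (inord a)) | a <- iota 0 N.+1].

Definition comp_table x y := [seq nth 0 y a | a <- x].

Definition bounded l := all (fun q => [&& q.1 <= N, q.2 <= N & q.1 != q.2]) l.

Lemma table_prod_tperm l : bounded l -> table_of (prod_tperm l) = table l.
Proof.
move=> bl; apply/eq_in_map=> a; rewrite mem_iota add0n => /= aN.
elim: l bl a aN => [|[b c] l IH] bl a aN; first by rewrite /= perm1 inordK.
case/andP: bl => /= /and3P[bN cN bc] bl; rewrite permM.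
rewrite -[tperm _ _ _]inord_val IH //.
rewrite /swap_nat /=; congr foldl.
have io d : d <= N -> (inord a == inord d :> 'I_N.+1) = (a == d).
  by move=> dN; rewrite -val_eqE /= !inordK.
case: tpermP => [/eqP|/eqP|/eqP + /eqP]; rewrite ?io // ?inordK //.
- by move=> ->.
- by move/eqP->; rewrite eq_sym (negbTE bc) eqxx.
by move=> /negbTE -> /negbTE ->.
Qed.

Lemma table_of_inj : injective table_of.
Proof.
move=> g h /eq_in_map e; apply/permP=> i; apply: val_inj.
by have := e i; rewrite mem_iota add0n inord_val => /(_ (ltn_ord i)).
Qed.

Lemma table_ofM g h : table_of (g * h) = comp_table (table_of g) (table_of h).
Proof.
rewrite /comp_table -map_comp; apply/eq_in_map=> a aI /=.
rewrite permM (nth_map 0) ?size_iota // nth_iota // add0n inord_val //.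
Qed.

Lemma nth_table_of g a : a <= N -> nth 0 (table_of g) a = g (inord a) :> nat.
Proof. by move=> aN; rewrite (nth_map 0) ?size_iota // nth_iota. Qed.

Lemma table_of1 : table_of 1 = iota 0 N.+1.
Proof.
rewrite -[RHS]map_id; apply/eq_in_map=> a; rewrite mem_iota perm1 => /andP[_ aN].
by rewrite inordK.
Qed.

Fixpoint search fuel (ts : seq (seq nat)) (seen todo : seq (seq nat)) :=
  if fuel is f.+1 then
    if todo is x :: todo' then
      let new := [seq y <- undup [seq comp_table x t | t <- ts] | y \notin seen] in
      search f ts (new ++ seen) (todo' ++ new)
    else seen
  else seen.

Definition closure fuel ts := search fuel ts [:: iota 0 N.+1] [:: iota 0 N.+1].

Definition closed ts (s : seq (seq nat)) :=
  (iota 0 N.+1 \in s) && all (fun x => all (fun t => comp_table x t \in s) ts) s.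

Variable prs : seq (seq (nat * nat)).
Let tau c := prod_tperm (nth [::] prs c).
Let tabs i j := [seq table (nth [::] prs c) | c <- index_iota i j].

Variable fuel : nat.

Definition elements i j := closure fuel (tabs i j).

Definition good i j := all bounded prs && closed (tabs i j) (elements i j).

Lemma bounded_nth c : all bounded prs -> bounded (nth [::] prs c).
Proof.
move=> b; have [cs|sc] := ltnP c (size prs); first exact: (all_nthP _ b).
by rewrite nth_default.
Qed.

Lemma elements_sound i j x : all bounded prs -> x \in elements i j ->
  exists2 h, h \in gens tau (index_iota i j) & table_of h = x.
Proof.
pose P x := exists2 h, h \in gens tau (index_iota i j) & table_of h = x.
move=> bp; rewrite -/(P x).
have P1 y : y \in [:: iota 0 N.+1] -> P y.
  by rewrite inE => /eqP ->; exists 1; rewrite ?group1 ?table_of1.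
have PM y t : t \in tabs i j -> P y -> P (comp_table y t).
  case/mapP=> c ci -> [h hG <-]; exists (h * tau c).
    by rewrite groupM // mem_gens.
  by rewrite table_ofM table_prod_tperm //; apply: bounded_nth.
suff gen f seen todo : (forall y, y \in seen -> P y) -> (forall y, y \in todo -> P y) ->
    x \in search f (tabs i j) seen todo -> P x by exact: (gen _ _ _ P1 P1).
elim: f seen todo => [|f IH] seen todo hs ht; first exact: hs.
case: todo ht => [|y todo] ht; first exact: hs.
have Py : P y by apply: ht; apply: mem_head.
apply: IH => z; rewrite mem_cat mem_filter mem_undup.
  by case/orP=> [/andP[_ /mapP[t tt ->]]|/hs //]; apply: PM.
by case/orP=> [zt|/andP[_ /mapP[t tt ->]]]; [apply: ht; rewrite inE zt orbT|apply: PM].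
Qed.

(** The search only produces products of generators, and a list that passes [closed] contains all of
    them by induction on words. Nothing therefore has to be proved about termination: too little
    [fuel] could only make the test fail. *)
Lemma mem_elements i j : good i j -> forall g,
  (g \in gens tau (index_iota i j)) = (table_of g \in elements i j).
Proof.
case/andP=> bp /andP[s1 /allP sM] g; apply/idP/idP.
  move: g; apply: gens_ind => [|g c ci gs]; first by rewrite table_of1.
  rewrite table_ofM table_prod_tperm; last exact: bounded_nth.
  by apply: (allP (sM _ gs)); apply: map_f.
by case/(elements_sound bp)=> h hG /table_of_inj <-.
Qed.

Let m := size prs.
Let tab c := table (nth [::] prs c).
Let id_tab := iota 0 N.+1.

Definition stringC_check :=
  [&& all bounded prs,
      all (fun c => (comp_table (tab c) (tab c) == id_tab) && (tab c != id_tab)) (iota 0 m),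
      all (fun i => all (fun j => (i + 2 <= j) ==>
        (comp_table (tab i) (tab j) == comp_table (tab j) (tab i))) (iota 0 m)) (iota 0 m)
    & all (fun i => all (fun j => (i < j) ==>
        let A := elements i j in let B := elements i.+1 j.+1 in
        let C := elements i.+1 j in
        [&& closed (tabs i j) A, closed (tabs i.+1 j.+1) B, closed (tabs i.+1 j) C
          & all (fun x => (x \in B) ==> (x \in C)) A]) (iota 0 m)) (iota 0 m)].

Lemma stringC_table : stringC_check -> stringC tau m.
Proof.
case/and4P=> bp /allP o2 /allP cm /allP it.
have tE c : table_of (tau c) = tab c by apply: table_prod_tperm; apply: bounded_nth.
split=> [i im|i j ij jm|i j ij jm].
- have /andP[/eqP sq n1] : (comp_table (tab i) (tab i) == id_tab) && (tab i != id_tab).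
    by apply: o2; rewrite mem_iota.
  apply: nt_prime_order => //.
    by apply: table_of_inj; rewrite table_ofM tE sq table_of1.
  by apply: contraNneq n1 => e; rewrite -tE e table_of1.
- have im : i \in iota 0 m by rewrite mem_iota; lia.
  have jm' : j \in iota 0 m by rewrite mem_iota.
  move/implyP: (allP (cm i im) j jm') => /(_ ij)/eqP e.
  by apply: table_of_inj; rewrite !table_ofM !tE.
have im : i \in iota 0 m by rewrite mem_iota; lia.
have jm' : j \in iota 0 m by rewrite mem_iota.
move/implyP: (allP (it i im) j jm') => /(_ ij)/and4P[gA gB gC /allP sub].
apply/subsetP=> g; rewrite inE !mem_elements ?/good ?bp // => /andP[/sub/implyP].
exact.
Qed.

Variable v : nat.

Definition orbit_of (s : seq (seq nat)) := [seq nth 0 x v | x <- s].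

Definition arm_check :=
  [&& v <= N, 0 < m, nth 0 (tab 0) v != v,
      all (fun c => (0 < c) ==> (nth 0 (tab c) v == v)) (iota 0 m),
      all (fun l => ~~ odd (size l)) prs,
      stringC_check
    & all (fun j => (0 < j) ==>
        let A := elements 0 j.+1 in let B := elements 0 j in
        let o := orbit_of B in
        [&& closed (tabs 0 j.+1) A, closed (tabs 0 j) B
          & all (fun x => all (fun a => (a \in o) || (nth 0 x a == a)) (iota 0 N.+1)
                 ==> (x \in B)) A]) (iota 0 m)].

Lemma odd_prod_tperm l : bounded l -> odd_perm (prod_tperm l) = odd (size l).
Proof.
elim: l => [|[a b] l IH] /=; first by rewrite odd_perm1.
case/andP=> /and3P[aN bN ab] bl; rewrite odd_permM IH // odd_tperm -val_eqE /= !inordK //.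
by rewrite ab.
Qed.

Lemma arm_table : arm_check -> arm m tau (inord v).
Proof.
case/and5P=> vN m0 mv /allP fx /and3P[ev sc /allP st].
have bp : all bounded prs by case/andP: sc.
have tE c : table_of (tau c) = tab c by apply: table_prod_tperm; apply: bounded_nth.
have tv c : tau c (inord v) = nth 0 (tab c) v :> nat by rewrite -tE nth_table_of.
have vE : (inord v : 'I_N.+1) = v :> nat by rewrite inordK.
split=> [||c c0 cm|c cm||j j0 jm g gG gx] //.
- by rewrite -val_eqE /= tv vE.
- apply: val_inj; rewrite /= tv vE; apply/eqP.
  by have := fx c; rewrite mem_iota add0n cm => /(_ isT)/implyP; apply.
- by rewrite odd_prod_tperm ?bounded_nth //; apply/negbTE/(all_nthP _ ev).
- exact: stringC_table.
have := st j; rewrite mem_iota add0n jm => /(_ isT)/implyP/(_ j0)/and3P[gA gB /allP sub].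
have gA' : good 0 j.+1 by rewrite /good bp.
have gB' : good 0 j by rewrite /good bp.
rewrite mem_elements //; move: gG; rewrite mem_elements // => gG.
move/implyP: (sub _ gG); apply; apply/allP=> a; rewrite mem_iota add0n => /andP[_ aN].
rewrite nth_table_of // -implyNb; apply/implyP=> ao.
rewrite gx ?inordK //; apply: contraNN ao => /imsetP[h].
rewrite mem_elements // => hB e; apply/mapP; exists (table_of h) => //.
by rewrite nth_table_of // -e inordK.
Qed.

Definition transitive_check :=
  let A := elements 0 m in
  closed (tabs 0 m) A && all (fun a => a \in orbit_of A) (iota 0 N.+1).

Lemma arm_transitive_table : all bounded prs -> v <= N -> transitive_check ->
  arm_transitive m tau (inord v).
Proof.
move=> bp vN /andP[cA /allP tr] w.
have /tr/mapP[x xA wE] : nat_of_ord w \in iota 0 N.+1 by rewrite mem_iota ltn_ord.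
have [h hG hx] := elements_sound bp xA.
by exists h => //; apply: val_inj; rewrite /= wE -hx nth_table_of.
Qed.

(** The exponent 15 covers both odd orders that occur, 3 and 5. *)
Definition odd_check c :=
  iter 15 (fun y => comp_table y (comp_table (tab c) (tab c.+1))) id_tab == id_tab.

Lemma odd_order_table c : all bounded prs -> odd_check c -> odd #[tau c * tau c.+1].
Proof.
have tE b : all bounded prs -> table_of (tau b) = tab b.
  by move=> bp; apply: table_prod_tperm; apply: bounded_nth.
move=> bp /eqP e; have : #[tau c * tau c.+1] %| 15.
  rewrite order_dvdn; apply/eqP/table_of_inj; rewrite table_of1 -[RHS]e.
  elim: 15 => [|k IH]; first by rewrite expg0 table_of1.
  by rewrite expgSr table_ofM IH table_ofM !tE.
by move/dvdn_odd; apply.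
Qed.

Lemma table_nc c d a : all bounded prs -> a <= N ->
  nth 0 (comp_table (tab c) (tab d)) a != nth 0 (comp_table (tab d) (tab c)) a ->
  ~ commute (tau c) (tau d).
Proof.
move=> bp aN /eqP ne e; apply: ne.
rewrite /tab -(table_prod_tperm (bounded_nth c bp)) -(table_prod_tperm (bounded_nth d bp)).
by rewrite -!table_ofM e.
Qed.

Definition word w := foldl (fun y c => comp_table y (tab c)) id_tab w.

Definition cyc3_table (x y z : nat) :=
  [seq if a == x then y else if a == y then z else if a == z then x else a | a : nat <- id_tab].

Fixpoint grow_check (S : seq nat) (steps : seq (seq nat * nat * nat)) :=
  if steps is (w, a, b) :: steps' then
    [&& all (fun c => c < m) w, a <= N, b <= N, a \in S, b \in S, nth 0 (word w) b \in S
      & grow_check (nth 0 (word w) a :: S) steps']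
  else all (fun a => a \in S) id_tab.

(* [w] is a word for a 3-cycle of x, y, z; each step (g, a, b) adds g a to a
   set that already contains a, b and g b. *)
Definition Alt_check w (x y z : nat) steps :=
  [&& all bounded prs, all (fun l => ~~ odd (size l)) prs, all (fun c => c < m) w,
      uniq [:: x; y; z], all (fun a => a <= N) [:: x; y; z], word w == cyc3_table x y z
    & grow_check [:: x; y; z] steps].

Lemma word_sound w : all bounded prs -> all (fun c => c < m) w ->
  exists2 h, h \in gens tau (index_iota 0 m) & table_of h = word w.
Proof.
move=> bp; elim/last_ind: w => [|w c IH]; first by exists 1; rewrite ?group1 ?table_of1.
rewrite all_rcons => /andP[cm /IH[h hG hw]]; exists (h * tau c).
  by rewrite groupM // mem_gens // mem_index_iota.
rewrite table_ofM hw table_prod_tperm; last exact: bounded_nth.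
by rewrite /word foldl_rcons.
Qed.

Lemma table_of_cyc3 (x y z : nat) : uniq [:: x; y; z] -> all (fun a => a <= N) [:: x; y; z] ->
  table_of (cyc3 (inord x) (inord y) (inord z)) = cyc3_table x y z.
Proof.
move=> u /= /and4P[xN yN zN _]; apply/eq_in_map=> a; rewrite mem_iota add0n => /= aN.
have io d e : d <= N -> e <= N -> (inord d == inord e :> 'I_N.+1) = (d == e).
  by move=> dN eN; rewrite -val_eqE /= !inordK.
have u' : uniq [:: inord x; inord y; inord z : 'I_N.+1].
  by move: u; rewrite /= !inE !io.
have [cx cy cz cO] := cyc3E u'.
have [->|ax] := eqVneq a x; first by rewrite cx inordK.
have [->|ay] := eqVneq a y; first by rewrite cy inordK.
have [->|az] := eqVneq a z; first by rewrite cz inordK.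
by rewrite cO ?inordK // !inE !io // !negb_or ax ay.
Qed.

(** An alternating group is too large to enumerate, so the input is a certificate: a word for one
    3-cycle, then moves permitted by the block property of [alt_on_max] until every point is
    reached. *)
Lemma Alt_table w (x y z : nat) steps : Alt_check w x y z steps ->
  gens tau (index_iota 0 m) = 'Alt_('I_N.+1) :> {set {perm 'I_N.+1}}.
Proof.
case/and5P=> bp ev wm u /and3P[le /eqP wE gr].
apply/eqP; rewrite eqEsubset; apply/andP; split; apply/subsetP=> g.
  rewrite Alt_even; move: g; apply: gens_ind; first by rewrite odd_perm1.
  move=> h c; rewrite mem_index_iota => /andP[_ cm] he.
  rewrite odd_permM odd_prod_tperm; last exact: bounded_nth.
  by rewrite (negbTE (all_nthP [::] ev c cm)) addbF.
have cG : cyc3 (inord x) (inord y) (inord z) \in gens tau (index_iota 0 m).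
  have [h hG] := word_sound bp wm.
  by rewrite wE -table_of_cyc3 // => /table_of_inj <-.
have u' : uniq [:: inord x; inord y; inord z : 'I_N.+1].
  move: u le => /= + /and4P[xN yN zN _].
  by rewrite !inE -!val_eqE /= !inordK.
have [|S [/subsetP sub aS grow]] := alt_on_max (alt_on3 u' cG); first by rewrite cards3.
have S0 a : a \in [:: x; y; z] -> inord a \in S.
  by rewrite !inE => h; apply: sub; rewrite !inE; case/or3P: h => /eqP ->; rewrite eqxx ?orbT.
rewrite Alt_even => ge; apply: alt_on_even aS _ ge; apply/subsetP=> u0 _.
suff main (l : seq nat) : (forall a : nat, a \in l -> inord a \in S) -> grow_check l steps -> u0 \in S.
  exact: main S0 gr.
elim: steps {gr} l => [|[[g' a] b] steps IH] l lS.
  move/allP=> h; have /h/lS : nat_of_ord u0 \in id_tab by rewrite mem_iota ltn_ord.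
  by rewrite inord_val.
case/and5P=> gm aN bN al /and3P[bl gbl]; apply: IH => a'.
have [h hG hw] := word_sound bp gm; rewrite inE => /orP[/eqP->|]; last exact: lS.
rewrite -hw nth_table_of // inord_val; apply: (grow _ _ (inord b)) => //; try exact: lS.
by move/lS: gbl; rewrite -hw nth_table_of // inord_val.
Qed.

End Tables.

(** * Paths and ladders *)

Section Involution.

Variable T : finType.

Definition invol_perm (f : T -> T) (fK : involutive f) : {perm T} := perm (inv_inj fK).

Lemma order_invol (s : {perm T}) : (forall x, s (s x) = x) -> s != 1 -> #[s] = 2.
Proof.
move=> sK s1; apply: nt_prime_order => //.
by apply/permP=> x; rewrite expgS expg1 permM sK perm1.
Qed.

(** Splitting off the transposition of a moved point and its image lowers the number of moved points
    by two. *)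
Lemma odd_invol (s : {perm T}) : (forall x, s (s x) = x) ->
  odd_perm s = odd #|[set x | s x != x]|./2.
Proof.
have [n] := ubnP #|[set x | s x != x]|; elim: n s => // n IH s le_n sK.
have [e|/set0Pn[x]] := eqVneq [set x | s x != x] set0.
  rewrite e cards0; suff -> : s = 1 by rewrite odd_perm1.
  apply/permP=> x; rewrite perm1; apply/eqP/negPn.
  by have := in_set0 x; rewrite -e inE => ->.
rewrite inE => sx; set y := s x in sx; pose t := tperm x y * s.
have sy : s y = x by rewrite /y sK.
have tE z : t z = if z == x then x else if z == y then y else s z.
  rewrite permM; case: tpermP => [->|->|/eqP/negbTE -> /eqP/negbTE -> //].
    by rewrite eqxx sy.
  by rewrite (negbTE sx) eqxx.
have tK z : t (t z) = z.
  have zs : (s z == x) = (z == y) by rewrite -{1}sy (inj_eq perm_inj).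
  have zy : (s z == y) = (z == x) by rewrite /y (inj_eq perm_inj).
  rewrite !tE; have [->|zx] := eqVneq z x; first by rewrite eqxx.
  have [->|zNy] := eqVneq z y; first by rewrite (negbTE sx) eqxx.
  by rewrite zs (negbTE zNy) zy (negbTE zx) sK.
have cE : #|[set x | s x != x]| = #|[set x | t x != x]|.+2.
  rewrite (cardsD1 x) inE sx (cardsD1 y) !inE sx sy eq_sym sx /= !add1n.
  congr _.+2; apply: eq_card => z; rewrite !inE tE.
  have [->|zx] := eqVneq z x; first by rewrite eqxx andbF.
  by have [->|zy] := eqVneq z y; rewrite ?eqxx.
rewrite cE /= -(IH t) //; last by rewrite cE in le_n; lia.
by rewrite odd_permM odd_tperm eq_sym sx addTb negbK.
Qed.

End Involution.

Section PathArm.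

Variable s : nat.
Hypothesis s_gt0 : 0 < s.
Local Notation V := 'I_(4 * s).+1.

(** Together with [path1], the alternately labelled edges of the path 0 - 1 - ... - 4 s. Each label
    occurs on 2 s edges, which makes both generators even. *)
Definition path0 a := if odd a then a.-1 else if a < 4 * s then a.+1 else a.
Definition path1 a := if odd a then a.+1 else a.-1.

Let path0_fun (x : V) : V := inord (path0 x).
Let path1_fun (x : V) : V := inord (path1 x).

Let path0_val x : path0_fun x = path0 x :> nat.
Proof.
by rewrite inordK // /path0; have := ltn_ord x; do ?[case: ifP => ?]; lia.
Qed.

Let path1_val x : path1_fun x = path1 x :> nat.
Proof.
by rewrite inordK // /path1; have := ltn_ord x; do ?[case: ifP => ?]; lia.
Qed.

Let path0K : involutive path0_fun.
Proof.
move=> x; apply: val_inj; rewrite /= !path0_val {2}/path0; have := ltn_ord x.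
case ox: (odd x) => xs.
  have ox' : odd x.-1 = false by lia.
  have lx : x.-1 < 4 * s by lia.
  by rewrite /path0 ox' lx; lia.
case: ifP => lx; last by rewrite /path0 ox lx.
have ox' : odd x.+1 by lia.
by rewrite /path0 ox'.
Qed.

Let path1K : involutive path1_fun.
Proof.
move=> x; apply: val_inj; rewrite /= !path1_val {2}/path1; have := ltn_ord x.
case ox: (odd x) => xs.
  have ox' : odd x.+1 = false by lia.
  by rewrite /path1 ox'; lia.
have [->|x0] := eqVneq (x : nat) 0; first by rewrite /path1.
have ox' : odd x.-1 by lia.
by rewrite /path1 ox'; lia.
Qed.

Definition path_gen (c : nat) : {perm V} :=
  if c == 0 then invol_perm path0K else invol_perm path1K.

Let g0E x : path_gen 0 x = path0 x :> nat. Proof. by rewrite permE path0_val. Qed.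

Let g1E x : path_gen 1%N x = path1 x :> nat. Proof. by rewrite permE path1_val. Qed.

Let v0 : V := ord0.

Let genK c x : path_gen c (path_gen c x) = x.
Proof. by rewrite /path_gen; case: (c == 0); rewrite !permE ?path0K ?path1K. Qed.

Let gen_c c : 0 < c -> path_gen c = path_gen 1%N. Proof. by case: c. Qed.

Let oddG c : c < 2 -> odd_perm (path_gen c) = false.
Proof.
move=> c2; rewrite odd_invol //.
suff -> : #|[set x | path_gen c x != x]| = #|[set~ (if c == 0 then ord_max else v0 : V)]|.
  by rewrite cardsC1 card_ord; lia.
apply: eq_card => x; rewrite !inE -!val_eqE /=; have := ltn_ord x.
case: c c2 => [|[|//]] _; rewrite ?g0E ?g1E /= /path0 /path1; do ?[case: ifP => ?]; lia.
Qed.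

Lemma path_stringC : stringC path_gen 2.
Proof.
have o2 c : #[path_gen c] = 2.
  apply: order_invol => //; apply/eqP=> e.
  have /(congr1 val) := congr1 (fun t : {perm V} => t (inord 1%N)) e.
  rewrite perm1 /=; case: c e => [|c] _; first by rewrite g0E /path0 inordK /=; lia.
  by rewrite gen_c // g1E /path1 inordK /=; lia.
split=> [c _|i j ij j2|i j ij j2]; [exact: o2|lia|].
have -> : i = 0 by lia.
have -> : j = 1%N by lia.
apply/subsetP=> g; rewrite inE => /andP[].
have /subsetP sub : gens path_gen (index_iota 0 1%N) \subset <[path_gen 0]>.
  by apply: gens_sub => c; rewrite mem_index_iota => cI; have -> : c = 0 by [lia]; apply: cycle_id.
move/sub; rewrite cycle2g // !inE => /orP[/eqP-> //|/eqP->] h.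
have : forall g, g \in gens path_gen (index_iota 1%N 2) -> g v0 = v0.
  apply: gens_ind => [|h' c]; first by rewrite perm1.
  rewrite mem_index_iota => cI h0; rewrite permM h0; apply: val_inj.
  by rewrite gen_c; [rewrite /= g1E|lia].
by move/(_ _ h)/(congr1 val); rewrite /= g0E /path0 /=; case: ifP; lia.
Qed.

Lemma path_arm : arm 2 path_gen v0.
Proof.
split=> //.
- by rewrite -val_eqE /= g0E /path0 /=; case: ifP; lia.
- by move=> c c0 _; apply: val_inj; rewrite gen_c //= g1E.
- exact: path_stringC.
(* The arm condition only concerns j = 1: an even permutation that moves no point besides v0 and its
   image under generator 0 is trivial. *)
move=> j j0 j2 g; have {j j0 j2} -> : j = 1%N by lia.
move=> gG gx; suff -> : g = 1 by apply: group1.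
have ge : ~~ odd_perm g.
  move: g gG {gx}; apply: gens_ind; first by rewrite odd_perm1.
  by move=> g c; rewrite mem_index_iota => cI ge; rewrite odd_permM oddG ?addbF.
pose w : V := path_gen 0 v0.
have wN : w != v0 by rewrite -val_eqE /= g0E /path0 /=; case: ifP; lia.
have out x : x != v0 -> x != w -> g x = x.
  move=> xv xw; apply: gx; apply/imsetP=> -[h].
  have /subsetP sub : gens path_gen (index_iota 0 1%N) \subset <[path_gen 0]>.
    by apply: gens_sub => c; rewrite mem_index_iota => cI; have -> : c = 0 by [lia]; apply: cycle_id.
  have o2 := stringC_order path_stringC (isT : 0 < 2).
  move/sub; rewrite cycle2g // !inE => /orP[]/eqP-> xE; move: xv xw.
    by rewrite xE perm1 eqxx.
  by rewrite xE eqxx.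
have [gv|gv] := eqVneq (g v0) v0.
  apply/permP=> x; rewrite perm1; have [->//|xv] := eqVneq x v0.
  have [->|] := eqVneq x w; last exact: out.
  apply: contraTeq isT => gw; have := out (g w).
  by rewrite gw -{1}gv (inj_eq perm_inj) wN => /(_ isT isT)/perm_inj/eqP; rewrite (negbTE gw).
case/negP: ge; suff -> : g = tperm v0 w by rewrite odd_tperm eq_sym.
have gvw : g v0 = w.
  apply: contraTeq isT => gw; have := out _ gv gw.
  by move/perm_inj/eqP; rewrite (negbTE gv).
apply/permP=> x; case: tpermP => [->//|->|/eqP xv /eqP xw]; last exact: out.
apply: contraTeq isT => gw.
have gww : g w != w by rewrite -gvw (inj_eq perm_inj).
by have /perm_inj/eqP := out _ gw gww; rewrite (negbTE gww).
Qed.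

Lemma path_transitive : arm_transitive 2 path_gen v0.
Proof.
suff main n : forall x : V, x <= n -> exists2 h : {perm V},
    h \in gens path_gen (index_iota 0 2) & x = h v0 by move=> x; apply: (main x).
elim: n => [|n IH] x xn.
  by exists 1; rewrite ?group1 // perm1; apply: val_inj => /=; lia.
have [xn'|nx] := leqP x n; first exact: IH.
pose c := ~~ odd x : nat; pose y := path_gen c x.
have cI : c < 2 by rewrite /c; case: odd.
have yn : y <= n.
  rewrite /y /c; have := ltn_ord x; case xo: (odd x) => /=.
    by rewrite g0E /path0 xo; lia.
  by rewrite g1E /path1 xo; lia.
have [h hG yE] := IH y yn; exists (h * path_gen c).
  by rewrite groupM // mem_gens // mem_index_iota.
by rewrite permM -yE /y genK.
Qed.

Lemma path_nc : ~ commute (path_gen 0) (path_gen 1%N).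
Proof.
move=> e; have := congr1 (fun t : {perm V} => val (t v0)) e.
by rewrite /= !permM !g0E !g1E /path0 /path1 ?g0E ?g1E /path0 /path1 /=; do ?[case: ifP => ?]; lia.
Qed.

End PathArm.

(** * Signed permutations of the columns of a ladder *)

Section SignedPerm.

Variable m : nat.
Local Notation C := 'I_m.+1.
Implicit Types (s t : {perm C}) (e : C -> bool).

(** Elements of the hyperoctahedral group: columns are permuted by [s], and the two rows are
    exchanged in the columns where [e] holds. The sign is read before the column moves, whence the
    shift in [signedM]. *)
Definition signed_fun s e (x : C * bool) := (s x.1, x.2 (+) e x.1).

Lemma signed_fun_inj s e : injective (signed_fun s e).
Proof. by move=> [x b] [y c] [/perm_inj /= -> /addIb ->]. Qed.

Definition signed s e : {perm C * bool} := perm (@signed_fun_inj s e).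

Lemma signedE s e x b : signed s e (x, b) = (s x, b (+) e x).
Proof. by rewrite permE. Qed.

Lemma signedM s e t f :
  signed s e * signed t f = signed (s * t) (fun x => e x (+) f (s x)).
Proof. by apply/permP=> -[x b]; rewrite permM !signedE permM addbA. Qed.

Lemma eq_signed s e f : e =1 f -> signed s e = signed s f.
Proof. by move=> ef; apply/permP=> -[x b]; rewrite !signedE ef. Qed.

Lemma signed1 : signed 1 (fun=> false) = 1.
Proof. by apply/permP=> -[x b]; rewrite signedE !perm1 addbF. Qed.

Lemma signed_inj s e t f : signed s e = signed t f -> s = t /\ e =1 f.
Proof.
move=> h; split=> [|x].
  by apply/permP=> x; have := congr1 (fun g : {perm C * bool} => g (x, false)) h;
    rewrite !signedE => -[].
by have := congr1 (fun g : {perm C * bool} => g (x, false)) h; rewrite !signedE => -[].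
Qed.

Definition adj (c : nat) : {perm C} := tperm (inord c) (inord c.+1).

Definition win lo hi : {set C} := [set x : C | lo <= x <= hi].

Lemma adj_val c (x : C) : c < m ->
  adj c x = (if x == c :> nat then c.+1 else if x == c.+1 :> nat then c else x) :> nat.
Proof.
move=> cm; rewrite /adj; have cE : (inord c : C) = c :> nat by rewrite inordK; lia.
have cE' : (inord c.+1 : C) = c.+1 :> nat by rewrite inordK; lia.
case: tpermP => [->|->|].
- by rewrite cE cE' eqxx.
- by rewrite cE cE' eqxx; case: eqP => //; lia.
by move=> /eqP + /eqP; rewrite -!val_eqE /= cE cE' => /negbTE -> /negbTE ->.
Qed.

Lemma adj_win c lo hi : lo <= c -> c < hi -> hi <= m -> perm_on (win lo hi) (adj c).
Proof.
move=> loc chi him; apply/subsetP=> x; rewrite !inE -val_eqE /= adj_val; last lia.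
by do ?[case: eqP]; lia.
Qed.

Lemma adj_sqr c : adj c * adj c = 1. Proof. exact: tperm2. Qed.

Lemma perm_on_win lo hi s (x : C) : perm_on (win lo hi) s -> (x < lo) || (hi < x) -> s x = x.
Proof. by move=> sw xN; apply: (out_perm sw); rewrite inE; lia. Qed.

Lemma win_stable lo hi s (x : C) : perm_on (win lo hi) s -> (lo <= s x <= hi) = (lo <= x <= hi).
Proof. by move=> sw; have := perm_closed x sw; rewrite !inE. Qed.

Lemma perm_on_win_shrink lo hi s : perm_on (win lo hi.+1) s ->
  (forall x : C, x = hi.+1 :> nat -> s x = x) -> perm_on (win lo hi) s.
Proof.
move=> sw sx; apply/subsetP=> x; rewrite !inE => h.
have := subsetP sw x; rewrite !inE h => /(_ isT) xI.
have : x != hi.+1 :> nat by apply: contra h => /eqP/sx ->.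
by lia.
Qed.

Lemma perm_on_win1 lo hi s : hi <= lo -> perm_on (win lo hi) s -> s = 1.
Proof.
move=> hl sw; apply/permP=> x; rewrite perm1; apply: contraTeq isT => h.
have := subsetP sw x; rewrite !inE h => /(_ isT) xI.
have := win_stable x sw; rewrite xI => sI.
by case/eqP: h; apply: val_inj => /=; lia.
Qed.

Lemma adj_cube c : c.+1 < m -> (adj c * adj c.+1) ^+ 3 = 1.
Proof.
move=> cm; set u := adj c * adj c.+1.
have uE (x : C) : u x = (if x == c :> nat then c + 2 else
    if x == c.+1 :> nat then c else if x == c + 2 :> nat then c.+1 else x) :> nat.
  by rewrite permM !adj_val; try lia; do ?[case: eqP]; lia.
clearbody u; rewrite !expgS expg0 mulg1.
by apply/permP=> x; apply: val_inj; rewrite perm1 !permM /= !uE; do ?[case: eqP]; lia.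
Qed.

(** Bubble sort: the image of the top column is raised step by step to [hi], after which the window
    shrinks. *)
Lemma adj_gens lo hi s : hi <= m -> perm_on (win lo hi) s -> s \in gens adj (index_iota lo hi).
Proof.
have [d] := ubnP (hi - lo); elim: d hi s => // d IH hi s le_d him sw.
have [hl|lh] := leqP hi lo; first by rewrite (perm_on_win1 hl sw).
pose h : C := inord hi; have hE : h = hi :> nat by rewrite inordK.
have [k] := ubnP (hi - s h); elim: k s sw => // k IHk s sw le_k.
have sI : lo <= s h <= hi by rewrite (win_stable h sw) hE; lia.
have [shi|shi] := eqVneq (s h : nat) hi.
  apply: (subsetP (_ : gens adj (index_iota lo hi.-1) \subset _)).
    by apply: gensS => c; rewrite !mem_index_iota; lia.
  apply: IH; [lia|lia|].
  apply: perm_on_win_shrink; first by rewrite prednK //; lia.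
  move=> x xE; have -> : x = h by apply: val_inj; rewrite /= xE hE; lia.
  by apply: val_inj; rewrite /= shi hE.
have aG : adj (s h) \in gens adj (index_iota lo hi).
  by apply: mem_gens; rewrite mem_index_iota; lia.
rewrite -(groupMr _ aG); apply: IHk.
  by apply: perm_onM => //; apply: adj_win; lia.
by rewrite permM adj_val ?eqxx; lia.
Qed.

End SignedPerm.

Section Ladder.

Variables (m z : nat).
Local Notation C := 'I_m.+1.
Implicit Types (s t : {perm C}) (e : C -> bool) (g : {perm C * bool}).

(** Neighbouring columns are exchanged in both rows at once; only generator z also exchanges rows,
    in all columns that it does not otherwise move and that lie beyond it. For m <= z the rows
    remain unlinked. *)
Definition ladder c := signed (adj m c) (fun x => (c == z) && (z + 2 <= x)).

Local Notation G i j := (gens ladder (index_iota i j)).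

Lemma ladder_unflipped c : c != z -> ladder c = signed (adj m c) (fun=> false).
Proof. by move=> cz; apply: eq_signed => x; rewrite (negbTE cz). Qed.

Lemma ladderK c x : c < m -> ladder c (ladder c x) = x.
Proof.
move=> cm; case: x => x b; rewrite -permM signedM signedE adj_sqr perm1.
suff -> : (c == z) && (z + 2 <= x) (+) (c == z) && (z + 2 <= adj m c x) = false.
  by rewrite addbF.
case cz: (c == z); rewrite //= adj_val //.
by do ?[case: eqP]; lia.
Qed.

Lemma ladder_order c : c < m -> #[ladder c] = 2.
Proof.
move=> cm; apply: order_invol => [x|]; first exact: ladderK.
apply/eqP=> e; have := congr1 (fun g : {perm C * bool} => val (g (inord c, false)).1) e.
by rewrite /= signedE perm1 /= adj_val // inordK ?eqxx; lia.
Qed.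

Lemma ladder_comm i j : i + 2 <= j -> j < m -> (z <= 1) || (m <= z) ->
  commute (ladder i) (ladder j).
Proof.
move=> ij jm zm; rewrite /commute !signedM.
have st : adj m i * adj m j = adj m j * adj m i.
  by apply/permP=> x; apply: val_inj; rewrite /= !permM !adj_val //; try lia;
    do ?[case: eqP]; lia.
rewrite st; apply: eq_signed => x; rewrite !adj_val //; last lia.
case iz: (i == z); case jz: (j == z) => //=; rewrite ?addbF ?addFb; try lia;
  do ?[case: eqP]; lia.
Qed.

Lemma ladder_struct i j g : j <= m -> g \in G i j ->
  exists s e, g = signed s e /\ perm_on (win m i j) s.
Proof.
move=> jm; move: g; apply: gens_ind.
  by exists 1, (fun=> false); rewrite signed1; split=> //; apply: perm_on1.
move=> g c; rewrite mem_index_iota => cI [s [e [-> sw]]].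
rewrite signedM; eexists; eexists; split; first by [].
by apply: perm_onM => //; apply: adj_win; lia.
Qed.

Lemma ladder_plain i j g : j <= m -> (z < i) || (j <= z) -> g \in G i j ->
  exists2 s, g = signed s (fun=> false) & perm_on (win m i j) s.
Proof.
move=> jm zN; move: g; apply: gens_ind.
  by exists 1; rewrite ?signed1 //; apply: perm_on1.
move=> g c; rewrite mem_index_iota => cI [s -> sw].
rewrite ladder_unflipped; last by apply/eqP; lia.
rewrite signedM; exists (s * adj m c); first exact: eq_signed.
by apply: perm_onM => //; apply: adj_win; lia.
Qed.

Lemma plain_ladder i j s : j <= m -> (z < i) || (j <= z) -> perm_on (win m i j) s ->
  signed s (fun=> false) \in G i j.
Proof.
move=> jm zN /(adj_gens jm); move: s; apply: gens_ind; first by rewrite signed1.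
move=> s c cI sG.
have -> : signed (s * adj m c) (fun=> false) = signed s (fun=> false) * ladder c.
  rewrite ladder_unflipped ?signedM //; last by apply/eqP; rewrite mem_index_iota in cI; lia.
by rewrite groupM // mem_gens.
Qed.

(** The only row exchange that can occur comes from generator z as the last one of the interval, and
    it hits exactly the columns beyond j, all together. *)
Lemma ladder_unlinked j g : j <= m -> j <= z.+1 -> g \in G 0 j ->
  exists s b, g = signed s (fun x => b && (j < x)) /\ perm_on (win m 0 j) s.
Proof.
move=> jm jz; move: g; apply: gens_ind.
  by exists 1, false; rewrite signed1; split=> //; apply: perm_on1.
move=> g c; rewrite mem_index_iota => cI [s [b [-> sw]]].
rewrite signedM; exists (s * adj m c), (b (+) (c == z)); split; last first.
  by apply: perm_onM => //; apply: adj_win; lia.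
apply: eq_signed => x; have [jx|xj] := ltnP j x.
  rewrite (perm_on_win sw) ?jx ?orbT // !andbT.
  by case cz: (c == z); rewrite //=; lia.
have := win_stable x sw; rewrite xj /= => sx; rewrite !andbF addFb.
by case cz: (c == z) => //=; lia.
Qed.

(** On the columns from z on, this is the coboundary of the indicator of column z plus the constant
    [d]. Conjugation by the flip of column z thus turns the generators from z on into plain column
    exchanges, the one at z being multiplied by the flip of all these columns: the group is
    symmetric times order 2 once j >= z + 2. *)
Definition twist (d : bool) s (x : C) :=
  (z <= x) && (d (+) (x == z :> nat) (+) (s x == z :> nat)).

Lemma twistM lo hi d d' s t : z <= lo -> perm_on (win m lo hi) s ->
  (fun x => twist d s x (+) twist d' t (s x)) =1 twist (d (+) d') (s * t).
Proof.
move=> zlo sw x; rewrite /twist permM.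
have -> : (z <= s x) = (z <= x).
  have := win_stable x sw; have [xw|xw] := boolP (lo <= x <= hi); first by lia.
  by rewrite (perm_on_win sw) //; lia.
case: (z <= x) => //=; case: (x == z :> nat); case: (s x == z :> nat);
  by case: (t _ == z :> nat); case: d; case: d'.
Qed.

Lemma twist1 d : twist d 1 =1 (fun x => d && (z <= x)).
Proof. by move=> x; rewrite /twist perm1 -addbA addbb addbF andbC. Qed.

Lemma twist_adj c : c < m -> z <= c ->
  twist (c == z) (adj m c) =1 (fun x => (c == z) && (z + 2 <= x)).
Proof.
move=> cm zc x; rewrite /twist adj_val //.
by case cz: (c == z) => /=; do ?[case: eqP]; lia.
Qed.

Lemma ladder_twisted i j g : j <= m -> z <= i -> g \in G i j ->
  exists s d, g = signed s (twist d s) /\ perm_on (win m i j) s.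
Proof.
move=> jm zi; move: g; apply: gens_ind.
  exists 1, false; split; last exact: perm_on1.
  by rewrite -signed1; apply: eq_signed => x; rewrite twist1.
move=> g c; rewrite mem_index_iota => cI [s [d [-> sw]]].
exists (s * adj m c), (d (+) (c == z)); split; last first.
  by apply: perm_onM => //; apply: adj_win; lia.
rewrite signedM; apply: eq_signed => x; rewrite -(twistM _ _ _ zi sw).
by rewrite twist_adj //; lia.
Qed.

(** The column part of the product of generators z and z + 1 has order 3, so its cube consists of
    signs alone. *)
Lemma global_flip j : z + 2 <= j -> j <= m -> signed 1 (fun x => z <= x) \in G z j.
Proof.
move=> zj jm; pose g := ladder z * ladder z.+1.
have gG : g \in G z j by rewrite groupM // mem_gens // mem_index_iota; lia.
suff <- : g ^+ 3 = signed 1 (fun x => z <= x) by apply: groupX.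
rewrite !expgS expg0 mulg1 /g (@ladder_unflipped z.+1) ?gtn_eqF // !signedM.
have E (x : C) : adj m z.+1 (adj m z x) = (if x == z :> nat then z + 2 else
    if x == z.+1 :> nat then z else if x == z + 2 :> nat then z.+1 else x) :> nat.
  by rewrite !adj_val; try lia; do ?[case: eqP]; lia.
set u := adj m z * adj m z.+1.
have uE (x : C) : u x = (if x == z :> nat then z + 2 else
    if x == z.+1 :> nat then z else if x == z + 2 :> nat then z.+1 else x) :> nat.
  by rewrite permM E.
have -> : u * (u * u) = 1.
  by have := @adj_cube m z; rewrite !expgS expg0 mulg1; apply; lia.
clearbody u.
apply: eq_signed => x; rewrite eqxx !addbF /=; rewrite !uE.
by do ?[case: eqP]; lia.
Qed.

Lemma twisted_ladder j s d : z + 2 <= j -> j <= m -> perm_on (win m z j) s ->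
  signed s (twist d s) \in G z j.
Proof.
move=> zj jm sw; pose Z := signed 1 (fun x : C => z <= x).
have ZG : Z \in G z j by apply: global_flip.
have [_ tG] : perm_on (win m z j) s /\ signed s (twist false s) \in G z j.
  have := adj_gens jm sw; move: s {sw}; apply: gens_ind => [|s c cI [sw sG]].
    by split; [apply: perm_on1|rewrite (eq_signed _ (twist1 _)) signed1].
  move: (cI); rewrite mem_index_iota => cI'.
  have aw : perm_on (win m z j) (adj m c) by apply: adj_win; lia.
  split; first exact: perm_onM.
  have -> : signed (s * adj m c) (twist false (s * adj m c)) =
      signed s (twist false s) * signed (adj m c) (twist false (adj m c)).
    by rewrite signedM; apply: eq_signed => x; rewrite (twistM _ _ _ _ sw).
  rewrite groupM //; have cm : c < m by lia.
  have [cz|cz] := eqVneq c z; last first.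
    have e : twist false (adj m c) =1 (fun x => (c == z) && (z + 2 <= x)).
      by rewrite -{1}(negbTE cz); apply: twist_adj; lia.
    by rewrite (eq_signed _ e); apply: mem_gens.
  have -> : signed (adj m c) (twist false (adj m c)) = Z * ladder c.
    rewrite signedM mul1g; apply: eq_signed => x; rewrite perm1 -twist_adj ?cz //; last lia.
    by rewrite eqxx /twist; case: (z <= x) => //=; case: (x == z :> nat); case: (adj m z x == z :> nat).
  by rewrite groupM // mem_gens.
case: d => //; have -> : signed s (twist true s) = Z * signed s (twist false s).
  rewrite signedM mul1g; apply: eq_signed => x; rewrite perm1 /twist.
  by case: (z <= x) => //=; case: (x == z :> nat); case: (s x == z :> nat).
exact: groupM.
Qed.

Lemma ladder_fix_col i j g (x : C) b : j <= m -> g \in G i j -> (x < i) || (j < x) ->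
  (g (x, b)).1 = x.
Proof.
by move=> jm /(ladder_struct jm)[s [e [-> sw]]] xN; rewrite signedE (perm_on_win sw).
Qed.

(** Elements of the first group keep column j + 1 in place, which shrinks the window of the column
    permutation. Signs matter only if generator z occurs in the second interval without starting
    below it; as z is at most 1 there, this leaves z = 1 and i = 0. *)
Lemma ladder_itv i j : i < j -> j < m -> (z <= 1) || (m <= z) ->
  G i j :&: G i.+1 j.+1 \subset G i.+1 j.
Proof.
move=> ij jm zm; apply/subsetP=> g; rewrite inE => /andP[gl gr].
have col (x : C) : x = j.+1 :> nat -> (g (x, false)).1 = x.
  by move=> xE; apply: ladder_fix_col gl _; lia.
have [zA|zB] := boolP ((z < i.+1) || (j.+1 <= z)).
  have [s gE sw] := ladder_plain jm zA gr; rewrite gE; apply: plain_ladder; [lia|lia|].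
  apply: perm_on_win_shrink sw _ => x /col.
  by rewrite gE signedE.
have z1 : z = 1%N by lia.
have i0 : i = 0 by lia.
rewrite {}i0 in ij gl gr zB *.
have [s [d [gE sw0]]] := ladder_twisted jm (eq_leq z1) gr.
have sw : perm_on (win m 1 j) s.
  by apply: perm_on_win_shrink sw0 _ => x /col; rewrite gE signedE.
have [j3|j3] := leqP 3 j.
  rewrite gE; have := twisted_ladder d (_ : z + 2 <= j) (ltnW jm) (s := s).
  by rewrite z1; apply => //; lia.
have jz : j <= z.+1 by lia.
have [t [b [gE' tw]]] := ladder_unlinked (ltnW jm) jz gl.
have [st ef] := signed_inj (etrans (esym gE) gE').
pose c1 : C := inord 1%N; have c1E : c1 = 1%N :> nat by rewrite inordK; lia.
have := ef c1; rewrite /twist c1E z1 /= ltnNge (_ : 1 <= j) // andbF => e1.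
have [s1|s1] := eqVneq (s c1 : nat) 1%N.
  have d0 : d = false by move: e1; rewrite s1 /=; case: (d).
  have sE : s = 1.
    have j12 : (j == 1)%N || (j == 2)%N by lia.
    have [/eqP j1|j1] := boolP (j == 1)%N; first by apply: perm_on_win1 sw; rewrite j1.
    have j2 : j = 2 by lia.
    apply/permP=> x; rewrite perm1; have [xI|xI] := boolP (1 <= x <= j); last first.
      by apply: (perm_on_win sw); lia.
    have [x1|x1] := eqVneq (x : nat) 1%N.
      by have -> : x = c1 by [apply: val_inj; rewrite /= x1 c1E]; apply: val_inj; rewrite /= s1 c1E.
    have := win_stable x sw; rewrite xI => sI.
    have : s x != c1.
      have <- : s c1 = c1 by apply: val_inj; rewrite /= s1 c1E.
      by rewrite (inj_eq perm_inj) -val_eqE /= c1E.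
    by rewrite -val_eqE /= c1E => sx; apply: val_inj => /=; lia.
  have -> : g = 1 by rewrite gE sE d0 (eq_signed _ (twist1 _)) signed1.
  exact: group1.
have sc : 1 <= s c1 <= j by rewrite (win_stable c1 sw) c1E; lia.
have j2 : j = 2 by lia.
have d1 : d = true by move: e1; rewrite (negbTE s1); case: (d).
have sE : s = adj m 1.
  apply/permP=> x; apply: val_inj; rewrite /= adj_val; last lia.
  have [x1|x1] := eqVneq (x : nat) 1%N.
    by have -> : x = c1 by [apply: val_inj; rewrite /= x1 c1E]; lia.
  have [xI|xI] := boolP (1 <= x <= j); last first.
    rewrite (perm_on_win sw) //; last by lia.
    by case: eqP; lia.
  have := win_stable x sw; rewrite xI => sI.
  have : s x != s c1 by rewrite (inj_eq perm_inj) -val_eqE /= c1E.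
  by rewrite -val_eqE /= => sx; do ?[case: eqP]; lia.
have -> : g = ladder 1.
  rewrite gE sE d1; apply: eq_signed => x.
  have := @twist_adj 1 _ _ x; rewrite z1 eqxx /= => -> //; lia.
by apply: mem_gens; rewrite mem_index_iota j2.
Qed.

Lemma ladder_stringC : (z <= 1) || (m <= z) -> stringC ladder m.
Proof.
move=> zm; split=> [c cm|i j ij jm|i j ij jm].
- exact: ladder_order.
- exact: ladder_comm.
exact: ladder_itv.
Qed.

End Ladder.

Section Parity.

Variable m : nat.
Local Notation C := 'I_m.+1.
Implicit Types (s t : {perm C}) (e f : C -> bool).

Definition parity e := \big[addb/false]_x e x.

Lemma parityD e f : parity (fun x => e x (+) f x) = parity e (+) parity f.
Proof. exact: big_split. Qed.

Lemma parity_perm s e : parity (fun x => e (s x)) = parity e.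
Proof. by rewrite [RHS](reindex_inj (@perm_inj _ s)). Qed.

Lemma eq_parity e f : e =1 f -> parity e = parity f.
Proof. by move=> ef; apply: eq_bigr. Qed.

Lemma parity0 : parity (fun=> false) = false.
Proof. exact: big1_eq. Qed.

Lemma parity_card e : parity e = odd #|[set x | e x]|.
Proof.
rewrite /parity -sum1_card (big_morph odd oddD (erefl _)) [RHS]big_mkcond.
by apply: eq_bigr => x _; rewrite inE; case: (e x).
Qed.

Lemma card_ge k : #|[set x : C | k <= x]| = m.+1 - k.
Proof.
rewrite -sum1_card (eq_bigl (fun x : C => k <= x)) => [|x]; last by rewrite inE.
elim: m.+1 => [|n IH]; first by rewrite big_ord0.
rewrite big_mkcond big_ord_recr -big_mkcond /= IH; case: leqP; lia.
Qed.

End Parity.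

Ltac split_ifs := repeat match goal with |- context [if ?b then _ else _] =>
  lazymatch b with context [if _ then _ else _] => fail
  | _ => let h := fresh in case h : b end end.

Section LadderArm.

Variables (m z : nat).
Local Notation C := 'I_m.+1.
Local Notation lad := (ladder m z).
Local Notation G i j := (gens lad (index_iota i j)).
Implicit Types (s t : {perm C}) (e f : C -> bool) (g : {perm C * bool}).
Let v0 : C * bool := (ord0, false).

Lemma ladder_even c : c < m -> (m <= z) || odd (m - z) -> odd_perm (lad c) = false.
Proof.
move=> cm zm; rewrite odd_invol => [|x]; last exact: ladderK.
pose S := if c == z then [set x : C | z <= x] else [set inord c; inord c.+1].
have -> : #|[set x | lad c x != x]| = (#|S| * 2)%N.
  have -> : (#|S| * 2)%N = #|setX S [set: bool]| by rewrite cardsX cardsT card_bool.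
  apply: eq_card => -[x b]; rewrite !inE andbT /= signedE xpair_eqE negb_and.
  have -> : forall p q : bool, (p (+) q != p) = q by case=> -[].
  rewrite -val_eqE /= adj_val //.
  rewrite /S; case: (eqVneq c z) => [cz|cz] /=; rewrite !inE -?val_eqE /= ?inordK; try lia.
    by do ?[case: eqP]; lia.
  by do ?[case: eqP]; lia.
rewrite muln2 doubleK /S; case: (eqVneq c z) => cz.
  by rewrite card_ge; lia.
by rewrite cards2 -val_eqE /= !inordK; [case: eqP => /=; lia|lia|lia].
Qed.

(** When m - z is odd, generator z flips m - 1 - z columns, an even number. *)
Lemma ladder_parity i j g : j <= m -> (m <= z) || odd (m - z) -> g \in G i j ->
  exists s e, [/\ g = signed s e, perm_on (win m i j) s & parity e = false].
Proof.
move=> jm zm; move: g; apply: gens_ind.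
  by exists 1, (fun=> false); rewrite signed1 parity0; split=> //; apply: perm_on1.
move=> g c; rewrite mem_index_iota => cI [s [e [-> sw pe]]].
rewrite signedM; eexists; eexists; split; first by [].
  by apply: perm_onM => //; apply: adj_win; lia.
rewrite parityD pe (parity_perm s (fun x => (c == z) && (z + 2 <= x))) addFb.
case cz: (c == z) => /=; last exact: parity0.
by rewrite parity_card card_ge; lia.
Qed.

Section Shifted.

(* For z = 1 the flips of all even sets of columns are realised. *)
Hypotheses (z1 : z = 1%N).
Variable j : nat.
Hypotheses (j3 : 3 <= j) (jm : j <= m).

Let flip2 (c : nat) (x : C) := (x == c :> nat) || (x == c.+1 :> nat).

Let conj_flip c b s e : signed s e \in G 0 j -> signed 1 (flip2 c) \in G 0 j ->
  (forall x, flip2 b x = flip2 c (s^-1 x)) -> signed 1 (flip2 b) \in G 0 j.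
Proof.
move=> sG cG bc; have -> : signed 1 (flip2 b) = signed 1 (flip2 c) ^ signed s e.
  apply/permP=> -[x d]; have [y ->] : exists y, x = s y by exists (s^-1 x); rewrite permKV.
  have -> : (s y, d) = signed s e (y, d (+) e y) by rewrite signedE -addbA addbb addbF.
  rewrite permJ !signedE !perm1 bc permK; congr (_, _).
  by case: d; case: (e y); case: (flip2 c y).
exact: groupJ.
Qed.

Let ladderG c : c < j -> lad c \in G 0 j.
Proof. by move=> cj; apply: mem_gens; rewrite mem_index_iota. Qed.

Let ZG : signed 1 (fun x : C => z <= x) \in G 0 j.
Proof.
apply: (subsetP (_ : G z j \subset G 0 j)).
  by apply: gensS => c; rewrite !mem_index_iota; lia.
by apply: global_flip => //; lia.
Qed.

(** The flip of the columns from 1 on, times its conjugate under the exchange of columns 0 and 1, is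
    the flip of these two columns. Conjugation by [lad c.+1 * lad c] then shifts the pair by one. *)
Let flip_adj c : c < j -> signed 1 (flip2 c) \in G 0 j.
Proof.
elim: c => [|c IH] cj.
  have -> : signed 1 (flip2 0) = signed 1 (fun x : C => z <= x) ^ lad 0 *
      signed 1 (fun x : C => z <= x).
    have l0 : (lad 0)^-1 = lad 0.
      have o2 : #[lad 0] = 2 by apply: ladder_order; lia.
      by apply: (mulIg (lad 0)); rewrite mulVg -[RHS]/(lad 0 ^+ 2) -o2 expg_order.
    rewrite conjgE l0 (@ladder_unflipped m z 0) ?z1 // !signedM !mulg1 mul1g adj_sqr.
    apply: eq_signed => x; rewrite /flip2 !addbF /= perm1 !adj_val; try lia.
    by do ?[case: eqP]; lia.
  by rewrite groupM // groupJ // ladderG //; lia.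
have := groupM (ladderG cj) (ladderG (ltnW cj)); rewrite signedM => lG.
apply: (conj_flip lG) => [|x]; first by apply: IH; lia.
rewrite invMg permM /adj !tpermV -/(adj m c.+1) -/(adj m c) /flip2 !adj_val; try lia.
by split_ifs; lia.
Qed.

Let parity_flip2 c : c < m -> parity (flip2 c) = false.
Proof.
move=> cm; rewrite parity_card.
have -> : [set x | flip2 c x] = [set inord c; inord c.+1].
  by apply/setP=> x; rewrite !inE /flip2 -!val_eqE /= !inordK //; lia.
by rewrite cards2 -val_eqE /= !inordK; [case: eqP => /=; lia|lia|lia].
Qed.

Let even_flips e : (forall x : C, j < x -> e x = false) -> parity e = false ->
  signed 1 e \in G 0 j.
Proof.
suff main (k : nat) : k <= j -> forall e, (forall x : C, k < x -> e x = false) -> parity e = false ->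
    signed 1 e \in G 0 j by move=> ej pe; exact: (main j (leqnn j) e ej pe).
elim: k => [|t IH] tj {}e et pe.
  have e0 : e ord0 = false.
    move: pe; rewrite /parity (bigD1 ord0) //= big1 ?addbF // => x x0.
    by apply: et; rewrite lt0n.
  rewrite (eq_signed 1 (_ : e =1 fun=> false)) ?signed1 ?group1 // => x.
  have [->//|x0] := eqVneq x ord0; by apply: et; rewrite lt0n.
pose c1 : C := inord t.+1; have c1E : c1 = t.+1 :> nat by rewrite inordK; lia.
have [ec|ec] := boolP (e c1); last first.
  apply: IH => //; first lia.
  move=> x tx; have [xt|xt] := eqVneq (x : nat) t.+1; last by apply: et; lia.
  by have -> : x = c1 by [apply: val_inj; rewrite /= xt c1E]; apply: negbTE.
have tj' : t < j by lia.
rewrite -(groupMr _ (flip_adj tj')) signedM mul1g; apply: IH; first lia.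
  move=> x tx; rewrite perm1 /flip2; have [xt|xt] := eqVneq (x : nat) t.+1.
    have -> : x = c1 by apply: val_inj; rewrite /= xt c1E.
    by rewrite ec orbT.
  by rewrite et; [case: eqP; lia|lia].
rewrite parityD pe addFb -[RHS](@parity_flip2 t) //; last lia.
by apply: eq_parity => x; rewrite perm1.
Qed.

Lemma even_signed s e : perm_on (win m 0 j) s -> (forall x : C, j < x -> e x = false) ->
  parity e = false -> signed s e \in G 0 j.
Proof.
move=> sw ej pe.
have [_ [f [fj pf sG]]] : perm_on (win m 0 j) s /\ exists f,
    [/\ forall x : C, j < x -> f x = false, parity f = false & signed s f \in G 0 j].
  have := adj_gens jm sw; move: s {sw}; apply: gens_ind.
    by split; [apply: perm_on1|exists (fun=> false); rewrite parity0 signed1 group1].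
  move=> s c; rewrite mem_index_iota => cI [sw [f [fj pf sG]]].
  split; first by apply: perm_onM => //; apply: adj_win; lia.
  pose h (x : C) := (c == z) && flip2 z x.
  have ph : parity h = false.
    rewrite /h; case: (c == z) => /=; last exact: parity0.
    by apply: parity_flip2; lia.
  have hj (x : C) : j < x -> h x = false.
    by rewrite /h /flip2 => jx; case: eqP => //= _; lia.
  have hG : signed (adj m c) h \in G 0 j.
    have [cz|cz] := eqVneq c z; last first.
      rewrite (eq_signed _ (_ : h =1 fun x => (c == z) && (z + 2 <= x))).
        exact: ladderG.
      by move=> x; rewrite /h (negbTE cz).
    have -> : signed (adj m c) h = signed 1 (fun x : C => z <= x) * lad c.
      rewrite signedM mul1g; apply: eq_signed => x.
      by rewrite /h /flip2 perm1 cz eqxx /=; lia.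
    by rewrite groupM // ladderG.
  exists (fun x => f x (+) h (s x)); split.
  - move=> x jx; rewrite fj // addFb hj //.
    by rewrite (perm_on_win sw) ?jx ?orbT.
  - by rewrite parityD pf (parity_perm s h) ph.
  by rewrite -signedM groupM.
have -> : signed s e = signed 1 (fun x => e x (+) f x) * signed s f.
  rewrite signedM mul1g; apply: eq_signed => x; rewrite perm1.
  by rewrite -addbA addbb addbF.
rewrite groupM // even_flips // => [x jx|]; first by rewrite ej // fj.
by rewrite parityD pe pf.
Qed.

End Shifted.

(** For j <= z.+1 the orbit of [v0] stays in its row, so [g] fixes the other row pointwise and is
    trivial. For larger j, [g] fixes every column beyond j, and the explicit description of the
    group applies: twists for z = 0, all even sign vectors for z = 1. *)
Lemma ladder_star j g : j < m -> (m <= z) || [&& z <= 1, z + 3 <= m & odd (m - z)] ->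
  g \in G 0 j.+1 ->
  (forall x, x \notin [set (h : {perm C * bool}) v0 | h in G 0 j] -> g x = x) ->
  g \in G 0 j.
Proof.
move=> jm zm gG gx.
have [jz|zj] := leqP j z.+1.
  have fixt (x : C) : g (x, true) = (x, true).
    apply: gx; apply/imsetP=> -[h hG].
    have [s [b [-> _]]] := ladder_unlinked (ltnW jm) jz hG.
    by rewrite signedE andbF => -[].
  have [s [e [gE _]]] := ladder_struct jm gG.
  suff -> : g = 1 by apply: group1.
  rewrite gE -signed1; have -> : s = 1.
    by apply/permP=> x; have := fixt x; rewrite gE signedE perm1 => -[].
  by apply: eq_signed => x; have := fixt x; rewrite gE signedE => -[_]; case: (e x).
have {}zm : [&& z <= 1, z + 3 <= m & odd (m - z)] by lia.
have fixc (x : C) b : j < x -> g (x, b) = (x, b).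
  move=> jx; apply: gx; apply/imsetP=> -[h hG].
  have [s [e [-> sw]]] := ladder_struct (ltnW jm) hG.
  rewrite signedE => -[xs _]; have := win_stable (ord0 : C) sw.
  by rewrite -xs /=; lia.
have shrink s e : g = signed s e -> perm_on (win m 0 j.+1) s -> perm_on (win m 0 j) s.
  move=> gE sw; apply: perm_on_win_shrink sw _ => x xE.
  by have := fixc x false; rewrite gE signedE xE => /(_ (ltnSn j))[].
have [z0|z0] := eqVneq z 0.
  have [s [d [gE sw0]]] := ladder_twisted jm (eq_leq z0) gG.
  have sw := shrink _ _ gE sw0.
  have sw' : perm_on (win m z j) s by rewrite z0.
  apply: (subsetP (_ : G z j \subset G 0 j)); first by rewrite z0.
  by rewrite gE; apply: twisted_ladder => //; [lia|exact: ltnW].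
have z1 : z = 1%N by lia.
have zm' : (m <= z) || odd (m - z) by lia.
have [s [e [gE sw0 pe]]] := ladder_parity jm zm' gG.
have sw := shrink _ _ gE sw0.
rewrite gE; apply: even_signed => //; [lia|exact: ltnW|].
by move=> x /(fixc x false); rewrite gE signedE => -[_].
Qed.

Lemma ladder_arm : 0 < m ->
  (m <= z) || [&& z <= 1, z + 3 <= m & odd (m - z)] -> arm m lad v0.
Proof.
move=> m0 zm; split=> //.
- by rewrite signedE xpair_eqE -val_eqE /= adj_val.
- move=> c c0 cm; rewrite signedE addn2 andbF; congr (_, _); apply: val_inj.
  by rewrite /= adj_val //=; split_ifs; lia.
- by move=> c cm; apply: ladder_even => //; lia.
- by apply: ladder_stringC; lia.
by move=> j _ jm g gG; apply: ladder_star.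
Qed.

(** Climb in the row of [v0] to column z + 2, where generator z changes the row without moving the
    column, and walk back. *)
Lemma ladder_transitive : z + 3 <= m -> arm_transitive m lad v0.
Proof.
move=> zm.
have step c x b : c < m -> (exists2 h : {perm C * bool}, h \in G 0 m & (x, b) = h v0) ->
    exists2 h : {perm C * bool}, h \in G 0 m & lad c (x, b) = h v0.
  move=> cm [h hG ->]; exists (h * lad c); last by rewrite permM.
  by rewrite groupM // mem_gens // mem_index_iota.
have up b : (exists2 h : {perm C * bool}, h \in G 0 m & ((ord0 : C), b) = h v0) ->
    forall k (x : C), x = k :> nat ->
      exists2 h : {perm C * bool}, h \in G 0 m & (x, b) = h v0.
  move=> h0; elim=> [|k IH] x xk.
    by have -> : x = ord0 by apply: val_inj.
  have km : k < m by have := ltn_ord x; lia.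
  have kE : (inord k : C) = k :> nat by rewrite inordK; lia.
  have := step k (inord k) b km (IH _ kE); rewrite signedE kE.
  have -> : (k == z) && (z + 2 <= k) = false by case: eqP => //; lia.
  rewrite addbF; have -> // : adj m k (inord k) = x.
  by apply: val_inj; rewrite /= adj_val // kE eqxx xk.
have down k : forall x : C, x = k :> nat ->
    (exists2 h : {perm C * bool}, h \in G 0 m & (x, true) = h v0) ->
    exists2 h : {perm C * bool}, h \in G 0 m & ((ord0 : C), true) = h v0.
  elim: k => [|k IH] x xk hx.
    by have <- : x = ord0 by apply: val_inj.
  have km : k < m by have := ltn_ord x; lia.
  have kE : (inord k : C) = k :> nat by rewrite inordK; lia.
  apply: (IH _ kE); have := step k x true km hx; rewrite signedE xk.
  have -> : (k == z) && (z + 2 <= k.+1) = false by case: eqP => //; lia.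
  rewrite addbF; have -> // : adj m k x = inord k.
  by apply: val_inj; rewrite /= adj_val // xk kE eqxx gtn_eqF.
have h0 : exists2 h : {perm C * bool}, h \in G 0 m & ((ord0 : C), false) = h v0.
  by exists 1; rewrite ?group1 ?perm1.
have zE : (inord (z + 2) : C) = z + 2 :> nat by rewrite inordK; lia.
have h1 : exists2 h : {perm C * bool}, h \in G 0 m & ((ord0 : C), true) = h v0.
  apply: (down (z + 2) _ zE); have zm' : z < m by lia.
  have := step z (inord (z + 2)) false zm' (up _ h0 _ _ zE); rewrite signedE eqxx zE leqnn.
  have -> // : adj m z (inord (z + 2)) = inord (z + 2).
  by apply: val_inj; rewrite /= adj_val // zE; split_ifs; lia.
by move=> [x []]; [apply: up h1 _ _ (erefl _)|apply: up h0 _ _ (erefl _)].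
Qed.

Lemma ladder_odd c : z < c -> c.+1 < m -> odd #[lad c * lad c.+1].
Proof.
move=> zc cm; have : #[lad c * lad c.+1] %| 3.
  rewrite order_dvdn !ladder_unflipped ?gtn_eqF //; last exact: ltnW.
  rewrite !expgS expg0 mulg1 !signedM; apply/eqP; rewrite -signed1.
  have := adj_cube cm; rewrite !expgS expg0 mulg1 => ->.
  exact: eq_signed.
by move/dvdn_odd; apply.
Qed.

Lemma ladder_nc c : c.+1 < m -> ~ commute (lad c) (lad c.+1).
Proof.
move=> cm; rewrite /commute /ladder !signedM => /signed_inj[e _].
have := congr1 (fun s : {perm C} => val (s (inord c))) e; rewrite /= !permM.
by rewrite !adj_val ?inordK; try lia; split_ifs; lia.
Qed.

End LadderArm.

(** * The families on 2 r + 1 and 2 r + 4 points *)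

Section Attached.

Variables (m : nat) (K : finType).
Local Notation C := 'I_m.+1.
Local Notation X := ((C * bool) + K)%type.
Implicit Types (s t : {perm C}) (g : {perm X}) (rho : nat -> {perm X}).

Lemma inl_inj : injective (inl : C * bool -> X). Proof. by move=> x y []. Qed.

Definition slide s : {perm X} := emb inl_inj (signed s (fun=> false)).

Lemma slideE s x b : slide s (inl (x, b)) = inl (s x, b).
Proof. by rewrite /slide embE signedE addbF. Qed.

Lemma slide_r s k : slide s (inr k) = inr k.
Proof. by rewrite /slide emb_out //; apply/codomP=> -[]. Qed.

Lemma slideM s t : slide (s * t) = slide s * slide t.
Proof. by rewrite /slide -embM signedM; congr emb; apply: eq_signed. Qed.

Lemma slide1 : slide 1 = 1. Proof. by rewrite /slide signed1 emb1. Qed.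

(** Plain column exchanges are ladder generators with z = m, where no index below m is linked. *)
Lemma slide_order c : c < m -> #[slide (adj m c)] = 2.
Proof. by move=> cm; rewrite order_emb -(@ladder_unflipped m m) ?ladder_order // ltn_eqF. Qed.

Lemma slide_even c : c < m -> odd_perm (slide (adj m c)) = false.
Proof.
move=> cm; rewrite odd_emb -(@ladder_unflipped m m) ?ladder_even ?leqnn //.
by rewrite ltn_eqF.
Qed.

Lemma slide_comm i j : i + 2 <= j -> j < m -> commute (slide (adj m i)) (slide (adj m j)).
Proof.
move=> ij jm; rewrite /commute -!slideM; congr slide.
by apply/permP=> x; apply: val_inj; rewrite /= !permM !adj_val //; try lia; split_ifs; lia.
Qed.

Lemma slide_tperm x y :
  slide (tperm x y) = tperm (inl (x, false)) (inl (y, false)) *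
                      tperm (inl (x, true)) (inl (y, true)).
Proof.
have neq (u v : C) b : u <> v -> (inl (u, b) : X) != inl (v, b).
  by move=> uv; apply/eqP=> -[].
have neqb (u v : C) b : (inl (u, b) : X) != inl (v, ~~ b) by apply/eqP; case: b => -[].
apply/permP=> -[[w b]|k]; last by rewrite slide_r permM !tpermD.
rewrite slideE permM; case: tpermP => [->|->|/nesym xw /nesym yw]; case: b.
- by rewrite [tperm (inl (_, false)) _ _]tpermD ?(neqb _ _ false) // tpermL.
- by rewrite tpermL tpermD ?(neqb _ _ true).
- by rewrite [tperm (inl (_, false)) _ _]tpermD ?(neqb _ _ false) // tpermR.
- by rewrite tpermR tpermD ?(neqb _ _ true).
- by rewrite [tperm (inl (_, false)) _ _]tpermD ?(neqb _ _ false) // tpermD ?neq.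
by rewrite [tperm (inl (_, false)) _ _]tpermD ?neq // tpermD ?(neqb _ _ true).
Qed.

Lemma slide_odd c : c.+1 < m -> odd #[slide (adj m c) * slide (adj m c.+1)].
Proof.
move=> cm; have : #[slide (adj m c) * slide (adj m c.+1)] %| 3.
  rewrite order_dvdn -slideM !expgS expg0 mulg1 -!slideM.
  by rewrite (_ : _ * _ = 1) ?slide1 //; have := adj_cube cm; rewrite !expgS expg0 mulg1.
by move/dvdn_odd; apply.
Qed.

Lemma gens_slide rho k i j g : k <= i -> j <= m + k ->
  (forall c, i <= c -> c < j -> rho c = slide (adj m (c - k))) ->
  g \in gens rho (index_iota i j) ->
  exists2 s, g = slide s & perm_on (win m (i - k) (j - k)) s.
Proof.
move=> ki jm rE; move: g; apply: gens_ind; first by exists 1; rewrite ?slide1 ?perm_on1.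
move=> g c; rewrite mem_index_iota => cI [s -> sw].
exists (s * adj m (c - k)); first by rewrite slideM rE //; lia.
by apply: perm_onM => //; apply: adj_win; lia.
Qed.

Lemma slide_gens rho k i j s : k <= i -> j <= m + k ->
  (forall c, i <= c -> c < j -> rho c = slide (adj m (c - k))) ->
  perm_on (win m (i - k) (j - k)) s -> slide s \in gens rho (index_iota i j).
Proof.
move=> ki jm rE sw; have jm' : j - k <= m by lia.
have := adj_gens jm' sw; move: s {sw}; apply: gens_ind; first by rewrite slide1.
move=> s c; rewrite mem_index_iota slideM => cI sG; rewrite groupM //.
have -> : adj m c = adj m (c + k - k) by rewrite addnK.
by rewrite -rE ?mem_gens ?mem_index_iota; try lia.
Qed.

End Attached.

Section Tripod.

Variable m : nat.
Local Notation C := 'I_m.+1.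
Local Notation X := ((C * bool) + option bool)%type.
Implicit Types (s t : {perm C}) (g : {perm X}).

(** A ladder whose row [false] is prolonged at column 0 by the path [None], [Some false],
    [Some true]. Generator 0 carries the rungs and the middle edge of this extension, generator 1
    its two other edges. Only [Some true] is fixed by generator 0, a product of m + 2
    transpositions. *)
Definition tripod0 (x : X) : X := match x with
  | inl (a, b) => inl (a, ~~ b)
  | inr None => inr (Some false) | inr (Some false) => inr None
  | inr (Some true) => inr (Some true) end.

Definition tripod1 (x : X) : X := match x with
  | inl (a, b) => if (a == ord0) && ~~ b then inr None else inl (a, b)
  | inr None => inl (ord0, false) | inr (Some b) => inr (Some (~~ b)) end.

Lemma tripod0K : involutive tripod0. Proof. by move=> [[a b]|[[]|]] //=; rewrite negbK. Qed.

Lemma tripod1K : involutive tripod1.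
Proof.
move=> [[a b]|[[]|]] //=; case e: ((a == ord0) && ~~ b) => /=; last by rewrite e.
by case/andP: e => /eqP -> /negbTE ->.
Qed.

Definition tripod c : {perm X} := match c with
  | 0 => invol_perm tripod0K | 1 => invol_perm tripod1K
  | c.+2 => slide (option bool) (adj m c) end.

Local Notation G i j := (gens tripod (index_iota i j)).

Lemma tripod_slide c : 2 <= c -> tripod c = slide (option bool) (adj m (c - 2)).
Proof. by case: c => [|[|c]] // _; rewrite /= subn2. Qed.

Lemma tripod0E x : tripod 0 x = tripod0 x. Proof. exact: permE. Qed.

Lemma tripod1E x : tripod 1%N x = tripod1 x. Proof. exact: permE. Qed.

Hypotheses (m0 : 0 < m) (me : ~~ odd m).

Lemma tripod_order c : c < m.+2 -> #[tripod c] = 2.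
Proof.
case: c => [|[|c]] cm /=; last by rewrite slide_order.
  apply: order_invol => [x|]; first by rewrite !permE tripod0K.
  by apply/eqP=> /permP/(_ (inr None)); rewrite !permE.
apply: order_invol => [x|]; first by rewrite !permE tripod1K.
by apply/eqP=> /permP/(_ (inr None)); rewrite !permE.
Qed.

Lemma tripod1_tperm : tripod 1%N = tperm (inl (ord0, false)) (inr None) *
  tperm (inr (Some false)) (inr (Some true)).
Proof.
apply/permP=> -[[a b]|[[]|]]; rewrite tripod1E permM /=.
- case: ifP => e; first by case/andP: e => /eqP -> /negbTE ->; rewrite tpermL tpermD.
  have ne : (inl (ord0, false) : X) != inl (a, b).
    by apply: contraFneq e => -[<- <-]; rewrite eqxx.
  by rewrite !tpermD.
- by rewrite [tperm (inl _) _ _]tpermD // tpermR.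
- by rewrite [tperm (inl _) _ _]tpermD // tpermL.
by rewrite tpermR tpermD.
Qed.

Lemma tripod_even c : c < m.+2 -> odd_perm (tripod c) = false.
Proof.
case: c => [|[|c]] cm /=; last by rewrite slide_even.
  rewrite odd_invol => [|x]; last by rewrite !permE tripod0K.
  have -> : #|[set x | invol_perm tripod0K x != x]| = #|[set~ (inr (Some true) : X)]|.
    apply: eq_card => -[[a b]|[[]|]]; rewrite !inE permE //=.
    by rewrite -[inl _ == inl _]/((a, ~~ b) == (a, b)) xpair_eqE eqxx /=; case: b.
  by rewrite cardsC1 card_sum card_prod card_ord card_bool card_option card_bool; lia.
by rewrite -/(tripod 1%N) tripod1_tperm odd_permM !odd_tperm.
Qed.

Lemma tripod_comm i j : i + 2 <= j -> j < m.+2 -> commute (tripod i) (tripod j).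
Proof.
move=> ij jm; have [i2|] := leqP 2 i.
  by rewrite !tripod_slide; [apply: slide_comm| |]; lia.
rewrite (@tripod_slide j); last lia.
case: i ij => [|[|//]] ij _; apply/permP=> -[[a b]|k]; rewrite !permM.
- by rewrite tripod0E !slideE tripod0E.
- by case: k => [[]|]; rewrite tripod0E !slide_r !tripod0E.
- have a0 (x : C) : (adj m (j - 2) x == ord0) = (x == ord0).
    by rewrite -!val_eqE /= adj_val; [split_ifs; lia|lia].
  rewrite slideE !tripod1E /= a0; case: ifP => _; last by rewrite slideE.
  by rewrite slide_r.
case: k => [[]|]; rewrite slide_r !tripod1E /= ?slide_r // slideE; congr (inl (_, _)).
have o0 : (ord0 : C) = 0 :> nat by [].
by apply: val_inj; rewrite /= adj_val ?o0; [split_ifs; lia|lia].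
Qed.

Lemma tripod_col0 j g (x : C) b : 2 <= j -> j <= m.+2 -> g \in G 0 j -> j <= x.+1 ->
  exists b', g (inl (x, b)) = inl (x, b').
Proof.
move=> j2 jm gG jx; move: g gG; apply: gens_ind; first by exists b; rewrite perm1.
move=> g c; rewrite mem_index_iota => cI [b' gE]; rewrite permM gE.
case: c cI => [|[|c]] cI /=; try (by rewrite !permE /=; eexists).
  exists b'; rewrite permE /=; case: ifP => // /andP[/eqP x0 _].
  by move: jx; rewrite x0 /=; lia.
exists b'; rewrite slideE; congr (inl (_, _)); apply: val_inj; rewrite /= adj_val; last lia.
by split_ifs; lia.
Qed.

(** Without generator 0, row [true] and the pair of points [Some b] are invariant. The remaining
    points, [None] and row [false], are those on which [tripod_alt] finds an alternating group. *)
Lemma tripod_top j g : 0 < j -> j < m.+2 -> g \in G 1 j.+1 ->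
  exists s d, [/\ perm_on (win m 0 j.-1) s, forall x, g (inl (x, true)) = inl (s x, true)
    & forall b, g (inr (Some b)) = inr (Some (b (+) d))].
Proof.
move=> j0 jm; move: g; apply: gens_ind.
  by exists 1, false; split=> *; rewrite ?perm_on1 ?perm1 ?addbF.
move=> g c; rewrite mem_index_iota => cI [s [d [sw gt gd]]].
case: c cI => [|[|c]] cI //=.
  exists s, (~~ d); split=> // [x|b]; rewrite permM ?gt ?gd permE /= ?andbF //.
  by rewrite addbN.
exists (s * adj m c), d; split=> [|x|b].
- by apply: perm_onM => //; apply: adj_win; lia.
- by rewrite !permM gt slideE.
by rewrite permM gd slide_r.
Qed.

Definition foot k : {set X} := [set y : X | match y with
  | inl (x, b) => (x <= k) && ~~ b | inr o => o == None end].

(** Generator 2 fixes both points [Some b], so their transposition cancels between generator 1 and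
    its conjugate; two transpositions with a common point remain. *)
Lemma tripod_cyc3 j : 3 <= j ->
  cyc3 (inr None) (inl (ord0, false)) (inl (inord 1%N, false)) \in G 1 j.
Proof.
move=> j3; have mG c : 0 < c -> c < j -> tripod c \in G 1 j.
  by move=> c0 cj; rewrite mem_gens // mem_index_iota c0.
have -> : cyc3 (inr None) (inl (ord0, false)) (inl (inord 1%N, false)) =
    tripod 1%N * (tripod 1%N) ^ (tripod 2).
  have a0 : adj m 0 (ord0 : C) = inord 1%N.
    by apply: val_inj; rewrite /= adj_val // inordK.
  rewrite tripod1_tperm conjMg !tpermJ /= slideE !slide_r a0 /cyc3 (tpermC (inr None)).
  rewrite (tpermC (inl (inord _, _))) -!mulgA; congr (_ * _).
  set B := tperm (inr (Some false)) _; set A := tperm (inr None) _.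
  have AB : A ^ B = A by rewrite tpermJ !tpermD.
  by rewrite -{1}AB conjgE tpermV.
by rewrite groupM ?groupJ ?mG //; lia.
Qed.

Lemma tripod_alt j : 2 <= j -> j <= m.+2 -> alt_on (G 1 j) (foot (j - 2)).
Proof.
move=> j2 jm; have [k jE] : exists k, j = k + 2 by exists (j - 2); lia.
have -> : j - 2 = k by lia.
have km : k <= m by lia.
rewrite jE {jE j j2 jm}; elim: k km => [|k IH] km.
  apply/alt_onP=> x y z; suff inS w : w \in foot 0 -> w = inr None \/ w = inl (ord0, false).
    by move=> /inS[] -> /inS[] -> /inS[] ->; rewrite /= ?inE ?eqxx ?orbT ?andbF.
  rewrite inE; case: w => [[a b]|o]; last by move/eqP->; left.
  by rewrite leqn0 => /andP[/eqP a0 /negbTE ->]; right; congr (inl (_, _)); apply: val_inj.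
have kE : (inord k : C) = k :> nat by rewrite inordK; lia.
have kE' : (inord k.+1 : C) = k.+1 :> nat by rewrite inordK; lia.
have -> : foot k.+1 = inl (inord k.+1, false) |: foot k.
  apply/setP=> -[[x b]|o]; rewrite !inE //.
  by rewrite -[inl _ == inl _]/((x, b) == (inord k.+1, false)) xpair_eqE -val_eqE /= kE'; lia.
have slG c : c <= k -> slide (option bool) (adj m c) \in G 1 (k.+1 + 2).
  by move=> ck; apply: (@mem_gens _ tripod _ c.+2); rewrite mem_index_iota; lia.
have ss : alt_on (G 1 (k.+1 + 2)) (foot k).
  have /alt_onP h := IH (ltnW km); apply/alt_onP=> x y z xS yS zS u.
  apply: (subsetP (_ : G 1 (k + 2) \subset _)); last exact: h.
  by apply: gensS => c; rewrite !mem_index_iota; lia.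
have top : inl (inord k.+1, false) \notin foot k by rewrite inE kE' ltnn.
have [k0|k0] := posnP k.
  have /tripod_cyc3 c0 : 3 <= k.+1 + 2 by lia.
  apply: (@alt_on_grow _ _ _ _ (inr None) (inl (ord0, false))) => //; try by rewrite inE.
  rewrite cyc3_rot; first by rewrite k0 in c0 *.
  by rewrite /= !inE -[inl _ == inl _]/((_, _) == (_, _)) xpair_eqE -val_eqE /= kE'.
have k0' : adj m k (ord0 : C) = ord0.
  by apply: val_inj; rewrite /= adj_val // /= ltn_eqF.
apply: (@alt_on_grow _ _ _ _ (inr None) (inl (ord0, false))) => //; try by rewrite inE.
have -> : cyc3 (inl (inord k.+1, false)) (inr None) (inl (ord0, false)) =
    cyc3 (inl (inord k, false)) (inr None) (inl (ord0, false)) ^ slide (option bool) (adj m k).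
  rewrite cyc3J !slideE slide_r k0'; congr (cyc3 (inl (_, _))).
  by apply: val_inj; rewrite /= adj_val // kE eqxx kE'.
rewrite groupJ ?slG //; move/alt_onP: ss; apply; rewrite ?inE ?kE ?leqnn //.
by rewrite /= !inE -[inl _ == inl _]/((_, _) == (_, _)) xpair_eqE -val_eqE /= kE gtn_eqF.
Qed.

(** For i > 0 the second interval consists of slides and a window shrinks. For i = 0, [g] is divided
    by an element of [G 1 j] with the same action on row [true] and on the points [Some b]; the
    quotient is even and supported on a foot, so [tripod_alt] applies. *)
Lemma tripod_itv i j : i < j -> j < m.+2 ->
  G i j :&: G i.+1 j.+1 \subset G i.+1 j.
Proof.
move=> ij jm; apply/subsetP=> g; rewrite inE => /andP[gl gr].
have gl0 : g \in G 0 j by apply: subsetP gl; apply: gensS => c; rewrite !mem_index_iota; plia.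
have [i0|i0] := posnP i; last first.
  have [s gE sw] : exists2 s, g = slide (option bool) s & perm_on (win m (i.+1 - 2) (j.+1 - 2)) s.
    by apply: gens_slide gr; [plia|plia|move=> c *; apply: tripod_slide; plia].
  rewrite gE; apply: (@slide_gens _ _ _ 2); [plia|plia|by move=> c *; apply: tripod_slide; plia|].
  have jE : j.+1 - 2 = (j - 2).+1 by plia.
  rewrite jE in sw; apply: perm_on_win_shrink sw _ => x xE.
  have [||||b] := @tripod_col0 j g x false; [plia|plia|by []|plia|].
  by rewrite gE slideE => -[].
rewrite i0 in gr *; have j0 : 0 < j by plia.
have [s [d [sw gt gd]]] := tripod_top j0 jm gr.
have [j1|j1] := leqP j 1%N.
  have jE : j = 1%N by plia.
  have /subsetP sub : G 0 j \subset <[tripod 0]>.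
    by apply: gens_sub => c; rewrite mem_index_iota => cI; have -> : c = 0 by [plia]; apply: cycle_id.
  move: (sub _ gl0); rewrite cycle2g ?tripod_order // !inE => /orP[]/eqP gE.
    by rewrite gE.
  by have := gt ord0; rewrite gE tripod0E.
have sw' : perm_on (win m 0 (j - 2)) s.
  have jE : j.-1 = (j - 2).+1 by plia.
  rewrite jE in sw; apply: perm_on_win_shrink sw _ => x xE.
  have [||||b] := @tripod_col0 j g x true; [plia|plia|by []|plia|].
  by rewrite gt => -[].
have sG : slide (option bool) s \in G 2 j.
  by apply: (@slide_gens _ _ _ 2); [plia|plia|move=> c *; apply: tripod_slide; plia|].
have sub c : 2 <= c -> G c j \subset G 1 j.
  by move=> c2; apply: gensS => e; rewrite !mem_index_iota; plia.
have sub0 : G 1 j \subset G 0 j by apply: gensS => e; rewrite !mem_index_iota; plia.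
have t1 : tripod 1%N \in G 1 j by rewrite mem_gens // mem_index_iota j1.
pose t := (slide (option bool) s)^-1 * tripod 1%N ^+ d.
have tG : t \in G 1 j by rewrite groupM ?groupX ?groupV // (subsetP (sub 2 _)).
have tE x : t (inl (x, true)) = inl (s^-1 x, true).
  rewrite permM -{1}(permKV s x) -slideE permK; case: (d).
    by rewrite expg1 tripod1E /= andbF.
  by rewrite expg0 perm1.
have tE' b : t (inr (Some b)) = inr (Some (b (+) d)).
  rewrite permM -{1}(slide_r s (Some b)) permK; case: (d).
    by rewrite expg1 tripod1E /= addbT.
  by rewrite expg0 perm1 addbF.
rewrite -(groupMr _ tG); set h := g * t.
have hG : h \in G 0 j by rewrite groupM // (subsetP sub0).
apply: (alt_on_even (tripod_alt j1 (ltnW jm))); last first.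
  move: h hG; apply: gens_ind; first by rewrite odd_perm1.
  move=> h c; rewrite mem_index_iota => cI he.
  by rewrite odd_permM tripod_even ?addbF //; plia.
have hT x : h (inl (x, true)) = inl (x, true) by rewrite permM gt tE permK.
have hS b : h (inr (Some b)) = inr (Some b).
  by rewrite permM gd tE' -addbA addbb addbF.
apply/subsetP=> -[[x b]|[b|]]; rewrite !inE ?hS ?eqxx //.
case: b; first by rewrite hT eqxx.
rewrite andbT; apply: contraR; rewrite -ltnNge => jx.
have [||||b hx] := @tripod_col0 j h x false; [plia|plia|by []|plia|].
case: b hx => hx; last by rewrite hx.
by have := hT x; rewrite -[in RHS]hx => /perm_inj[].
Qed.

Lemma tripod_stringC : stringC tripod m.+2.
Proof.
split=> [c cm|i j ij jm|i j ij jm].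
- exact: tripod_order.
- exact: tripod_comm.
exact: tripod_itv.
Qed.

Lemma tripod_Alt : G 0 m.+2 = 'Alt_X :> {set {perm X}}.
Proof.
apply/eqP; rewrite eqEsubset; apply/andP; split; apply/subsetP=> g.
  rewrite Alt_even; move: g; apply: gens_ind; first by rewrite odd_perm1.
  move=> h c; rewrite mem_index_iota => cI he.
  by rewrite odd_permM tripod_even ?addbF //; plia.
have mG c : c < m.+2 -> tripod c \in G 0 m.+2.
  by move=> cm; rewrite mem_gens // mem_index_iota.
have cG : cyc3 (inr None) (inl (ord0, false)) (inl (inord 1%N, false)) \in G 0 m.+2.
  apply: (subsetP (_ : G 1 m.+2 \subset _)); last by apply: tripod_cyc3; plia.
  by apply: gensS => c; rewrite !mem_index_iota; plia.
have u : uniq [:: inr None; inl (ord0, false); (inl (inord 1%N, false) : X)].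
  by rewrite /= !inE /= andbT -[inl _ == inl _]/((_, _) == (_, _)) xpair_eqE -val_eqE /= inordK.
have [|S [sub aS grow]] := alt_on_max (alt_on3 u cG).
  by rewrite cards3.
have S0 : inr None \in S by apply: (subsetP sub); rewrite !inE.
have S1 : inl (ord0, false) \in S by apply: (subsetP sub); rewrite !inE eqxx ?orbT.
have S2 : inl (inord 1%N, false) \in S by apply: (subsetP sub); rewrite !inE eqxx ?orbT.
have up b : inl (ord0, b) \in S -> forall k (x : C), x = k :> nat -> inl (x, b) \in S.
  move=> h0; elim=> [|k IH] x xk; first by have -> : x = ord0 by apply: val_inj.
  have km : k < m by have := ltn_ord x; plia.
  have kE : (inord k : C) = k :> nat by rewrite inordK; plia.
  have := grow _ (inl (inord k, b)) (inr None) (mG k.+2 _) (IH _ kE) S0.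
  rewrite /= slide_r slideE S0 => /(_ km isT).
  suff -> : adj m k (inord k) = x by [].
  by apply: val_inj; rewrite /= adj_val // kE eqxx xk.
have col0 (x : C) : inl (x, false) \in S by apply: up S1 _ _ (erefl _).
have ST : inr (Some true) \in S.
  (* This conjugate of generator 1 fixes column 1 in row [false] and takes [None] to [Some true].
     That point is fixed by generator 0, so the block becomes stable under generator 0. *)
  have gG : tripod 0 * tripod 1%N * tripod 0 \in G 0 m.+2 by rewrite !groupM ?mG.
  have := grow _ _ _ gG S0 S2; rewrite !permM !tripod0E !tripod1E /= andbF /=.
  exact.
have flip x : x \in S -> tripod0 x \in S.
  move=> xS; rewrite -tripod0E; apply: (grow _ _ _ (mG 0 _) xS ST) => //.
  by rewrite tripod0E.
have full x : x \in S.
  by case: x => [[x []]|[[]|]] //; [apply: (flip (inl (x, false)))|apply: (flip (inr None))].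
rewrite Alt_even => ge; apply: alt_on_even aS _ ge.
by apply/subsetP=> x _; apply: full.
Qed.

Lemma tripod_rep (k : nat) : reducible_rep 'Alt_X m.+2 k.
Proof.
exists tripod; split.
- exact: tripod_stringC.
- exact: tripod_Alt.
- move=> e; have := congr1 (fun g : {perm X} => g (inr None)) e.
  by rewrite /= !permM !tripod0E !tripod1E.
- move=> e; have := congr1 (fun g : {perm X} => g (inr None)) e.
  rewrite /= !permM tripod1E !slide_r tripod1E slideE => -[].
  by move/(congr1 val); rewrite /= adj_val.
move=> i i2 _ im; rewrite !tripod_slide; [|plia|plia].
by rewrite subSn //; apply: slide_odd; plia.
Qed.

End Tripod.

Lemma card_tripod m : #|{: ('I_m.+1 * bool) + option bool}| = (2 * m + 5)%N.
Proof. by rewrite card_sum card_prod card_ord card_bool card_option card_bool; plia. Qed.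

Section Fork.

Variable m : nat.
Local Notation C := 'I_m.+1.
Local Notation X := ((C * bool) + (bool * bool))%type.
Local Notation sl := (@slide m (bool * bool)%type).
Implicit Types (s t : {perm C}) (g : {perm X}).

(** The end (0, true) of a ladder is prolonged by the path (false, false), (false, true), (true,
    false), (true, true), with edges labelled 0, 1, 0, 1 in turn. Column 0 has no rung, so generator
    0 fixes (0, false) and (true, true) and is a product of m + 2 transpositions. *)
Definition fork0 (x : X) : X := match x with
  | inl (a, b) => if a == ord0 then (if b then inr (false, false) else inl (a, b))
                  else inl (a, ~~ b)
  | inr (false, false) => inl (ord0, true)
  | inr (true, true) => inr (true, true)
  | inr (p, q) => inr (~~ p, ~~ q) end.

Definition fork_swap (x : X) : X := match x with
  | inl _ => x | inr (p, q) => inr (p, ~~ q) end.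

Lemma fork0K : involutive fork0.
Proof.
move=> [[a b]|[[] []]] //=; have [->|a0] := eqVneq a ord0; first by case: b.
by rewrite /= (negbTE a0) negbK.
Qed.

Lemma fork_swapK : involutive fork_swap.
Proof. by move=> [[a b]|[p q]] //=; rewrite negbK. Qed.

Definition delta : {perm X} := invol_perm fork_swapK.

Definition fork c : {perm X} := match c with
  | 0 => invol_perm fork0K | 1 => sl (adj m 0) * delta
  | c.+2 => sl (adj m c.+1) end.

Local Notation G i j := (gens fork (index_iota i j)).

Lemma fork0E x : fork 0 x = fork0 x. Proof. exact: permE. Qed.

Lemma deltaE x : delta x = fork_swap x. Proof. exact: permE. Qed.

Lemma delta_sqr : delta * delta = 1.
Proof. by apply/permP=> x; rewrite permM !deltaE perm1 fork_swapK. Qed.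

Lemma slide_delta s : sl s * delta = delta * sl s.
Proof.
by apply/permP=> -[[a b]|[p q]]; rewrite !permM !(deltaE, slideE, slide_r).
Qed.

Lemma fork_slide c : 2 <= c -> fork c = sl (adj m (c - 1)).
Proof. by case: c => [|[|c]] // _; rewrite /= subn1. Qed.

Lemma fork1E x : fork 1%N x = match x with
  | inl (a, b) => inl (adj m 0 a, b) | inr (p, q) => inr (p, ~~ q) end.
Proof.
by case: x => [[a b]|[p q]]; rewrite /= permM ?slideE ?slide_r deltaE.
Qed.

Hypotheses (m2 : 2 <= m) (me : ~~ odd m).

Lemma fork_order c : c < m.+1 -> #[fork c] = 2.
Proof.
case: c => [|[|c]] cm; last by rewrite slide_order.
  apply: order_invol => [x|]; first by rewrite !fork0E fork0K.
  by apply/eqP=> /permP/(_ (inr (false, false))); rewrite fork0E perm1.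
apply: order_invol => [x|].
  rewrite !fork1E; case: x => [[a b]|[p q]]; last by rewrite negbK.
  by rewrite /adj tpermK.
by apply/eqP=> /permP/(_ (inr (false, false))); rewrite fork1E perm1.
Qed.

Lemma delta_even : odd_perm delta = false.
Proof.
have -> : delta = tperm (inr (false, false)) (inr (false, true)) *
    tperm (inr (true, false)) (inr (true, true)).
  apply/permP=> -[[a b]|[p q]]; rewrite deltaE permM /=; first by rewrite !tpermD.
  case: p q => [] [].
  - by rewrite [tperm (inr (false, _)) _ _]tpermD // tpermR.
  - by rewrite [tperm (inr (false, _)) _ _]tpermD // tpermL.
  - by rewrite tpermR tpermD.
  by rewrite tpermL tpermD.
by rewrite odd_permM !odd_tperm.
Qed.

Lemma fork_even c : c < m.+1 -> odd_perm (fork c) = false.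
Proof.
case: c => [|[|c]] cm; last by rewrite slide_even.
  rewrite odd_invol => [|x]; last by rewrite !fork0E fork0K.
  have -> : #|[set x | fork 0 x != x]| =
      #|~: [set (inl (ord0, false) : X); inr (true, true)]|.
    apply: eq_card => -[[a b]|[[] []]]; rewrite !inE fork0E //=.
    have [->|a0] := eqVneq a ord0; first by case: b => //=; rewrite eqxx.
    rewrite -![inl _ == inl _]/((_, _) == (_, _)) !xpair_eqE (negbTE a0).
    by rewrite eqxx /=; case: b.
  have := cardsC [set (inl (ord0, false) : X); inr (true, true)].
  by rewrite cards2 card_sum !card_prod card_ord card_bool; lia.
by rewrite odd_permM slide_even ?delta_even //; lia.
Qed.

Lemma fork_comm i j : i + 2 <= j -> j < m.+1 -> commute (fork i) (fork j).
Proof.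
move=> ij jm; have j2 : 2 <= j by lia.
have jE : j = (j - 2).+2 by lia.
case: i ij => [|[|i]] ij; rewrite {}jE in ij j2 jm *; set k := (j - 2)%N in ij j2 jm *.
- have a0 (x : C) : (adj m k.+1 x == ord0) = (x == ord0).
    by rewrite -!val_eqE /= adj_val; [split_ifs; lia|lia].
  have o0 : adj m k.+1 ord0 = ord0 by apply/eqP; rewrite a0.
  apply/permP=> -[[a b]|[[] []]]; rewrite !permM !fork0E ?slideE ?slide_r /= ?o0 //.
  + rewrite a0; have [->|aN] := eqVneq a ord0; last by rewrite slideE.
    by case: b; rewrite ?slideE ?slide_r ?o0.
- rewrite /commute /= -mulgA -slide_delta !mulgA; congr (_ * _).
  by apply: slide_comm; lia.
by apply: slide_comm; lia.
Qed.

(** In the product of generators 1 and 2 the column part has order 3 and commutes with the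
    involution [delta], so the cube is [delta]. *)
Lemma delta_gen j : 3 <= j -> delta \in G 1 j.
Proof.
move=> j3; have -> : delta = (fork 1%N * fork 2) ^+ 3.
  rewrite /= slide_delta -mulgA -slideM expgMn; last by rewrite /commute slide_delta.
  have -> : sl (adj m 0 * adj m 1) ^+ 3 = 1.
    by have := @adj_cube m 0 m2; rewrite !expgS expg0 !mulg1 -!slideM => ->; rewrite slide1.
  by rewrite mulg1 expgS -[delta ^+ 2]/(delta * delta) delta_sqr mulg1.
have fG c : 0 < c -> c < 3 -> fork c \in G 1 j.
  by move=> c0 c3; rewrite mem_gens // mem_index_iota; lia.
by rewrite groupX //; exact: (groupM (fG 1%N isT isT) (fG 2 isT isT)).
Qed.

Lemma fork_linked j s : 0 < j -> j <= m.+1 -> perm_on (win m 0 j.-1) s ->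
  exists d, sl s * delta ^+ d \in G 1 j.
Proof.
move=> j0 jm sw; have := @adj_gens m 0 j.-1 s _ sw; rewrite -ltnS prednK // => /(_ jm).
move: s {sw}; apply: gens_ind; first by exists 0; rewrite slide1 mulg1.
move=> s c; rewrite mem_index_iota => cI [d sG].
have dC : delta ^+ d * sl (adj m c) = sl (adj m c) * delta ^+ d.
  by apply/commute_sym/commuteX; rewrite /commute slide_delta.
have cG : fork c.+1 \in G 1 j by rewrite mem_gens // mem_index_iota; lia.
case: c cI dC cG => [|c] cI dC cG; have := groupM sG cG; rewrite /= -mulgA.
  by rewrite [X in _ * X]mulgA dC -mulgA -expgSr mulgA -slideM; exists d.+1.
by rewrite dC mulgA -slideM; exists d.
Qed.

Lemma fork_col j g (x : C) b : 0 < j -> j <= m.+1 -> g \in G 0 j -> j <= x ->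
  exists b', g (inl (x, b)) = inl (x, b').
Proof.
move=> j0 jm gG jx; move: g gG; apply: gens_ind; first by exists b; rewrite perm1.
move=> g c; rewrite mem_index_iota => cI [b' gE]; rewrite permM gE.
have xE : c < j -> 0 < c -> adj m c.-1 x = x.
  by move=> cj c0; apply: val_inj; rewrite /= adj_val; [split_ifs; lia|lia].
case: c cI xE => [|[|c]] cI xE.
- by exists (~~ b'); rewrite fork0E /= -val_eqE /= gtn_eqF //; lia.
- by exists b'; rewrite fork1E xE //; lia.
by exists b'; rewrite slideE xE.
Qed.

Lemma fork_top i j g : 0 < i -> j <= m.+1 -> g \in G i j ->
  exists s d, g = sl s * delta ^+ d /\ perm_on (win m i.-1 j.-1) s.
Proof.
move=> i0 jm; move: g; apply: gens_ind.
  by exists 1, 0; rewrite slide1 mulg1; split=> //; apply: perm_on1.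
move=> g c; rewrite mem_index_iota => cI [s [d [-> sw]]].
have dC t : delta ^+ d * sl t = sl t * delta ^+ d.
  by apply/commute_sym/commuteX; rewrite /commute slide_delta.
have aw : perm_on (win m i.-1 j.-1) (adj m c.-1) by apply: adj_win; lia.
exists (s * adj m c.-1), (if c == 1%N then d.+1 else d); split; last exact: perm_onM.
case: c cI aw => [|[|c]] cI aw; first lia.
  by rewrite /= -mulgA [X in _ * X = _]mulgA dC slideM expgSr !mulgA.
by rewrite /= -mulgA dC slideM mulgA.
Qed.

(** By [dihedral_commute], either [delta] or [delta * fork 1], which is the slide of columns 0 and
    1, would commute with [fork 0]; each is refuted at one point. *)
Lemma deltaN : delta \notin G 0 2.
Proof.
apply/negP=> dG.
have dG' : delta \in <<[set fork 0; fork 1%N]>>.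
  apply: subsetP dG; apply: (gens_sub (H := <<[set fork 0; fork 1%N]>>%G)) => c.
  by rewrite mem_index_iota; case: c => [|[|c]] // _; rewrite mem_gen // !inE eqxx ?orbT.
have [||||e|e] := dihedral_commute _ _ _ _ dG'.
- exact: fork_order.
- by apply: fork_order; lia.
- exact: delta_sqr.
- by rewrite /commute /= mulgA -slide_delta.
- have := congr1 (fun g : {perm X} => g (inr (true, true))) e.
  by rewrite /= !permM !deltaE !fork0E.
move/permP/(_ (inl (ord0, false))): e.
rewrite !permM !(fork0E, deltaE) /= slideE /=.
rewrite -val_eqE /= adj_val //=; last lia.
Qed.

(** For i = 0, elements of the second interval are slides times powers of [delta]. Once the window
    is shrunk, only the power of [delta] is in doubt: from j = 3 on [delta] is available, and below
    that [deltaN] excludes it. *)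
Lemma fork_itv i j : i < j -> j < m.+1 -> G i j :&: G i.+1 j.+1 \subset G i.+1 j.
Proof.
move=> ij jm; apply/subsetP=> g; rewrite inE => /andP[gl gr]; have j0 : 0 < j by lia.
have gl0 : g \in G 0 j by apply: subsetP gl; apply: gensS => c; rewrite !mem_index_iota; lia.
have jE : j = j.-1.+1 by lia.
have [i0|i0] := posnP i; last first.
  have [s gE sw] : exists2 s, g = sl s & perm_on (win m (i.+1 - 1) (j.+1 - 1)) s.
    by apply: gens_slide gr; [lia|lia|move=> c *; apply: fork_slide; lia].
  rewrite gE; apply: (@slide_gens _ _ _ 1%N); [lia|lia|by move=> c *; apply: fork_slide; lia|].
  rewrite !subn1 /= jE in sw; rewrite !subn1 /=.
  apply: perm_on_win_shrink sw _ => x xE.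
  have [|||b] := @fork_col j g x false j0; [lia|by []|lia|].
  by rewrite gE slideE => -[].
rewrite i0 in gr *.
have [s [d [gE sw]]] := fork_top (ltn0Sn 0) jm gr.
have dI (x : C) b : (delta ^+ d) (inl (x, b)) = inl (x, b).
  by elim: (d) => [|k IH]; rewrite ?expg0 ?perm1 // expgS permM deltaE.
have {}sw : perm_on (win m 0 j.-1) s.
  rewrite /= jE in sw; apply: perm_on_win_shrink sw _ => x xE.
  have [|||b] := @fork_col j g x false j0; [lia|by []|lia|].
  by rewrite gE permM slideE dI => -[].
have [e eG] := fork_linked j0 (ltnW jm) sw.
have hE : g = sl s * delta ^+ e * (delta ^- e * delta ^+ d) by rewrite gE !mulgA mulgK.
rewrite hE groupMl //; move: gl0; rewrite {}hE groupMl; last first.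
  by apply: subsetP eG; apply: gensS => c; rewrite !mem_index_iota; lia.
have : delta ^- e * delta ^+ d \in <[delta]> by rewrite groupM ?groupV ?mem_cycle.
rewrite cycle2g; last first.
  apply: order_invol => [x|]; first by rewrite !deltaE fork_swapK.
  by apply/eqP=> /permP/(_ (inr (true, true))); rewrite deltaE perm1.
rewrite !inE => /orP[]/eqP->; first by rewrite !group1.
have [j3|j3] := leqP 3 j; first by rewrite delta_gen.
move=> dG; case/negP: deltaN; apply: subsetP dG.
by apply: gensS => c; rewrite !mem_index_iota; lia.
Qed.

Lemma fork_stringC : stringC fork m.+1.
Proof.
split=> [c cm|i j ij jm|i j ij jm].
- exact: fork_order.
- exact: fork_comm.
exact: fork_itv.
Qed.

(** The element [c] is the commutator of [delta] and [fork 0], a 5-cycle on (0, true) and the four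
    added points. The slide of columns 0 and 1 is t' t with t' disjoint from this cycle, so the
    commutator with [c] only retains t and its conjugate, which share the point (1, true). *)
Lemma fork_cyc3 : cyc3 (inl (inord 1%N, true)) (inl (ord0, true)) (inr (true, true)) \in G 0 m.+1.
Proof.
have sub : G 1 m.+1 \subset G 0 m.+1.
  by apply: gensS => c; rewrite !mem_index_iota; lia.
have dG : delta \in G 0 m.+1 by apply: (subsetP sub); apply: delta_gen; lia.
have fG c : c < m.+1 -> fork c \in G 0 m.+1.
  by move=> cm; rewrite mem_gens // mem_index_iota.
have tG : sl (adj m 0) \in G 0 m.+1.
  have := fG 1%N (ltnW m2); rewrite -(groupMr _ dG) /= -mulgA delta_sqr mulg1.
  exact.
pose c := delta * delta ^ fork 0.
have cG : c \in G 0 m.+1 by rewrite groupM // groupJ // fG.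
have cE x : c x = fork0 (fork_swap (fork0 (fork_swap x))).
  have f0V : (fork 0)^-1 = fork 0.
    apply: (mulIg (fork 0)); rewrite mulVg.
    by apply/permP=> y; rewrite perm1 permM !fork0E fork0K.
  by rewrite /c conjgE f0V !permM !(fork0E, deltaE).
set b2 : X := inl (inord 1%N, true); set h2 : X := inl (ord0, true).
pose t := tperm h2 b2; pose t' := tperm (inl (ord0, false)) (inl (inord 1%N, false)) : {perm X}.
have i0 : (inord 0 : C) = ord0 by apply: val_inj; rewrite /= inordK.
have tE : sl (adj m 0) = t' * t by rewrite /adj slide_tperm i0.
have E1 : (inord 1%N == ord0 :> C) = false by rewrite -val_eqE /= inordK //; lia.
have ct' : c ^ t' = c.
  have e : t' ^ c = t' by rewrite tpermJ !cE /= E1 /= E1.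
  by apply/conjg_fixP/commgP/commute_sym/commgP/conjg_fixP.
have ch : c (inr (true, true)) = h2 by rewrite cE.
have cb : c b2 = b2 by rewrite cE /= E1 /= E1.
suff <- : c ^ sl (adj m 0) * c^-1 = cyc3 b2 h2 (inr (true, true)).
  by rewrite groupM ?groupV // groupJ.
have -> : c ^ sl (adj m 0) * c^-1 = t * t ^ c^-1.
  by rewrite tE conjgM ct' !conjgE tpermV invgK !mulgA.
by rewrite tpermJ -{1}ch -{1}cb !permK /t /cyc3 (tpermC h2) (tpermC _ b2).
Qed.

Lemma fork_Alt : G 0 m.+1 = 'Alt_X :> {set {perm X}}.
Proof.
apply/eqP; rewrite eqEsubset; apply/andP; split; apply/subsetP=> g.
  rewrite Alt_even; move: g; apply: gens_ind; first by rewrite odd_perm1.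
  move=> h c; rewrite mem_index_iota => cI he.
  by rewrite odd_permM fork_even ?addbF //; plia.
have mG c : c < m.+1 -> fork c \in G 0 m.+1.
  by move=> cm; rewrite mem_gens // mem_index_iota.
have E1 : (inord 1%N == ord0 :> C) = false by rewrite -val_eqE /= inordK //; plia.
have dG : delta \in G 0 m.+1.
  apply: (subsetP (_ : G 1 m.+1 \subset _)); last by apply: delta_gen; plia.
  by apply: gensS => c; rewrite !mem_index_iota; plia.
have tG c : c < m -> sl (adj m c) \in G 0 m.+1.
  case: c => [|c] cm; last exact: (mG c.+2).
  have := mG 1%N (ltnW m2); rewrite -(groupMr _ dG) /= -mulgA delta_sqr mulg1.
  exact.
have u : uniq [:: (inl (inord 1%N, true) : X); inl (ord0, true); inr (true, true)].
  by rewrite /= !inE /= andbT -![inl _ == inl _]/((_, _) == (_, _)) xpair_eqE E1.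
have [|S [sub aS grow]] := alt_on_max (alt_on3 u fork_cyc3).
  by rewrite cards3.
have S1 : inl (inord 1%N, true) \in S by apply: (subsetP sub); rewrite !inE eqxx.
have S6 : inr (true, true) \in S by apply: (subsetP sub); rewrite !inE eqxx ?orbT.
have flip x : x \in S -> fork0 x \in S.
  by move=> xS; rewrite -fork0E; apply: (grow _ _ _ (mG 0 _) xS S6); rewrite ?fork0E.
have swap x : x \in S -> fork_swap x \in S.
  by move=> xS; rewrite -deltaE; apply: (grow _ _ _ dG xS S1); rewrite ?deltaE.
have step c x b : c < m -> inl (x, b) \in S -> inl (adj m c x, b) \in S.
  by move=> cm xS; rewrite -slideE; apply: (grow _ _ _ (tG c cm) xS S6); rewrite slide_r.
have S0 b : inl (ord0, b) \in S.
  have <- : adj m 0 (inord 1%N) = ord0.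
    by apply: val_inj; rewrite /= adj_val ?inordK //; plia.
  apply: step; first plia.
  by case: b => //; have := flip _ S1; rewrite /= E1.
have up b k : forall x : C, x = k :> nat -> inl (x, b) \in S.
  elim: k => [|k IH] x xk; first by have -> : x = ord0 by apply: val_inj.
  have km : k < m by have := ltn_ord x; plia.
  have kE : (inord k : C) = k :> nat by rewrite inordK; plia.
  have <- : adj m k (inord k) = x by apply: val_inj; rewrite /= adj_val // kE eqxx xk.
  by apply: step => //; apply: IH.
have S5 : inr (true, false) \in S by apply: (swap (inr (true, true))).
have S4 : inr (false, true) \in S by apply: (flip (inr (true, false))).
have S3 : inr (false, false) \in S by apply: (swap (inr (false, true))).
rewrite Alt_even => ge; apply: alt_on_even aS _ ge.
apply/subsetP=> x _; case: x => [[x b]|[[] []]] //; exact: up (erefl _).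
Qed.

Lemma fork_rep (k : nat) : reducible_rep 'Alt_X m.+1 k.
Proof.
exists fork; split.
- exact: fork_stringC.
- exact: fork_Alt.
- move/permP/(_ (inr (true, true))).
  by rewrite !permM !(fork0E, slide_r, deltaE).
- move/permP/(_ (inl (ord0, true))).
  rewrite /= !permM !(slideE, deltaE) /= => -[] /(congr1 val) /=.
  rewrite !adj_val //; try plia; by split_ifs; plia.
move=> i i2 _ im; rewrite !fork_slide; [|plia|plia].
by rewrite subSn; [apply: slide_odd|]; plia.
Qed.

End Fork.

Lemma card_fork m : #|{: ('I_m.+1 * bool) + (bool * bool)}| = (2 * m + 6)%N.
Proof. by rewrite card_sum !card_prod card_ord card_bool; plia. Qed.

(** * Small degrees and conclusion *)

Local Open Scope nat_scope.

(** The group A_5 of the hemi-icosahedron, of type {3,5}, acting on its six vertices. *)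
Definition hexad : seq (seq (nat * nat)) :=
  [:: [:: (0, 1); (4, 5)]; [:: (0, 2); (3, 4)]; [:: (0, 1); (2, 3)]].

(* The reflections of the 3-cube acting on its vertices, in binary. *)
Definition cube : seq (seq (nat * nat)) :=
  [:: [:: (0, 1); (2, 3); (4, 5); (6, 7)]; [:: (1, 2); (5, 6)]; [:: (2, 4); (3, 5)]].

Definition icosahedron : seq (seq (nat * nat)) :=
  [:: [:: (0, 1); (3, 5); (6, 8); (9, 10)]; [:: (1, 2); (3, 4); (6, 7); (10, 11)];
      [:: (2, 7); (3, 8); (4, 11); (5, 6)]].

(* PSL(2, 11) in degree 11, acting on the vertices of the 11-cell. *)
Definition l2_11 : seq (seq (nat * nat)) :=
  [:: [:: (0, 1); (2, 5); (6, 10); (8, 9)]; [:: (1, 4); (3, 6); (5, 7); (8, 9)];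
      [:: (2, 5); (4, 7); (6, 8); (9, 10)]; [:: (2, 10); (3, 7); (5, 6); (8, 9)]].

Lemma hexad_arm : arm 3 (fun c => prod_tperm 5 (nth [::] hexad c)) (inord 5).
Proof. by apply: (@arm_table _ hexad 1000); vm_compute. Qed.

Lemma cube_arm : arm 3 (fun c => prod_tperm 7 (nth [::] cube c)) (inord 7).
Proof. by apply: (@arm_table _ cube 1000); vm_compute. Qed.

Lemma l2_11_arm : arm 4 (fun c => prod_tperm 10 (nth [::] l2_11 c)) (inord 0).
Proof. by apply: (@arm_table _ l2_11 1000); vm_compute. Qed.

Lemma ico_arm : arm 3 (fun c => prod_tperm 11 (nth [::] icosahedron c)) (inord 0).
Proof. by apply: (@arm_table _ icosahedron 1000); vm_compute. Qed.

(* Found by computer search. *)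
Definition twelve : seq (seq (nat * nat)) :=
  [:: [:: (0, 6); (1, 8); (2, 7); (3, 11); (4, 10); (5, 9)];
      [:: (0, 10); (1, 11); (2, 4); (3, 9); (5, 8); (6, 7)];
      [:: (0, 6); (1, 4); (2, 5); (3, 11); (7, 9); (8, 10)];
      [:: (0, 10); (1, 8); (2, 7); (3, 9); (4, 6); (5, 11)]].

(** Only intervals of at most three generators are enumerated, so the size of A_12 does not
    matter. *)
Lemma twelve_stringC : stringC (fun c => prod_tperm 11 (nth [::] twelve c)) 4.
Proof. by apply: (@stringC_table _ twelve 1000); vm_compute. Qed.

Lemma hexad_trans : arm_transitive 3 (fun c => prod_tperm 5 (nth [::] hexad c)) (inord 5).
Proof. by apply: (@arm_transitive_table _ hexad 1000). Qed.

Lemma cube_trans : arm_transitive 3 (fun c => prod_tperm 7 (nth [::] cube c)) (inord 7).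
Proof. by apply: (@arm_transitive_table _ cube 1000). Qed.

Lemma ico_trans : arm_transitive 3 (fun c => prod_tperm 11 (nth [::] icosahedron c)) (inord 0).
Proof. by apply: (@arm_transitive_table _ icosahedron 1000). Qed.

Lemma l2_11_trans : arm_transitive 4 (fun c => prod_tperm 10 (nth [::] l2_11 c)) (inord 0).
Proof. by apply: (@arm_transitive_table _ l2_11 1000); vm_compute. Qed.

Definition twelve_gen c := prod_tperm 11 (nth [::] twelve c).

Lemma twelve_Alt : gens twelve_gen (index_iota 0 4) = 'Alt_('I_12) :> {set {perm 'I_12}}.
Proof.
(* The seventh power of the product of the four generators is the 3-cycle (2 10 11). *)
apply: (@Alt_table 11 twelve (flatten (nseq 7 (iota 0 4))) 2 10 11
  [:: ([:: 0; 1], 2, 10); ([:: 0; 1], 11, 2); ([:: 0; 1], 9, 2); ([:: 2], 2, 10);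
      ([:: 0], 2, 9); ([:: 0], 10, 2); ([:: 0], 11, 2); ([:: 0], 6, 2); ([:: 0], 8, 2)]).
by vm_compute.
Qed.

Lemma twelve_rep : reducible_rep 'Alt_('I_12) 4 1.
Proof.
exists twelve_gen; split.
- exact: twelve_stringC.
- exact: twelve_Alt.
- by apply: (@table_nc 11 twelve 0 1 0); vm_compute.
- by apply: (@table_nc 11 twelve 1 2 0); vm_compute.
move=> [|[|[|i]]] // _ _ _; by apply: (@odd_order_table 11 twelve 2).
Qed.

Section GluedRep.

Variables (V : finType) (k : nat) (tau : nat -> {perm V}) (v0 : V) (t : nat).
Hypotheses (aT : arm k tau v0) (tT : arm_transitive k tau v0).

(** The path takes positions 0 and 1, so the products consumed by reductions are the consecutive
    ones of [tau], from its beginning. *)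
Lemma path_glued_rep s : 0 < s ->
  (forall c, c < t -> c.+1 < k -> odd #[tau c * tau c.+1]) ->
  reducible_rep 'Alt_('I_(4 * s + #|V|)) (k + 2) t.
Proof.
move=> s0 od; have aP := path_arm s0; have tP := @path_transitive s s0.
have cX : #|glued 'I_(4 * s).+1 v0| = 4 * s + #|V| by rewrite card_glued card_ord.
apply: (transport_rep cX); rewrite addnC; exists (glue 2 (path_gen s0) ord0 tau v0); split.
- exact: glue_stringC aP aT.
- exact: glue_Alt aP aT tP tT.
- by move/commute_emb/commute_sym; apply: path_nc.
- exact: glue_nc aP aT.
move=> i i2 it ik; rewrite /glue !ifN -?leqNgt ?(leqW i2) // -embM order_emb subSn //.
by apply: od; lia.
Qed.

(** The free end of the ladder comes first. Positions i and i + 1 carry ladder generators m - 1 - i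
    and m - 2 - i, and t + z + 4 <= m keeps these above z, where consecutive products have order
    3. *)
Lemma ladder_glued_rep m z : z <= 1 -> z + 3 <= m -> odd (m - z) ->
  (t == 0) || (t + z + 4 <= m) ->
  reducible_rep 'Alt_('I_(2 * m + 1 + #|V|)) (m + k) t.
Proof.
move=> z1 zm mz tz.
have aL : arm m (ladder m z) (ord0, false) by apply: ladder_arm; lia.
have tL := ladder_transitive zm.
have cX : #|glued ('I_m.+1 * bool)%type v0| = 2 * m + 1 + #|V|.
  by rewrite card_glued card_prod card_ord card_bool; lia.
have gE i : i < m -> glue m (ladder m z) (ord0, false) tau v0 i =
    emb (inU_inj (v0 := v0)) (ladder m z (m.-1 - i)) by rewrite /glue => ->.
apply: (transport_rep cX); exists (glue m (ladder m z) (ord0, false) tau v0); split.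
- exact: glue_stringC aL aT.
- exact: glue_Alt aL aT tL tT.
- rewrite !gE; [|lia|lia]; move/commute_emb/commute_sym.
  by rewrite (_ : m.-1 - 0 = (m.-1 - 1).+1); [apply: ladder_nc|]; lia.
- rewrite !gE; [|lia|lia]; move/commute_emb/commute_sym.
  by rewrite (_ : m.-1 - 1 = (m.-1 - 2).+1); [apply: ladder_nc|]; lia.
move=> i i2 it ik; rewrite !gE; [|lia|lia].
rewrite -embM order_emb (_ : m.-1 - i = (m.-1 - i.+1).+1); last lia.
(* The reversal exchanges the two factors; conjugation by one of them restores the order used in
   [ladder_odd]. *)
set a := _.-1 - _; rewrite -(orderJ _ (ladder m z a.+1)) conjgE -mulgA mulKg.
by apply: ladder_odd; rewrite /a; lia.
Qed.

End GluedRep.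

Theorem theorem7p1 (r n : nat) (hr : 3 <= r) (hn : 2 * r + 1 <= n)
    (hn12 : 12 <= n) :
  has_string_C_group_rep ('Alt_('I_n))%G r.
Proof.
have : n %% 4 < 4 by rewrite ltn_mod.
case nE: (n %% 4) => [|[|[|[|k]]]] // _.
(* For n = 2 m + 6 with m odd, a ladder with z = 0 and a path on 5 points reach the top rank m + 2,
   and reductions go down to rank 6. Ranks 3 to 5 use the icosahedron, which together with a path
   needs 16 points. *)
- have [n12|n16] := leqP n 12.
    have e : n = 12 by lia.
    rewrite {n12 hn12 nE}e in hn *.
    have [r4|r5] := leqP r 4; first by apply: (rank_reduction twelve_rep); lia.
    have -> : r = 5 by lia.
    have := @ladder_glued_rep _ _ _ _ 0 (path_arm (isT : 0 < 1)) (@path_transitive 1 isT) 3 0.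
    rewrite card_ord => /(_ isT isT isT isT) h; exact: (rank_reduction h).
  have [r5|r6] := leqP r 5.
    have [s s0 ->] : exists2 s, 0 < s & n = 4 * s + 12 by exists ((n - 12) %/ 4); lia.
    have := @path_glued_rep _ _ _ _ 2 ico_arm ico_trans s s0; rewrite card_ord => h.
    apply: (rank_reduction (h _)); [|lia|by []].
    by move=> [|[|c]] // _ _; apply: (@odd_order_table 11 icosahedron).
  have [m mI ->] : exists2 m, [&& odd m, r <= m + 2 & 5 <= m] & n = 2 * m + 1 + 5.
    by exists ((n - 6) %/ 2); lia.
  have := @ladder_glued_rep _ _ _ _ (m + 2 - r) (path_arm (isT : 0 < 1))
    (@path_transitive 1 isT) m 0.
  rewrite card_ord => h; apply: (rank_reduction (h _ _ _ _)); lia.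
(* Here n = 2 m + 5 with m even: the tripod has rank m + 2, the largest r with 2 r + 1 <= n, and can
   be reduced down to rank 3. *)
- have [m /andP[me m0] ->] : exists2 m, ~~ odd m && (r <= m.+2) & n = 2 * m + 5.
    by exists ((n - 5) %/ 2); lia.
  have h := transport_rep (card_tripod m) (@tripod_rep m _ me (m.+2 - r)).
  by apply: (rank_reduction (h _)) => //; lia.
(* The fork reaches every rank but the largest, n = 2 r + 2. There m = r - 2 is even, so the ladder
   must be linked at z = 1. *)
- have [rn|nr] := leqP (2 * r + 4) n.
    have [m mI ->] : exists2 m, [&& ~~ odd m, 2 <= m & r <= m.+1] & n = 2 * m + 6.
      by exists ((n - 6) %/ 2); lia.
    have h := transport_rep (card_fork m) (@fork_rep m _ _ (m.+1 - r)).
    apply: (rank_reduction (h _ _)); lia.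
  have [m mI ->] : exists2 m, [&& ~~ odd m, r == m + 2 & 4 <= m] & n = 2 * m + 1 + 5.
    by exists (r - 2); lia.
  have := @ladder_glued_rep _ _ _ _ 0 (path_arm (isT : 0 < 1)) (@path_transitive 1 isT) m 1.
  rewrite card_ord => h; apply: (rank_reduction (h _ _ _ _)); lia.
(* The 11-cell gives ranks 3 to 6. From rank 7 on, the cube serves for 2 r + 3 <= n, with m odd and
   z = 0; the last case n = 2 r + 1 uses the hexad, with m = r - 3 even and z = 1. *)
have [r6|r7] := leqP r 6.
  have [s s0 ->] : exists2 s, 0 < s & n = 4 * s + 11 by exists ((n - 11) %/ 4); lia.
  have := @path_glued_rep _ _ _ _ 3 l2_11_arm l2_11_trans s s0; rewrite card_ord => h.
  apply: (rank_reduction (h _)); [|lia|by []].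
  by move=> [|[|[|c]]] // _ _; apply: (@odd_order_table 10 l2_11).
have [rn|nr] := leqP (2 * r + 3) n.
  have [m mI ->] : exists2 m, [&& odd m, r <= m + 3 & 5 <= m] & n = 2 * m + 1 + 8.
    by exists ((n - 9) %/ 2); lia.
  have := @ladder_glued_rep _ _ _ _ (m + 3 - r) cube_arm cube_trans m 0.
  rewrite card_ord => h; apply: (rank_reduction (h _ _ _ _)); lia.
have [m mI ->] : exists2 m, [&& ~~ odd m, r == m + 3 & 4 <= m] & n = 2 * m + 1 + 6.
  by exists (r - 3); lia.
have := @ladder_glued_rep _ _ _ _ 0 hexad_arm hexad_trans m 1.
rewrite card_ord => h; apply: (rank_reduction (h _ _ _ _)); lia.
Qed.
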